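(* Let the setting, the objective $L$ and Algorithm 1 be as described in the context. Assume that $L$ is bounded below, that every entry of the matrix-valued map $\theta\mapsto\Phi(\theta)\in\mathbb{R}^{n\times n}$ is a twice continuously differentiable function of $\theta\in\mathbb{R}^P$, that $W\in\mathbb{R}^{(m+1)n\times(m+1)N}$ satisfies $WW^\intercal=I_{(m+1)n}$, and that there are constants $0<\lambda_{\min}\le\lambda_{\max}$ with $\lambda_{\min}\le\lambda_x^k\le\lambda_{\max}$ for all $k\in\mathbb{N}$ and $\lambda_{\min}\le\lambda_\theta\le\lambda_{\max}$. Then the sequence $(x^k,\theta^k)_{k\in\mathbb{N}}$ generated by Algorithm 1 is well defined (every minimization problem in the algorithm has a minimizer, and for every $k$ and $j$ a positive integer $i$ satisfying the acceptance inequality exists), and: 1. For all $k\ge 0$, $$L(x^{k+1},\theta^{k+1})+\frac{\lambda_{\min}}{2}\Big[\kappa\,\|\theta^{k+1}-\theta^k\|_2^2+H_\mu\big(W^\intercal(x^{k+1}-x^k)\big)\Big]\le L(x^k,\theta^k);$$ in particular $L(x^k,\theta^k)$ is non-increasing. 2. $\displaystyle\lim_{k\to\infty}\big(\|x^{k+1}-x^k\|_2+\|\theta^{k+1}-\theta^k\|_2\big)=0.$ 3. If in addition $L$ has the Kurdyka–Łojasiewicz property and the sequence $(x^k)_{k\in\mathbb{N}}$ is bounded, then $(x^k,\theta^k)_{k\in\mathbb{N}}$ converges to a critical point $(x^*,\theta^* )$ of $L$, i.e. a point with $0\in\partial L(x^*,\theta^* )$ (limiting subdifferential).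
   Context: Fixed positive integers: $m$ (number of observations), $n$ (number of pixels), $M\le n$ (measurements per observation), $P$ (number of transformation parameters per observation), $N\ge n$. Given matrices $A_1,\dots,A_m\in\mathbb{R}^{M\times n}$, a measurement vector $y=(y_1^\intercal,\dots,y_m^\intercal)^\intercal\in\mathbb{R}^{mM}$, and a map $\Phi:\mathbb{R}^P\to\mathbb{R}^{n\times n}$ (an interpolation/warping matrix depending on transformation parameters). For $\theta=(\theta_1^\intercal,\dots,\theta_m^\intercal)^\intercal\in\mathbb{R}^{mP}$ with $\theta_j\in\mathbb{R}^P$, and $x=(x_0^\intercal,x_1^\intercal,\dots,x_m^\intercal)^\intercal\in\mathbb{R}^{(m+1)n}$ with $x_j\in\mathbb{R}^n$, let $A(\theta)\in\mathbb{R}^{mM\times(m+1)n}$ be the block matrix whose $j$-th block row is $[A_j\Phi(\theta_j),\,0,\dots,0,\,A_j,\,0,\dots,0]$ ($A_j$ in the block column of $x_j$), so $(A(\theta)x)_j=A_j\Phi(\theta_j)x_0+A_jx_j$. Constraint set: for each $j$, bounds $\underline\theta_j\le\overline\theta_j$ in $\mathbb{R}^P$ and the box $C_j=\{\theta_j\in\mathbb{R}^P:\underline\theta_j\le\theta_j\le\overline\theta_j\}$ (componentwise); $C=C_1\times\dots\times C_m$, and $\iota_C$ its indicator function ($0$ on $C$, $+\infty$ outside). Objective: $L(x,\theta)=R(x)+\kappa\,\|A(\theta)x-y\|_2^2+\iota_C(\theta)$, where $\kappa>0$ and $R:\mathbb{R}^{(m+1)n}\to\mathbb{R}\cup\{+\infty\}$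 is proper, lower semicontinuous and convex. Huber function with parameter $\mu>0$: for $\alpha\in\mathbb{R}^{(m+1)N}$, $H_\mu(\alpha)=\sum_i h_i$ with $h_i=\alpha_i^2/(2\mu)$ if $|\alpha_i|<\mu$ and $h_i=|\alpha_i|+\mu/2$ otherwise. $W\in\mathbb{R}^{(m+1)n\times(m+1)N}$ is a given matrix. For $k\ge0$ and $j=1,\dots,m$: $q_j^{k+1}(\theta_j)=\|A_j\Phi(\theta_j)x_0^{k+1}+A_jx_j^{k+1}-y_j\|_2^2$; $J(\theta_j)\in\mathbb{R}^{n\times P}$ is the matrix whose $p$-th column is $\partial_{\theta_{pj}}\Phi(\theta_j)\,x_0^{k+1}$; $\mathcal{H}(\theta_j)=2(A_jJ(\theta_j))^\intercal(A_jJ(\theta_j))$. Algorithm 1: inputs $y,W,\kappa$, parameters $\lambda_x^k>0$ ($k\in\mathbb{N}$), $\lambda_\theta>0$, and the bounds. Initialize $x^0=0$, $\theta^0\in C$. For $k=0,1,2,\dots$: (1) choose $x^{k+1}\in\arg\min_{x}\; L(x,\theta^k)+\frac{\lambda_x^k}{2}H_\mu\big(W^\intercal(x-x^k)\big)$; (2) for each $j=1,\dots,m$, let $i$ be the smallest positive integer such that the point $\theta_j^{k+1}=\arg\min_{\theta_j\in C_j}\langle\nabla q_j^{k+1}(\theta_j^k),\theta_j-\theta_j^k\rangle+\frac12\langle\theta_j-\theta_j^k,[\mathcal{H}(\theta_j^k)+2^i\lambda_\theta I_P](\theta_j-\theta_j^k)\rangle$ satisfies $q_j^{k+1}(\theta_j^{k+1})\le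 q_j^{k+1}(\theta_j^k)+\langle\nabla q_j^{k+1}(\theta_j^k),\theta_j^{k+1}-\theta_j^k\rangle+\frac12\langle\theta_j^{k+1}-\theta_j^k,[\mathcal{H}(\theta_j^k)+(2^i-1)\lambda_\theta I_P](\theta_j^{k+1}-\theta_j^k)\rangle$, and set $\theta_j^{k+1}$ accordingly. Kurdyka–Łojasiewicz property: in the sense of Attouch et al. (e.g. satisfied by semi-algebraic functions).
   Formalization: The Huber function is taken as |α_i|−μ/2 (not +μ/2) for |α_i|≥μ, since with the plus sign step (1) may have no minimizer; well-definedness is stated as: from any admissible history, step k can be carried out for some minimizer x^{k+1}. *)

(* Defs.v *)
(* Stdlib (classical reals).  All vectors are  nat -> R ; a vector of
   R^d is read through its coordinates 0..d-1 only (every norm, inner product,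
   matrix product below only reads those coordinates). *)
From Stdlib Require Import Reals Lra Lia Classical ClassicalEpsilon.
Open Scope R_scope.

Definition vec := nat -> R.

Fixpoint sumR (d : nat) (f : nat -> R) : R :=
  match d with O => 0 | S d' => sumR d' f + f d' end.

Definition dot (d : nat) (u v : vec) : R := sumR d (fun i => u i * v i).
Definition sqn (d : nat) (u : vec) : R := dot d u u.
Definition nrm (d : nat) (u : vec) : R := sqrt (sqn d u).
Definition vsub (u v : vec) : vec := fun i => u i - v i.
Definition zerov : vec := fun _ => 0.
(* coordinates >= d set to 0: identifies nat -> R with R^d *)
Definition trunc (d : nat) (u : vec) : vec :=
  fun i => if Nat.ltb i d then u i else 0.
Definition upd (u : vec) (p : nat) (t : R) : vec :=
  fun i => if Nat.eqb i p then t else u i.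
Definition matvec (c : nat) (A : nat -> nat -> R) (u : vec) : vec :=
  fun r => sumR c (fun j => A r j * u j).
Definition quad (d : nat) (Mx : nat -> nat -> R) (u : vec) : R :=
  sumR d (fun p => sumR d (fun p' => u p * Mx p p' * u p')).
Definition shiftI (Mx : nat -> nat -> R) (c : R) : nat -> nat -> R :=
  fun p p' => Mx p p' + (if Nat.eqb p p' then c else 0).

Inductive ereal := Fin (r : R) | PInf.
Definition eadd (a b : ereal) : ereal :=
  match a, b with Fin x, Fin y => Fin (x + y) | _, _ => PInf end.
Definition ele (a b : ereal) : Prop :=
  match a, b with
  | Fin x, Fin y => x <= y | _, PInf => True | PInf, Fin _ => False end.
Definition elt (a b : ereal) : Prop :=
  match a, b with
  | Fin x, Fin y => x < y | Fin _, PInf => True | PInf, _ => False end.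

Definition proper_fun (F : vec -> ereal) : Prop := exists x, F x <> PInf.
Definition lsc_fun (d : nat) (F : vec -> ereal) : Prop :=
  forall x r, elt (Fin r) (F x) ->
    exists del, del > 0 /\ forall z, nrm d (vsub z x) < del -> elt (Fin r) (F z).
Definition convex_fun (F : vec -> ereal) : Prop :=
  forall x z a b t, F x = Fin a -> F z = Fin b -> 0 <= t <= 1 ->
    ele (F (fun i => t * x i + (1 - t) * z i)) (Fin (t * a + (1 - t) * b)).
Definition cont_fun (d : nat) (g : vec -> R) : Prop :=
  forall th eps, eps > 0 -> exists del, del > 0 /\
    forall th', nrm d (vsub th' th) < del -> Rabs (g th' - g th) < eps.

Definition huber_term (mu a : R) : R :=
  if Rlt_dec (Rabs a) mu then a ^ 2 / (2 * mu) else Rabs a - mu / 2.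
Definition Huber (mu : R) (d : nat) (alpha : vec) : R :=
  sumR d (fun i => huber_term mu (alpha i)).

Record problem := Problem {
  pm : nat;  pn : nat;  pM : nat;  pP : nat;  pN : nat;
  pA : nat -> nat -> nat -> R;      (* pA j r c = (A_j)_{r c}, j = 1..m *)
  py : vec;                         (* y_j(r) = py ((j-1) M + r)        *)
  pPhi : vec -> nat -> nat -> R;
  pdPhi : nat -> vec -> nat -> nat -> R; (* pdPhi p theta = d Phi/d theta_p *)
  plo : vec;  phi : vec;            (* bounds, layout of theta          *)
  pR : vec -> ereal;
  pkappa : R;  pmu : R;
  pW : nat -> nat -> R }.

Section Obj.
Variable pr : problem.
Let m := pm pr.  Let n := pn pr.  Let M := pM pr.  Let P := pP pr.

Definition dimx : nat := (S m * n)%nat.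
Definition dimt : nat := (m * P)%nat.
Definition dimW : nat := (S m * pN pr)%nat.

(* x_j, j = 0..m *)
Definition xblk (x : vec) (j : nat) : vec := fun i => x (j * n + i)%nat.
(* theta_j, j = 1..m *)
Definition tblk (t : vec) (j : nat) : vec := fun p => t ((j - 1) * P + p)%nat.
Definition yblk (j : nat) : vec := fun r => py pr ((j - 1) * M + r)%nat.
Definition Aj (j : nat) : nat -> nat -> R := pA pr j.
Definition Phit (t : vec) : nat -> nat -> R := pPhi pr (trunc P t).

Definition resid (j : nat) (x : vec) (t : vec) : vec :=
  fun r => matvec n (Aj j) (matvec n (Phit t) (xblk x 0)) r
           + matvec n (Aj j) (xblk x j) r - yblk j r.
Definition qfun (j : nat) (x : vec) (t : vec) : R := sqn M (resid j x t).
(* || A(theta) x - y ||^2 *)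
Definition fit (x th : vec) : R :=
  sumR m (fun j' => qfun (S j') x (tblk th (S j'))).

Definition inC (th : vec) : Prop :=
  forall i, (i < dimt)%nat -> plo pr i <= th i <= phi pr i.
Definition inCj (j : nat) (t : vec) : Prop :=
  forall p, (p < P)%nat ->
    plo pr ((j - 1) * P + p)%nat <= t p <= phi pr ((j - 1) * P + p)%nat.

Definition Rt (x : vec) : ereal := pR pr (trunc dimx x).

Definition Lobj (x th : vec) : ereal :=
  if excluded_middle_informative (inC th)
  then eadd (Rt x) (Fin (pkappa pr * fit x th)) else PInf.

Definition Wt (u : vec) : vec := fun c => sumR dimx (fun r => pW pr r c * u r).
Definition HW (u : vec) : R := Huber (pmu pr) dimW (Wt u).

Definition Step1 (lam : R) (xk thk xk1 : vec) : Prop :=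
  forall x', ele (eadd (Lobj xk1 thk) (Fin (lam / 2 * HW (vsub xk1 xk))))
                 (eadd (Lobj x' thk) (Fin (lam / 2 * HW (vsub x' xk)))).

Definition Jmat (x : vec) (t : vec) : nat -> nat -> R :=
  fun c p => matvec n (pdPhi pr p t) (xblk x 0) c.
Definition AJ (j : nat) (x t : vec) : nat -> nat -> R :=
  fun r p => sumR n (fun c => Aj j r c * Jmat x t c p).
Definition Hmat (j : nat) (x t : vec) : nat -> nat -> R :=
  fun p p' => 2 * sumR M (fun r => AJ j x t r p * AJ j x t r p').
(* gradient of q_j at t (chain rule): 2 (A_j J(t))^T (A_j Phi(t) x_0 + A_j x_j - y_j) *)
Definition gradq (j : nat) (x t : vec) : vec :=
  fun p => 2 * sumR M (fun r => AJ j x t r p * resid j x t r).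

Definition model (lamt : R) (j : nat) (x tk : vec) (i : nat) (t : vec) : R :=
  dot P (gradq j x tk) (vsub t tk)
  + 1 / 2 * quad P (shiftI (Hmat j x tk) (2 ^ i * lamt)) (vsub t tk).
Definition sub_argmin (lamt : R) (j : nat) (x tk : vec) (i : nat) (t : vec) : Prop :=
  inCj j t /\ forall t', inCj j t' -> model lamt j x tk i t <= model lamt j x tk i t'.
Definition accept (lamt : R) (j : nat) (x tk : vec) (i : nat) (t : vec) : Prop :=
  qfun j x t <= qfun j x tk + dot P (gradq j x tk) (vsub t tk)
     + 1 / 2 * quad P (shiftI (Hmat j x tk) ((2 ^ i - 1) * lamt)) (vsub t tk).
Definition Step2j (lamt : R) (j : nat) (xk1 tk tnew : vec) : Prop :=
  exists i, (1 <= i)%nat /\ sub_argmin lamt j xk1 tk i tnew /\ accept lamt j xk1 tk i tnew /\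
    forall i', (1 <= i' < i)%nat -> forall t,
      sub_argmin lamt j xk1 tk i' t -> ~ accept lamt j xk1 tk i' t.

Definition Step (lamxk lamt : R) (xk thk xk1 thk1 : vec) : Prop :=
  Step1 lamxk xk thk xk1 /\
  forall j, (1 <= j <= m)%nat -> Step2j lamt j xk1 (tblk thk j) (tblk thk1 j).

Definition Init (x0 th0 : vec) : Prop :=
  (forall i, (i < dimx)%nat -> x0 i = 0) /\ inC th0.

Definition Generated (lamx : nat -> R) (lamt : R) (xs ts : nat -> vec) : Prop :=
  Init (xs O) (ts O) /\
  forall k, Step (lamx k) lamt (xs k) (ts k) (xs (S k)) (ts (S k)).

Definition WellDefined (lamx : nat -> R) (lamt : R) : Prop :=
  forall (xs ts : nat -> vec) (K : nat), Init (xs O) (ts O) ->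
    (forall k, (k < K)%nat -> Step (lamx k) lamt (xs k) (ts k) (xs (S k)) (ts (S k))) ->
    exists xn tn, Step (lamx K) lamt (xs K) (ts K) xn tn.

End Obj.

Definition pdist (dx dt : nat) (x t x' t' : vec) : R :=
  sqrt (sqn dx (vsub x x') + sqn dt (vsub t t')).

Definition frechet_sub (dx dt : nat) (F : vec -> vec -> ereal) (x t vx vt : vec) : Prop :=
  exists a, F x t = Fin a /\
  forall eps, eps > 0 -> exists del, del > 0 /\
    forall x' t', 0 < pdist dx dt x' t' x t < del ->
      ele (Fin (a + dot dx vx (vsub x' x) + dot dt vt (vsub t' t)
                - eps * pdist dx dt x' t' x t)) (F x' t').

Definition limiting_sub (dx dt : nat) (F : vec -> vec -> ereal) (x t vx vt : vec) : Prop :=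
  exists (a : R) (xs ts vxs vts : nat -> vec) (fs : nat -> R),
    F x t = Fin a /\
    (forall k, F (xs k) (ts k) = Fin (fs k) /\
               frechet_sub dx dt F (xs k) (ts k) (vxs k) (vts k)) /\
    Un_cv (fun k => pdist dx dt (xs k) (ts k) x t) 0 /\
    Un_cv fs a /\
    Un_cv (fun k => pdist dx dt (vxs k) (vts k) vx vt) 0.

Definition KL_at (dx dt : nat) (F : vec -> vec -> ereal) (x t : vec) : Prop :=
  exists (a eta del : R) (ph dph : R -> R),
    F x t = Fin a /\ eta > 0 /\ del > 0 /\
    ph 0 = 0 /\
    (forall s, 0 <= s < eta -> 0 <= ph s) /\
    (forall s, 0 <= s < eta -> forall eps, eps > 0 -> exists d, d > 0 /\
        forall s', 0 <= s' < eta -> Rabs (s' - s) < d -> Rabs (ph s' - ph s) < eps) /\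
    (forall s1 s2 l, 0 <= s1 < eta -> 0 <= s2 < eta -> 0 <= l <= 1 ->
        l * ph s1 + (1 - l) * ph s2 <= ph (l * s1 + (1 - l) * s2)) /\
    (forall s, 0 < s < eta ->
        derivable_pt_lim ph s (dph s) /\ continuity_pt dph s /\ dph s > 0) /\
    (forall x' t' b, pdist dx dt x' t' x t < del -> F x' t' = Fin b ->
        a < b < a + eta ->
        forall vx vt, limiting_sub dx dt F x' t' vx vt ->
          dph (b - a) * pdist dx dt vx vt zerov zerov >= 1).

Definition KL_fun (dx dt : nat) (F : vec -> vec -> ereal) : Prop :=
  forall x t, (exists vx vt, limiting_sub dx dt F x t vx vt) -> KL_at dx dt F x t.

(* Main.v *)
(* Comparing each minimizer with the previous iterate, and using the acceptance inequality in
   step (2), gives the decrease of L; its sum is bounded, and small values of the Huber term are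
   quadratic, so the steps vanish.

   Put z = (x, theta). The box and a bound on x confine z to a set on which the entries of Phi
   and their first partials are Lipschitz, by the mean value theorem along coordinates. The
   functions f whose gradient g is bounded and Lipschitz, with
   |f(z') - f(z) - <g(z), z' - z>| <= K |z' - z|_1^2, form an algebra, which contains the
   data-fidelity term. Hence the backtracking stops, with 2^i bounded uniformly in k when the
   x^k are bounded.

   First-order optimality in step (1) yields a subgradient inequality for R, in step (2) a
   variational inequality on the box; together they give a Frechet subgradient of L at
   z^(k+1) of norm at most b |z^(k+1) - z^k|. At a cluster point the Kurdyka-Lojasiewicz
   inequality then turns the decrease of L into
   2 |z^(k+1) - z^k| <= |z^k - z^(k-1)| + (b/a) (ph_k - ph_(k+1)), where
   ph_k = ph(L(z^k) - L(z_lim)). This telescopes, so the iterates that come close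
   to the cluster point stay close to it. *)
Require Import Defs.
From Stdlib Require Import Reals Lra Lia FunctionalExtensionality Classical ClassicalEpsilon.
Open Scope R_scope.

(** [R] is only lower semicontinuous and may be infinite at the starting point. Hence values of [L]
    are tracked from the first computed iterate on. At a cluster point lower semicontinuity bounds
    the limit of these values from one side only; the subgradient of [R] supplied by step (1) gives
    the other side.

    The optimality conditions of both steps contain the gradient of the data-fidelity term at
    (x^(k+1), theta^k), whereas a subgradient of [L] is wanted at (x^(k+1), theta^(k+1)). The
    mismatch is a difference of gradients at these two points, which is why that gradient has to be
    Lipschitz and why second derivatives of Phi enter.

    The Huber term grows only linearly at infinity, so the decrease of [L] need not be quadratic in
    the step at the start. It is so once the Huber term has fallen below mu/2, and the
    Kurdyka-Lojasiewicz argument runs from that index on.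

    Estimates use the l1 norm because it adds up over coordinates and blocks; dimension factors lead
    back to the Euclidean norm. *)

(** * Finite sums *)

Lemma sumR_ext d f g : (forall i, (i < d)%nat -> f i = g i) -> sumR d f = sumR d g.
Proof.
  induction d as [|d IH]; intros H; simpl; [reflexivity|].
  rewrite IH by (intros; apply H; lia). rewrite H by lia. reflexivity.
Qed.

Lemma sumR_plus d f g : sumR d (fun i => f i + g i) = sumR d f + sumR d g.
Proof. induction d as [|d IH]; simpl; [lra|rewrite IH; lra]. Qed.

Lemma sumR_minus d f g : sumR d (fun i => f i - g i) = sumR d f - sumR d g.
Proof. induction d as [|d IH]; simpl; [lra|rewrite IH; lra]. Qed.

Lemma sumR_scal d c f : sumR d (fun i => c * f i) = c * sumR d f.
Proof. induction d as [|d IH]; simpl; [lra|rewrite IH; lra]. Qed.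

Lemma sumR_scal_r d c f : sumR d (fun i => f i * c) = sumR d f * c.
Proof. induction d as [|d IH]; simpl; [lra|rewrite IH; lra]. Qed.

Lemma sumR_const d c : sumR d (fun _ => c) = INR d * c.
Proof. induction d as [|d IH]; [simpl; lra|]. rewrite S_INR. simpl sumR. rewrite IH. lra. Qed.

Lemma sumR_0 d f : (forall i, (i < d)%nat -> f i = 0) -> sumR d f = 0.
Proof. intros H. rewrite (sumR_ext d f (fun _ => 0)), sumR_const by exact H. lra. Qed.

Lemma sumR_le d f g : (forall i, (i < d)%nat -> f i <= g i) -> sumR d f <= sumR d g.
Proof.
  induction d as [|d IH]; intros H; simpl; [lra|].
  apply Rplus_le_compat; [apply IH; intros; apply H; lia|apply H; lia].
Qed.

Lemma sumR_nonneg d f : (forall i, (i < d)%nat -> 0 <= f i) -> 0 <= sumR d f.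
Proof.
  intros H. rewrite <- (sumR_0 d (fun _ => 0)) by reflexivity. now apply sumR_le.
Qed.

Lemma sumR_abs d f : Rabs (sumR d f) <= sumR d (fun i => Rabs (f i)).
Proof.
  induction d as [|d IH]; simpl; [rewrite Rabs_R0; lra|].
  eapply Rle_trans; [apply Rabs_triang|lra].
Qed.

Lemma sumR_term_le d f i :
  (forall k, (k < d)%nat -> 0 <= f k) -> (i < d)%nat -> f i <= sumR d f.
Proof.
  induction d as [|d IH]; intros H Hi; [lia|]. simpl.
  destruct (Nat.eq_dec i d) as [->|Hne].
  - assert (0 <= sumR d f) by (apply sumR_nonneg; intros; apply H; lia). lra.
  - assert (f i <= sumR d f) by (apply IH; [intros; apply H; lia|lia]).
    assert (0 <= f d) by (apply H; lia). lra.
Qed.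

Lemma sumR_swap d e f :
  sumR d (fun i => sumR e (fun j => f i j)) = sumR e (fun j => sumR d (fun i => f i j)).
Proof.
  induction d as [|d IH]; simpl.
  - symmetry. now apply sumR_0.
  - rewrite IH, <- sumR_plus. reflexivity.
Qed.

Lemma sumR_single d f i :
  (i < d)%nat -> (forall k, (k < d)%nat -> k <> i -> f k = 0) -> sumR d f = f i.
Proof.
  induction d as [|d IH]; intros Hi H; [lia|]. simpl.
  destruct (Nat.eq_dec i d) as [->|Hne].
  - rewrite sumR_0; [lra|]. intros k Hk. apply H; lia.
  - rewrite IH by (try lia; intros; apply H; lia). rewrite (H d) by lia. lra.
Qed.

Lemma sumR_app d e f : sumR (d + e) f = sumR d f + sumR e (fun i => f (d + i)%nat).
Proof.
  induction e as [|e IH]; simpl.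
  - rewrite Nat.add_0_r. lra.
  - rewrite Nat.add_succ_r. simpl. rewrite IH. lra.
Qed.

Lemma sumR_blocks m P f :
  sumR (m * P) f = sumR m (fun j => sumR P (fun p => f (j * P + p)%nat)).
Proof.
  induction m as [|m IH]; simpl; [reflexivity|].
  rewrite Nat.add_comm, sumR_app, IH. reflexivity.
Qed.

(** * Norms *)

Definition n1 (d : nat) (u : vec) : R := sumR d (fun i => Rabs (u i)).

Lemma n1_nonneg d u : 0 <= n1 d u.
Proof. apply sumR_nonneg. intros. apply Rabs_pos. Qed.

Lemma n1_coord d u i : (i < d)%nat -> Rabs (u i) <= n1 d u.
Proof. intros Hi. apply (sumR_term_le d (fun i => Rabs (u i))); auto using Rabs_pos. Qed.

Lemma n1_vsub_sym d u v : n1 d (vsub u v) = n1 d (vsub v u).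
Proof. apply sumR_ext. intros i _. apply Rabs_minus_sym. Qed.

Lemma sqn_nonneg d u : 0 <= sqn d u.
Proof. apply sumR_nonneg. intros i _. nra. Qed.

Lemma nrm_nonneg d u : 0 <= nrm d u.
Proof. apply sqrt_pos. Qed.

Lemma nrm_sqr d u : nrm d u * nrm d u = sqn d u.
Proof. apply sqrt_def, sqn_nonneg. Qed.

(** The squared norm of s u - t v is nonnegative; s = |v| and t = |u| give the claim after division
    by |u| |v|. The case of a vanishing norm is treated apart. *)
Lemma dot_Cauchy_Schwarz d u v : dot d u v <= nrm d u * nrm d v.
Proof.
  set (a := nrm d u). set (b := nrm d v).
  assert (Ha : 0 <= a) by apply nrm_nonneg. assert (Hb : 0 <= b) by apply nrm_nonneg.
  assert (Haa : a * a = sqn d u) by apply nrm_sqr.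
  assert (Hbb : b * b = sqn d v) by apply nrm_sqr.
  assert (Hq : forall s t, 0 <= s * s * sqn d u - 2 * (s * t) * dot d u v + t * t * sqn d v).
  { intros s t. unfold sqn, dot. rewrite <- !sumR_scal, <- sumR_minus, <- sumR_plus.
    apply sumR_nonneg. intros i _.
    replace (_ + _) with ((s * u i - t * v i) * (s * u i - t * v i)) by ring.
    apply Rle_0_sqr. }
  destruct (Req_dec (a * b) 0) as [H0|H0].
  - rewrite H0. apply Rnot_lt_le. intros Hc.
    assert (sqn d u = 0 \/ sqn d v = 0) as [E|E].
    { destruct (Rmult_integral _ _ H0) as [E|E]; [left|right];
        rewrite <- ?Haa, <- ?Hbb, E; lra. }
    (* With |u| = 0 the quadratic is -2 s <u,v> + |v|^2, which this large s makes negative if <u,v>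
       > 0. *)
    + pose proof (Hq ((sqn d v + 1) / dot d u v) 1) as Hl. rewrite E in Hl.
      assert (Heq : (sqn d v + 1) / dot d u v * dot d u v = sqn d v + 1) by (field; lra).
      nra.
    + pose proof (Hq 1 ((sqn d u + 1) / dot d u v)) as Hl. rewrite E in Hl.
      assert (Heq : (sqn d u + 1) / dot d u v * dot d u v = sqn d u + 1) by (field; lra).
      nra.
  - pose proof (Hq b a) as Hl. rewrite <- Haa, <- Hbb in Hl.
    assert (0 < a * b) by nra.
    apply Rmult_le_reg_l with (a * b); [assumption|]. nra.
Qed.

Lemma nrm_triang d u v : nrm d (fun i => u i + v i) <= nrm d u + nrm d v.
Proof.
  apply Rsqr_incr_0_var.
  - unfold Rsqr. rewrite nrm_sqr.
    assert (E : sqn d (fun i => u i + v i) = sqn d u + 2 * dot d u v + sqn d v).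
    { unfold sqn, dot. rewrite <- sumR_scal, <- !sumR_plus. apply sumR_ext. intros; ring. }
    rewrite E, <- !nrm_sqr. pose proof (dot_Cauchy_Schwarz d u v). nra.
  - pose proof (nrm_nonneg d u). pose proof (nrm_nonneg d v). lra.
Qed.

Lemma nrm_coord d u i : (i < d)%nat -> Rabs (u i) <= nrm d u.
Proof.
  intros Hi. rewrite <- sqrt_Rsqr_abs. apply sqrt_le_1_alt.
  apply (sumR_term_le d (fun i => u i * u i)); [intros; nra|assumption].
Qed.

Lemma sqn_le_n1_sqr d u : sqn d u <= n1 d u * n1 d u.
Proof.
  unfold sqn, dot. unfold n1 at 1. rewrite <- sumR_scal_r. apply sumR_le. intros i Hi.
  pose proof (n1_coord d u i Hi). pose proof (Rabs_pos (u i)).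
  replace (u i * u i) with (Rabs (u i) * Rabs (u i))
    by (rewrite <- Rabs_mult; apply Rabs_pos_eq; nra).
  nra.
Qed.

Lemma nrm_le_n1 d u : nrm d u <= n1 d u.
Proof.
  apply Rsqr_incr_0_var; [|apply n1_nonneg].
  unfold Rsqr. rewrite nrm_sqr. apply sqn_le_n1_sqr.
Qed.

Lemma n1_le_nrm d u : n1 d u <= INR d * nrm d u.
Proof. unfold n1. rewrite <- sumR_const. apply sumR_le. intros. now apply nrm_coord. Qed.

Lemma n1_sqr_le_sqn d u : n1 d u * n1 d u <= INR d * INR d * sqn d u.
Proof.
  rewrite <- nrm_sqr. pose proof (n1_le_nrm d u). pose proof (n1_nonneg d u).
  pose proof (nrm_nonneg d u). pose proof (pos_INR d). nra.
Qed.

(** * Compactness *)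

Lemma Un_cv_ext u v l : (forall k, u k = v k) -> Un_cv u l -> Un_cv v l.
Proof.
  intros H Hu e He. destruct (Hu e He) as [N HN]. exists N. intros n Hn.
  rewrite <- H. now apply HN.
Qed.

Lemma Un_cv_const c : Un_cv (fun _ => c) c.
Proof. intros e He. exists 0%nat. intros. unfold Rdist. rewrite Rminus_diag, Rabs_R0. exact He. Qed.

Lemma sumR_cv d (f : nat -> nat -> R) (l : nat -> R) :
  (forall i, (i < d)%nat -> Un_cv (fun k => f k i) (l i)) ->
  Un_cv (fun k => sumR d (f k)) (sumR d l).
Proof.
  induction d as [|d IH]; intros H; simpl; [apply Un_cv_const|].
  apply CV_plus with (An := fun k => sumR d (f k)); auto.
Qed.

Lemma strict_mono_ge (phi : nat -> nat) :
  (forall k, (phi k < phi (S k))%nat) -> forall k, (k <= phi k)%nat.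
Proof. intros H. induction k as [|k IH]; [lia|]. specialize (H k). lia. Qed.

Lemma Un_cv_subseq u l phi :
  (forall k, (phi k < phi (S k))%nat) -> Un_cv u l -> Un_cv (fun k => u (phi k)) l.
Proof.
  intros Hphi Hu e He. destruct (Hu e He) as [N HN]. exists N. intros k Hk.
  apply HN. pose proof (strict_mono_ge phi Hphi k). lia.
Qed.

Lemma strict_mono_comp (phi psi : nat -> nat) :
  (forall k, (phi k < phi (S k))%nat) -> (forall k, (psi k < psi (S k))%nat) ->
  forall k, (phi (psi k) < phi (psi (S k)))%nat.
Proof.
  intros Hphi Hpsi k.
  assert (H : forall a b, (a < b)%nat -> (phi a < phi b)%nat).
  { intros a b Hab. induction Hab as [|c Hc IH]; [apply Hphi|]. specialize (Hphi c). lia. }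
  apply H, Hpsi.
Qed.

Lemma subseq_of_frequently (Q : nat -> nat -> Prop) :
  (forall k N, exists p, (N <= p)%nat /\ Q k p) ->
  exists phi : nat -> nat, (forall k, (phi k < phi (S k))%nat) /\ forall k, Q k (phi k).
Proof.
  intros H.
  assert (c : forall k N, {p | (N <= p)%nat /\ Q k p})
    by (intros; apply constructive_indefinite_description, H).
  set (phi := fix phi (k : nat) : nat :=
    match k with O => proj1_sig (c O O) | S k' => proj1_sig (c k (S (phi k'))) end).
  exists phi. split.
  - intros k. simpl. destruct (c (S k) (S (phi k))) as [p [Hp Hq]]. simpl. lia.
  - intros [|k]; simpl.
    + now destruct (c O O) as [p [Hp Hq]].
    + now destruct (c (S k) (S (phi k))) as [p [Hp Hq]].
Qed.

Lemma Rinv_INR_cv eps : eps > 0 -> exists N, forall k, (N <= k)%nat -> / INR (S k) < eps.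
Proof.
  intros He. destruct (archimed_cor1 eps He) as [N [HN HN0]]. exists N. intros k Hk.
  apply Rle_lt_trans with (/ INR N); [|assumption].
  apply Rinv_le_contravar; [now apply lt_0_INR|]. apply le_INR. lia.
Qed.

Lemma Bolzano_Weierstrass_1 (u : nat -> R) B :
  (forall k, Rabs (u k) <= B) ->
  exists phi l, (forall k, (phi k < phi (S k))%nat) /\ Un_cv (fun k => u (phi k)) l.
Proof.
  intros HB.
  destruct (Bolzano_Weierstrass u (fun x => - B <= x <= B) (compact_P3 (- B) B)) as [l Hl].
  { intros k. specialize (HB k). split; unfold Rabs in HB; destruct Rcase_abs in HB; lra. }
  (* [l] is an adherence value: every neighbourhood of it is visited beyond every index. Tolerance
     1/(k+1) at the k-th choice makes the chosen terms converge to it. *)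
  destruct (subseq_of_frequently (fun k p => Rabs (u p - l) < / INR (S k))) as [phi [H1 H2]].
  { intros k N.
    assert (Hp : 0 < / INR (S k)) by (apply Rinv_0_lt_compat, lt_0_INR; lia).
    destruct (Hl (disc l (mkposreal _ Hp)) N) as [p Hp'].
    { exists (mkposreal _ Hp). intros x Hx. exact Hx. }
    exists p. exact Hp'. }
  exists phi, l. split; [exact H1|].
  intros e He. destruct (Rinv_INR_cv e He) as [N HN]. exists N. intros k Hk.
  unfold Rdist. eapply Rlt_trans; [apply H2|now apply HN].
Qed.

Lemma Bolzano_Weierstrass_vec d (u : nat -> vec) B :
  (forall k i, (i < d)%nat -> Rabs (u k i) <= B) ->
  exists (phi : nat -> nat) (l : vec), (forall k, (phi k < phi (S k))%nat) /\
    forall i, (i < d)%nat -> Un_cv (fun k => u (phi k) i) (l i).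
Proof.
  induction d as [|d IH]; intros HB.
  - exists (fun k => k), zerov. split; intros; lia.
  - destruct IH as (phi & l & Hphi & Hl); [intros; apply HB; lia|].
    destruct (Bolzano_Weierstrass_1 (fun k => u (phi k) d) B) as (psi & c & Hpsi & Hc).
    { intros. apply HB. lia. }
    exists (fun k => phi (psi k)), (upd l d c). split; [now apply strict_mono_comp|].
    intros i Hi. unfold upd. destruct (Nat.eqb_spec i d) as [->|Hne]; [exact Hc|].
    apply (Un_cv_subseq (fun k => u (phi k) i)); [exact Hpsi|]. apply Hl. lia.
Qed.

Definition vcv (d : nat) (u : nat -> vec) (l : vec) : Prop :=
  forall i, (i < d)%nat -> Un_cv (fun k => u k i) (l i).

Lemma vcv_n1 d u l : vcv d u l -> Un_cv (fun k => n1 d (vsub (u k) l)) 0.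
Proof.
  intros H. rewrite <- (sumR_0 d (fun _ => 0)) by reflexivity.
  apply (sumR_cv d (fun k i => Rabs (u k i - l i)) (fun _ => 0)).
  intros i Hi e He. destruct (H i Hi e He) as [N HN]. exists N. intros k Hk.
  unfold Rdist. rewrite Rminus_0_r, Rabs_Rabsolu. now apply HN.
Qed.

Lemma vcv_nrm d u l : vcv d u l -> Un_cv (fun k => nrm d (vsub (u k) l)) 0.
Proof.
  intros H e He. destruct (vcv_n1 d u l H e He) as [N HN]. exists N. intros k Hk.
  specialize (HN k Hk). unfold Rdist in *. rewrite Rminus_0_r in *.
  rewrite Rabs_pos_eq in * by auto using n1_nonneg, nrm_nonneg.
  eapply Rle_lt_trans; [apply nrm_le_n1|exact HN].
Qed.

(** * Existence of minimizers *)

Lemma ele_trans a b c : ele a b -> ele b c -> ele a c.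
Proof. destruct a, b, c; simpl; try tauto. lra. Qed.

(** Direct method: a minimizing sequence inside the sublevel set of [x0] is bounded, so a
    subsequence converges coordinatewise, and closedness of sublevel sets passes the bounds to the
    limit. *)
Lemma argmin_exists d (F : vec -> ereal) (x0 : vec) (a0 B c : R) :
  F x0 = Fin a0 ->
  (forall x, ele (Fin c) (F x)) ->
  (forall x, ele (F x) (Fin a0) -> forall i, (i < d)%nat -> Rabs (x i) <= B) ->
  (forall u l r, vcv d u l -> (forall k, ele (F (u k)) (Fin r)) -> ele (F l) (Fin r)) ->
  exists x, forall x', ele (F x) (F x').
Proof.
  intros H0 Hc HB Hlsc.
  (* The infimum is [- s], where [s] is the supremum of the negated finite values. *)
  destruct (completeness (fun r => exists x, F x = Fin (- r))) as [s [Hub Hlub]].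
  { exists (- c). intros r [x Hx]. specialize (Hc x). rewrite Hx in Hc. simpl in Hc. lra. }
  { exists (- a0), x0. rewrite H0. f_equal. lra. }
  assert (Hinf : forall x, ele (Fin (- s)) (F x)).
  { intros x. destruct (F x) as [r|] eqn:E; simpl; [|exact I].
    enough (- r <= s) by lra. apply Hub. exists x. rewrite E. f_equal. lra. }
  assert (Happ : forall eps, eps > 0 -> exists x, ele (F x) (Fin (- s + eps))
                                             /\ ele (F x) (Fin a0)).
  { intros eps He.
    destruct (classic (exists r, (exists x, F x = Fin (- r)) /\ s - eps < r)) as [[r [[x Hx] Hr]]|Hn].
    (* If the near-minimizer lies above level [a0], then [x0] itself is a better one; either way the
       point chosen lies in the bounded sublevel set. *)
    - destruct (Rle_dec (- r) a0).
      + exists x. rewrite Hx. simpl. lra.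
      + exists x0. rewrite H0. simpl. lra.
    - exfalso. enough (s <= s - eps) by lra. apply Hlub. intros r Hr.
      apply Rnot_lt_le. intros Hlt. apply Hn. now exists r. }
  assert (Hpos : forall k, / INR (S k) > 0) by (intros; apply Rinv_0_lt_compat, lt_0_INR; lia).
  set (u := fun k => proj1_sig (constructive_indefinite_description _ (Happ _ (Hpos k)))).
  assert (Hu : forall k, ele (F (u k)) (Fin (- s + / INR (S k))) /\ ele (F (u k)) (Fin a0)).
  { intros k. unfold u. now destruct constructive_indefinite_description. }
  destruct (Bolzano_Weierstrass_vec d u B) as (phi & l & Hphi & Hl).
  { intros k i Hi. apply HB; [apply Hu|assumption]. }
  exists l. intros x'.
  apply ele_trans with (Fin (- s)); [|apply Hinf].
  assert (Hle : forall eps, eps > 0 -> ele (F l) (Fin (- s + eps))).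
  { intros eps He. destruct (Rinv_INR_cv eps He) as [N HN].
    apply (Hlsc (fun k => u (phi (N + k)%nat))).
    - intros i Hi e0 He0. destruct (Hl i Hi e0 He0) as [N0 HN0]. exists N0. intros k Hk.
      apply HN0. lia.
    - intros k. eapply ele_trans; [exact (proj1 (Hu _))|]. unfold ele.
      specialize (HN (phi (N + k)%nat)). pose proof (strict_mono_ge phi Hphi (N + k)).
      specialize (HN ltac:(lia)). lra. }
  destruct (F l) as [r|]; simpl in *.
  - apply Rle_plus_epsilon. intros. now apply Hle.
  - exact (Hle 1 Rlt_0_1).
Qed.

(** Merges constants that depend on a block, a coordinate or a matrix entry into a single one; the
    first premise says that a constant may be enlarged. *)
Lemma fin_max (d : nat) (Q : nat -> R -> Prop) :
  (forall i K K', (i < d)%nat -> K <= K' -> Q i K -> Q i K') ->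
  (forall i, (i < d)%nat -> exists K, Q i K) ->
  exists K, 0 <= K /\ forall i, (i < d)%nat -> Q i K.
Proof.
  induction d as [|d IH]; intros Hm H.
  - exists 0. split; [lra|intros; lia].
  - destruct IH as (K & HK & HQ); [intros i K K' Hi; apply Hm; lia|intros; apply H; lia|].
    destruct (H d) as [K' HK']; [lia|].
    exists (Rmax K K'). pose proof (Rmax_l K K'). pose proof (Rmax_r K K').
    split; [lra|]. intros i Hi. destruct (Nat.eq_dec i d) as [->|Hne].
    + apply (Hm d K'); auto.
    + apply (Hm i K); [lia|lra|]. apply HQ. lia.
Qed.

(** * Bounded functions with Lipschitz gradient *)

(** Boundedness is included because the product of two Lipschitz functions is Lipschitz only under a
    bound on the factors. *)
Definition Lip (d : nat) (S : vec -> Prop) (f : vec -> R) : Prop :=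
  exists K, 0 <= K /\ forall z, S z ->
    Rabs (f z) <= K /\
    forall z', S z' -> Rabs (f z' - f z) <= K * n1 d (vsub z' z).

Lemma Lip_const d S c : Lip d S (fun _ => c).
Proof.
  exists (Rabs c). split; [apply Rabs_pos|]. intros z _. split; [lra|]. intros z' _.
  rewrite Rminus_diag, Rabs_R0.
  apply Rmult_le_pos; [apply Rabs_pos|apply n1_nonneg].
Qed.

Lemma Lip_ext d (S : vec -> Prop) f g :
  (forall z, S z -> f z = g z) -> Lip d S f -> Lip d S g.
Proof.
  intros H (K & HK & HL). exists K. split; [exact HK|]. intros z Hz.
  rewrite <- H by exact Hz. destruct (HL z Hz) as [H1 H2]. split; [exact H1|].
  intros z' Hz'. rewrite <- H by exact Hz'. auto.
Qed.

Lemma Lip_plus d S f g : Lip d S f -> Lip d S g -> Lip d S (fun z => f z + g z).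
Proof.
  intros (K & HK & HL) (K' & HK' & HL'). exists (K + K'). split; [lra|]. intros z Hz.
  destruct (HL z Hz) as [H1 H2], (HL' z Hz) as [H3 H4]. split.
  - eapply Rle_trans; [apply Rabs_triang|lra].
  - intros z' Hz'. specialize (H2 z' Hz'). specialize (H4 z' Hz').
    replace (_ - _) with ((f z' - f z) + (g z' - g z)) by ring.
    eapply Rle_trans; [apply Rabs_triang|]. lra.
Qed.

Lemma Lip_mult d S f g : Lip d S f -> Lip d S g -> Lip d S (fun z => f z * g z).
Proof.
  intros (K & HK & HL) (K' & HK' & HL'). exists (2 * (K * K')). split; [nra|]. intros z Hz.
  destruct (HL z Hz) as [H1 H2], (HL' z Hz) as [H3 H4]. split.
  - rewrite Rabs_mult. pose proof (Rabs_pos (f z)). pose proof (Rabs_pos (g z)). nra.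
  - intros z' Hz'. specialize (H2 z' Hz'). specialize (H4 z' Hz').
    destruct (HL' z' Hz') as [H5 _].
    replace (_ - _) with ((f z' - f z) * g z' + f z * (g z' - g z)) by ring.
    eapply Rle_trans; [apply Rabs_triang|]. rewrite !Rabs_mult.
    set (D := n1 d (vsub z' z)) in *.
    assert (HD : 0 <= D) by apply n1_nonneg.
    assert (Rabs (f z' - f z) * Rabs (g z') <= (K * D) * K')
      by (apply Rmult_le_compat; auto using Rabs_pos).
    assert (Rabs (f z) * Rabs (g z' - g z) <= K * (K' * D))
      by (apply Rmult_le_compat; auto using Rabs_pos).
    lra.
Qed.

Lemma Lip_scal d S c f : Lip d S f -> Lip d S (fun z => c * f z).
Proof. intros H. apply (Lip_mult d S (fun _ => c) f); auto using Lip_const. Qed.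

Lemma Lip_sumR d S n (f : nat -> vec -> R) :
  (forall k, (k < n)%nat -> Lip d S (f k)) -> Lip d S (fun z => sumR n (fun k => f k z)).
Proof.
  induction n as [|n IH]; intros H; simpl; [apply Lip_const|].
  apply (Lip_plus d S (fun z => sumR n (fun k => f k z)) (f n)); auto.
Qed.

(* [g z i] plays the role of the i-th partial derivative of f at z. *)
Definition C11 (d : nat) (S : vec -> Prop) (f : vec -> R) (g : vec -> nat -> R) : Prop :=
  Lip d S f /\ (forall i, (i < d)%nat -> Lip d S (fun z => g z i)) /\
  exists K, 0 <= K /\ forall z z', S z -> S z' ->
    Rabs (f z' - f z - dot d (g z) (vsub z' z)) <= K * (n1 d (vsub z' z) * n1 d (vsub z' z)).

Lemma n1_sqr_nonneg d u : 0 <= n1 d u * n1 d u.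
Proof. pose proof (n1_nonneg d u). nra. Qed.

Lemma C11_const d S c : C11 d S (fun _ => c) (fun _ _ => 0).
Proof.
  repeat split; auto using Lip_const.
  exists 0. split; [lra|]. intros z z' _ _.
  unfold dot. rewrite sumR_0 by (intros; ring).
  rewrite Rminus_diag, Rminus_0_r, Rabs_R0. lra.
Qed.

Lemma C11_ext d (S : vec -> Prop) f f' g g' :
  (forall z, S z -> f z = f' z) ->
  (forall z i, S z -> (i < d)%nat -> g z i = g' z i) ->
  C11 d S f g -> C11 d S f' g'.
Proof.
  intros Hf Hg (H1 & H2 & K & HK & H3). split; [|split].
  - now apply Lip_ext with f.
  - intros i Hi. apply Lip_ext with (fun z => g z i); auto.
  - exists K. split; [exact HK|]. intros z z' Hz Hz'. rewrite <- !Hf by assumption.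
    replace (dot d (g' z) (vsub z' z)) with (dot d (g z) (vsub z' z)); auto.
    apply sumR_ext. intros i Hi. now rewrite Hg.
Qed.

Lemma C11_plus d S f g f' g' : C11 d S f g -> C11 d S f' g' ->
  C11 d S (fun z => f z + f' z) (fun z i => g z i + g' z i).
Proof.
  intros (H1 & H2 & K & HK & H3) (H1' & H2' & K' & HK' & H3'). split; [|split].
  - now apply Lip_plus.
  - intros i Hi. apply Lip_plus; auto.
  - exists (K + K'). split; [lra|]. intros z z' Hz Hz'.
    specialize (H3 z z' Hz Hz'). specialize (H3' z z' Hz Hz').
    assert (E : dot d (fun i => g z i + g' z i) (vsub z' z)
              = dot d (g z) (vsub z' z) + dot d (g' z) (vsub z' z)).
    { unfold dot. rewrite <- sumR_plus. apply sumR_ext. intros; ring. }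
    rewrite E.
    match goal with |- Rabs ?e <= _ =>
      replace e with ((f z' - f z - dot d (g z) (vsub z' z))
                      + (f' z' - f' z - dot d (g' z) (vsub z' z))) by ring end.
    eapply Rle_trans; [apply Rabs_triang|lra].
Qed.

(** The Taylor remainder of a product is the remainder of each factor times the other factor, plus
    the product of the two increments. The last term is quadratic by the Lipschitz bounds, whence
    [L * L']. *)
Lemma C11_mult d S f g f' g' : C11 d S f g -> C11 d S f' g' ->
  C11 d S (fun z => f z * f' z) (fun z i => g z i * f' z + f z * g' z i).
Proof.
  intros (H1 & H2 & K & HK & H3) (H1' & H2' & K' & HK' & H3'). split; [|split].
  - now apply Lip_mult.
  - intros i Hi.
    apply (Lip_plus d S (fun z => g z i * f' z) (fun z => f z * g' z i)); apply Lip_mult; auto.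
  - destruct H1 as (L & HL & H1), H1' as (L' & HL' & H1').
    exists (K * L' + L * K' + L * L'). split; [nra|]. intros z z' Hz Hz'.
    specialize (H3 z z' Hz Hz'). specialize (H3' z z' Hz Hz').
    destruct (H1 z Hz) as [B1 B2], (H1' z Hz) as [B1' B2'].
    specialize (B2 z' Hz'). specialize (B2' z' Hz').
    assert (E : dot d (fun i => g z i * f' z + f z * g' z i) (vsub z' z)
              = f' z * dot d (g z) (vsub z' z) + f z * dot d (g' z) (vsub z' z)).
    { unfold dot. rewrite <- !sumR_scal, <- sumR_plus. apply sumR_ext. intros; ring. }
    rewrite E. set (D := n1 d (vsub z' z)) in *.
    assert (HD : 0 <= D) by apply n1_nonneg.
    match goal with |- Rabs ?e <= _ =>
      replace e with ((f z' - f z - dot d (g z) (vsub z' z)) * f' z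
                      + f z * (f' z' - f' z - dot d (g' z) (vsub z' z))
                      + (f z' - f z) * (f' z' - f' z)) by ring end.
    eapply Rle_trans; [apply Rabs_triang|].
    eapply Rle_trans; [apply Rplus_le_compat_r, Rabs_triang|]. rewrite !Rabs_mult.
    pose proof (Rmult_le_compat _ _ _ _ (Rabs_pos _) (Rabs_pos _) H3 B1').
    pose proof (Rmult_le_compat _ _ _ _ (Rabs_pos _) (Rabs_pos _) B1 H3').
    pose proof (Rmult_le_compat _ _ _ _ (Rabs_pos _) (Rabs_pos _) B2 B2').
    lra.
Qed.

Lemma C11_scal d S c f g : C11 d S f g -> C11 d S (fun z => c * f z) (fun z i => c * g z i).
Proof.
  intros H.
  eapply C11_ext; [| |exact (C11_mult d S _ _ _ _ (C11_const d S c) H)];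
    simpl; intros; ring.
Qed.

Lemma C11_sumR d S n (f : nat -> vec -> R) (g : nat -> vec -> nat -> R) :
  (forall k, (k < n)%nat -> C11 d S (f k) (g k)) ->
  C11 d S (fun z => sumR n (fun k => f k z)) (fun z i => sumR n (fun k => g k z i)).
Proof.
  induction n as [|n IH]; intros H; simpl; [apply C11_const|].
  apply (C11_plus d S (fun z => sumR n (fun k => f k z)) _ (f n)); auto.
Qed.

(** The remainder is exactly 0; [B] enters because [Lip] asks for boundedness. *)
Lemma C11_coord d (S : vec -> Prop) B k : (k < d)%nat ->
  (forall z, S z -> Rabs (z k) <= B) ->
  C11 d S (fun z => z k) (fun _ i => if Nat.eqb k i then 1 else 0).
Proof.
  intros Hk HB. split; [|split].
  - exists (Rmax 1 B). pose proof (Rmax_l 1 B). pose proof (Rmax_r 1 B).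
    split; [lra|]. intros z Hz. split; [specialize (HB z Hz); lra|]. intros z' _.
    pose proof (n1_coord d (vsub z' z) k Hk). pose proof (n1_nonneg d (vsub z' z)).
    unfold vsub in *. nra.
  - intros i _. apply Lip_const.
  - exists 0. split; [lra|]. intros z z' _ _. unfold dot. rewrite (sumR_single d _ k Hk).
    + rewrite Nat.eqb_refl. unfold vsub. rewrite Rmult_1_l, Rminus_diag, Rabs_R0. lra.
    + intros i _ Hi. destruct (Nat.eqb_spec k i); [congruence|ring].
Qed.

Lemma C11_lower d S f g : C11 d S f g ->
  exists K, 0 <= K /\ forall z z', S z -> S z' ->
    f z + dot d (g z) (vsub z' z) - K * (n1 d (vsub z' z) * n1 d (vsub z' z)) <= f z' <=
    f z + dot d (g z) (vsub z' z) + K * (n1 d (vsub z' z) * n1 d (vsub z' z)).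
Proof.
  intros (_ & _ & K & HK & H). exists K. split; [exact HK|]. intros z z' Hz Hz'.
  specialize (H z z' Hz Hz'). unfold Rabs in H. destruct Rcase_abs in H; lra.
Qed.

Lemma C11_grad_Lip d S f g : C11 d S f g ->
  exists K, 0 <= K /\ forall i z z', (i < d)%nat -> S z -> S z' ->
    Rabs (g z i) <= K /\ Rabs (g z' i - g z i) <= K * n1 d (vsub z' z).
Proof.
  intros (_ & H & _).
  destruct (fin_max d (fun i K => forall z z', S z -> S z' ->
    Rabs (g z i) <= K /\ Rabs (g z' i - g z i) <= K * n1 d (vsub z' z))) as (K & HK & HQ).
  - intros i K K' _ HKK HQ z z' Hz Hz'. destruct (HQ z z' Hz Hz').
    pose proof (n1_nonneg d (vsub z' z)). split; nra.
  - intros i Hi. destruct (H i Hi) as (K & _ & HL). exists K. intros z z' Hz Hz'.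
    destruct (HL z Hz) as [H1 H2]. split; auto.
  - exists K. split; [exact HK|]. intros i z z' Hi. now apply HQ.
Qed.

(** * Mean value theorem along coordinates *)

Definition between (a b c : R) : Prop := Rmin a b <= c <= Rmax a b.

Lemma MVT_between (f f' : R -> R) a b :
  (forall s, derivable_pt_lim f s (f' s)) ->
  exists s, between a b s /\ f b - f a = f' s * (b - a).
Proof.
  intros H. unfold between, Rmin, Rmax.
  destruct (Rtotal_order a b) as [Hl|[->|Hl]].
  - destruct (MVT_cor2 f f' a b Hl) as (s & Hs & ?); [auto|].
    exists s. split; [destruct Rle_dec; lra|assumption].
  - exists b. split; [destruct Rle_dec; lra|ring].
  - destruct (MVT_cor2 f f' b a Hl) as (s & Hs & ?); [auto|].
    exists s. split; [destruct Rle_dec; lra|lra].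
Qed.

(** A path from [u] to [v] that changes one coordinate at a time. *)
Definition mix (u v : vec) (p : nat) : vec := fun i => if Nat.ltb i p then v i else u i.

Lemma upd_upd u p a b : upd (upd u p a) p b = upd u p b.
Proof. apply functional_extensionality. intros i. unfold upd. now destruct Nat.eqb. Qed.

Lemma upd_same u p a : upd u p a p = a.
Proof. unfold upd. now rewrite Nat.eqb_refl. Qed.

(** The one-dimensional mean value theorem is applied to each leg of the path [mix], and the legs
    telescope. All intermediate points stay in the box spanned by [t] and [t']. *)
Lemma mean_value_coordinates P (f : vec -> R) (fp : nat -> vec -> R) (t t' : vec) :
  (forall u v, (forall p, (p < P)%nat -> u p = v p) -> f u = f v) ->
  (forall p th, (p < P)%nat -> derivable_pt_lim (fun s => f (upd th p s)) (th p) (fp p th)) ->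
  exists xi : nat -> vec,
    (forall p i, (p < P)%nat -> between (t i) (t' i) (xi p i)) /\
    f t' - f t = sumR P (fun p => fp p (xi p) * (t' p - t p)).
Proof.
  intros Hext HD.
  (* The bound on [p] sits under the existential so that the points can be chosen by a total
     function of [p]. *)
  assert (Hstep : forall p, exists xi, (p < P)%nat ->
            (forall i, between (t i) (t' i) (xi i)) /\
            f (mix t t' (S p)) - f (mix t t' p) = fp p xi * (t' p - t p)).
  { intros p. destruct (Nat.lt_ge_cases p P) as [Hp|Hp]; [|exists t; lia].
    destruct (MVT_between (fun s => f (upd (mix t t' p) p s))
                (fun s => fp p (upd (mix t t' p) p s)) (t p) (t' p)) as (s & Hs & E).
    { intros s. pose proof (HD p (upd (mix t t' p) p s) Hp) as H.
      rewrite upd_same in H.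
      replace (fun s0 => f (upd (upd (mix t t' p) p s) p s0))
        with (fun s0 => f (upd (mix t t' p) p s0)) in H; [exact H|].
      apply functional_extensionality. intros. now rewrite upd_upd. }
    exists (upd (mix t t' p) p s). intros _. split.
    - intros i. unfold upd, mix. destruct (Nat.eqb_spec i p) as [->|_]; [exact Hs|].
      unfold between, Rmin, Rmax. destruct Nat.ltb, Rle_dec; lra.
    - rewrite <- E. f_equal; [|f_equal]; f_equal; apply functional_extensionality; intros i;
        unfold upd, mix; destruct (Nat.eqb_spec i p) as [->|Hne].
      + destruct (Nat.ltb_spec p (S p)); [reflexivity|lia].
      + destruct (Nat.ltb_spec i (S p)), (Nat.ltb_spec i p); try lia; reflexivity.
      + destruct (Nat.ltb_spec p p); [lia|reflexivity].
      + reflexivity. }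
  set (xi := fun p => proj1_sig (constructive_indefinite_description _ (Hstep p))).
  assert (Hxi : forall p, (p < P)%nat -> (forall i, between (t i) (t' i) (xi p i)) /\
            f (mix t t' (S p)) - f (mix t t' p) = fp p (xi p) * (t' p - t p)).
  { intros p. unfold xi. now destruct constructive_indefinite_description. }
  exists xi. split; [intros; now apply Hxi|].
  (* [mix t t' P] agrees with [t'] on the first P coordinates only. *)
  rewrite (Hext t' (mix t t' P))
    by (intros p Hp; unfold mix; destruct (Nat.ltb_spec p P); [reflexivity|lia]).
  replace (f t) with (f (mix t t' 0)) by (f_equal; now apply functional_extensionality).
  assert (HQ : forall Q, (Q <= P)%nat -> f (mix t t' Q) - f (mix t t' 0)
                          = sumR Q (fun p => fp p (xi p) * (t' p - t p))).
  { induction Q as [|Q IH]; intros HQ; simpl; [ring|].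
    rewrite <- IH by lia. rewrite <- (proj2 (Hxi Q HQ)). ring. }
  now apply HQ.
Qed.

(** * Functions of class C^2 on a box *)

Definition box (P : nat) (lo hi t : vec) : Prop := forall p, (p < P)%nat -> lo p <= t p <= hi p.

Lemma box_between P lo hi t t' s : box P lo hi t -> box P lo hi t' ->
  (forall i, between (t i) (t' i) (s i)) -> box P lo hi s.
Proof.
  intros H H' Hs p Hp. specialize (H p Hp). specialize (H' p Hp). specialize (Hs p).
  unfold between, Rmin, Rmax in Hs. destruct Rle_dec in Hs; lra.
Qed.

Lemma between_dist P t t' s :
  (forall i, between (t i) (t' i) (s i)) -> n1 P (vsub s t) <= n1 P (vsub t' t).
Proof.
  intros H. apply sumR_le. intros i _. specialize (H i). unfold vsub.
  unfold between, Rmin, Rmax in H. destruct Rle_dec in H; unfold Rabs;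
    repeat destruct Rcase_abs; lra.
Qed.

(** Otherwise points of the box with |g| > k would have a convergent subsequence, and continuity
    would fail at its limit. *)
Lemma cont_bounded_on_box P lo hi g : cont_fun P g ->
  exists K, 0 <= K /\ forall t, box P lo hi t -> Rabs (g t) <= K.
Proof.
  intros Hg. apply NNPP. intros Hn.
  assert (Hk : forall k, exists t, box P lo hi t /\ INR k < Rabs (g t)).
  { intros k. apply NNPP. intros Hk. apply Hn. exists (INR k). split; [apply pos_INR|].
    intros t Ht. apply Rnot_lt_le. intros Hl. apply Hk. now exists t. }
  set (u := fun k => proj1_sig (constructive_indefinite_description _ (Hk k))).
  assert (Hu : forall k, box P lo hi (u k) /\ INR k < Rabs (g (u k))).
  { intros k. unfold u. now destruct constructive_indefinite_description. }
  destruct (fin_max P (fun p K => forall k, Rabs (u k p) <= K)) as (B & _ & HB).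
  { intros i K K' _ HK HQ k. specialize (HQ k). lra. }
  { intros p Hp. exists (Rabs (lo p) + Rabs (hi p)). intros k.
    destruct (proj1 (Hu k) p Hp). unfold Rabs. repeat destruct Rcase_abs; lra. }
  destruct (Bolzano_Weierstrass_vec P u B) as (phi & l & Hphi & Hl); [auto|].
  destruct (Hg l 1 Rlt_0_1) as (del & Hdel & Hc).
  destruct (vcv_nrm P _ l Hl del Hdel) as [N HN].
  destruct (INR_unbounded (Rabs (g l) + 1)) as [N' HN'].
  set (k := (N + N')%nat). specialize (HN k ltac:(unfold k; lia)).
  unfold Rdist in HN. rewrite Rminus_0_r, Rabs_pos_eq in HN by apply nrm_nonneg.
  specialize (Hc _ HN). change (Rabs (g (u (phi k)) - g l) < 1) in Hc. destruct (Hu (phi k)) as [_ Hbig].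
  assert (INR N' <= INR (phi k)).
  { apply le_INR. pose proof (strict_mono_ge phi Hphi k). unfold k in *. lia. }
  pose proof (Rabs_triang (g (u (phi k)) - g l) (g l)) as Ht.
  replace (g (u (phi k)) - g l + g l) with (g (u (phi k))) in Ht by ring. lra.
Qed.

Lemma Lip_box_of_partials P lo hi (f : vec -> R) (fp : nat -> vec -> R) :
  (forall u v, (forall p, (p < P)%nat -> u p = v p) -> f u = f v) ->
  (forall p th, (p < P)%nat -> derivable_pt_lim (fun s => f (upd th p s)) (th p) (fp p th)) ->
  (forall p, (p < P)%nat -> exists K, forall t, box P lo hi t -> Rabs (fp p t) <= K) ->
  Lip P (box P lo hi) f.
Proof.
  intros Hext HD HB.
  destruct (fin_max P (fun p K => forall t, box P lo hi t -> Rabs (fp p t) <= K))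
    as (K & HK & HfK); [|exact HB|].
  { intros i K K' _ HK HQ t Ht. specialize (HQ t Ht). lra. }
  assert (HL : forall t t', box P lo hi t -> box P lo hi t' ->
                       Rabs (f t' - f t) <= K * n1 P (vsub t' t)).
  { intros t t' Ht Ht'.
    destruct (mean_value_coordinates P f fp t t' Hext HD) as (xi & Hxi & ->).
    eapply Rle_trans; [apply sumR_abs|]. unfold n1. rewrite <- sumR_scal.
    apply sumR_le. intros p Hp. rewrite Rabs_mult.
    apply Rmult_le_compat_r; [apply Rabs_pos|]. apply HfK; [exact Hp|].
    apply box_between with t t'; auto. }
  (* The bound on f comes from its value at one point of the box and the diameter of the box; over
     an empty box there is nothing to bound. *)
  destruct (classic (exists t, box P lo hi t)) as [[t0 Ht0]|Hno].
  - assert (HD0 : exists B, forall t, box P lo hi t -> n1 P (vsub t t0) <= B).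
    { exists (sumR P (fun p => Rabs (hi p - lo p))). intros t Ht. apply sumR_le.
      intros p Hp. specialize (Ht p Hp). specialize (Ht0 p Hp). unfold vsub, Rabs.
      repeat destruct Rcase_abs; lra. }
    destruct HD0 as [B HB0].
    assert (0 <= B) by (eapply Rle_trans; [apply n1_nonneg|now apply (HB0 t0)]).
    pose proof (Rabs_pos (f t0)) as Hf0.
    exists (K + Rabs (f t0) + K * B). split; [nra|]. intros t Ht. split.
    + specialize (HL t0 t Ht0 Ht). specialize (HB0 t Ht).
      pose proof (Rabs_triang (f t - f t0) (f t0)) as H1.
      replace (f t - f t0 + f t0) with (f t) in H1 by ring.
      assert (K * n1 P (vsub t t0) <= K * B) by (apply Rmult_le_compat_l; assumption). lra.
    + intros t' Ht'. specialize (HL t t' Ht Ht'). pose proof (n1_nonneg P (vsub t' t)).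
      eapply Rle_trans; [exact HL|]. apply Rmult_le_compat_r; [assumption|nra].
  - exists 0. split; [lra|]. intros z Hz. exfalso. apply Hno. now exists z.
Qed.

(** By the mean value formula the Taylor remainder is a sum of coordinate increments times
    differences of partials between [t] and an intermediate point, and each difference is at most K
    times the l1 distance. *)
Lemma C11_box P lo hi (f : vec -> R) (fp : nat -> vec -> R) :
  (forall u v, (forall p, (p < P)%nat -> u p = v p) -> f u = f v) ->
  (forall p th, (p < P)%nat -> derivable_pt_lim (fun s => f (upd th p s)) (th p) (fp p th)) ->
  (forall p, (p < P)%nat -> Lip P (box P lo hi) (fp p)) ->
  C11 P (box P lo hi) f (fun t p => fp p t).
Proof.
  intros Hext HD HL. split; [|split].
  - apply Lip_box_of_partials with fp; auto.
    intros p Hp. destruct (HL p Hp) as (K & _ & HK). exists K. intros t Ht. now apply HK.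
  - exact HL.
  - destruct (fin_max P (fun p K => forall t t', box P lo hi t -> box P lo hi t' ->
                Rabs (fp p t' - fp p t) <= K * n1 P (vsub t' t))) as (K & HK & HQ).
    { intros i K K' _ HKK HQ t t' Ht Ht'. specialize (HQ t t' Ht Ht').
      pose proof (n1_nonneg P (vsub t' t)). nra. }
    { intros p Hp. destruct (HL p Hp) as (K & _ & HK). exists K. intros t t' Ht Ht'.
      now apply HK. }
    exists K. split; [exact HK|]. intros t t' Ht Ht'.
    destruct (mean_value_coordinates P f fp t t' Hext HD) as (xi & Hxi & ->).
    unfold dot. rewrite <- sumR_minus. eapply Rle_trans; [apply sumR_abs|].
    rewrite <- Rmult_assoc. unfold n1 at 2. rewrite <- sumR_scal.
    apply sumR_le. intros p Hp. unfold vsub at 1.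
    rewrite <- Rmult_minus_distr_r, Rabs_mult.
    apply Rmult_le_compat_r; [apply Rabs_pos|].
    eapply Rle_trans; [apply HQ; auto; apply box_between with t t'; auto|].
    apply Rmult_le_compat_l; [exact HK|]. apply between_dist. auto.
Qed.

(** * Functions of one block of coordinates *)

Definition blk (off : nat) (z : vec) : vec := fun p => z (off + p)%nat.

Lemma n1_blk off P d u : (off + P <= d)%nat -> n1 P (blk off u) <= n1 d u.
Proof.
  intros H. unfold n1. replace d with (off + (P + (d - off - P)))%nat by lia.
  rewrite !sumR_app. unfold blk.
  pose proof (n1_nonneg off u). unfold n1 in *.
  assert (0 <= sumR (d - off - P) (fun i => Rabs (u (off + (P + i))%nat)))
    by (apply sumR_nonneg; intros; apply Rabs_pos).
  lra.
Qed.

Lemma Lip_blk off P d (S S' : vec -> Prop) f : (off + P <= d)%nat ->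
  (forall z, S z -> S' (blk off z)) -> Lip P S' f -> Lip d S (fun z => f (blk off z)).
Proof.
  intros Hd HS (K & HK & H). exists K. split; [exact HK|]. intros z Hz.
  destruct (H _ (HS z Hz)) as [H1 H2]. split; [exact H1|]. intros z' Hz'.
  specialize (H2 _ (HS z' Hz')).
  pose proof (n1_blk off P d (vsub z' z) Hd) as Hn.
  change (blk off (vsub z' z)) with (vsub (blk off z') (blk off z)) in Hn. nra.
Qed.

Definition blk_grad (off P : nat) (g : vec -> nat -> R) : vec -> nat -> R :=
  fun z i => if andb (Nat.leb off i) (Nat.ltb i (off + P)) then g (blk off z) (i - off)%nat else 0.

Lemma blk_grad_in off P g z p :
  (p < P)%nat -> blk_grad off P g z (off + p)%nat = g (blk off z) p.
Proof.
  intros Hp. unfold blk_grad.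
  destruct (Nat.leb_spec off (off + p)), (Nat.ltb_spec (off + p) (off + P)); try lia. simpl.
  f_equal. lia.
Qed.

Lemma blk_grad_out off P g z i :
  (i < off \/ off + P <= i)%nat -> blk_grad off P g z i = 0.
Proof.
  intros Hi. unfold blk_grad.
  destruct (Nat.leb_spec off i), (Nat.ltb_spec i (off + P)); try lia; reflexivity.
Qed.

(** Lets a function of one theta_j be treated as a function of the joint variable z, with gradient
    extended by zero. *)
Lemma C11_blk off P d (S S' : vec -> Prop) f g : (off + P <= d)%nat ->
  (forall z, S z -> S' (blk off z)) -> C11 P S' f g ->
  C11 d S (fun z => f (blk off z)) (blk_grad off P g).
Proof.
  intros Hd HS (H1 & H2 & K & HK & H3). split; [|split].
  - apply Lip_blk with P S'; auto.
  - intros i _. unfold blk_grad.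
    destruct (Nat.leb_spec off i), (Nat.ltb_spec i (off + P)); simpl; try apply Lip_const.
    apply (Lip_blk off P d S S' (fun z => g z (i - off)%nat)); auto. apply H2. lia.
  - exists K. split; [exact HK|]. intros z z' Hz Hz'.
    specialize (H3 _ _ (HS z Hz) (HS z' Hz')).
    assert (E : dot d (blk_grad off P g z) (vsub z' z)
              = dot P (g (blk off z)) (vsub (blk off z') (blk off z))).
    { unfold dot. replace d with (off + (P + (d - off - P)))%nat by lia.
      rewrite !sumR_app.
      rewrite (sumR_0 off) by (intros; rewrite blk_grad_out by lia; ring).
      rewrite (sumR_0 (d - off - P)) by (intros; rewrite blk_grad_out by lia; ring).
      rewrite Rplus_0_l, Rplus_0_r. apply sumR_ext. intros p Hp.
      now rewrite blk_grad_in. }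
    rewrite E. eapply Rle_trans; [exact H3|].
    pose proof (n1_blk off P d (vsub z' z) Hd) as Hn.
    change (blk off (vsub z' z)) with (vsub (blk off z') (blk off z)) in Hn.
    apply Rmult_le_compat_l; [exact HK|].
    apply Rmult_le_compat; auto using n1_nonneg.
Qed.

(** * The Huber function *)

Definition dhuber (mu a : R) : R :=
  if Rlt_dec (Rabs a) mu then a / mu else if Rcase_abs a then -1 else 1.

Lemma huber_0 mu : mu > 0 -> huber_term mu 0 = 0.
Proof.
  intros H. unfold huber_term. rewrite Rabs_R0. destruct Rlt_dec; [field; lra|lra].
Qed.

(** [dhuber mu] is a / mu clipped to [-1, 1]. *)
Lemma dhuber_bound mu a : mu > 0 -> Rabs (dhuber mu a) <= / mu * Rabs a.
Proof.
  intros H. unfold dhuber. destruct Rlt_dec as [Hl|Hl].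
  - unfold Rdiv. rewrite Rabs_mult, (Rabs_pos_eq (/ mu)); [lra|].
    left. now apply Rinv_0_lt_compat.
  - apply Rmult_le_reg_l with mu; [exact H|].
    rewrite <- Rmult_assoc, Rinv_r, Rmult_1_l by lra.
    destruct (Rcase_abs a); rewrite ?Rabs_R1; unfold Rabs in *; repeat destruct Rcase_abs; lra.
Qed.

(** The two branches of [huber_term] meet at |a| = mu with equal value and slope, so its derivative
    is Lipschitz with constant 1/mu. After multiplication by 2 mu every combination of branches is a
    polynomial inequality. *)
Lemma huber_descent mu a b : mu > 0 ->
  huber_term mu (a + b) <= huber_term mu a + dhuber mu a * b + / (2 * mu) * b ^ 2.
Proof.
  intros H. apply Rmult_le_reg_l with (2 * mu); [lra|].
  unfold huber_term, dhuber.
  replace (2 * mu * (_ + _ + _)) with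
    (2 * mu * (if Rlt_dec (Rabs a) mu then a ^ 2 / (2 * mu) else Rabs a - mu / 2)
     + 2 * (mu * (if Rlt_dec (Rabs a) mu then a / mu else if Rcase_abs a then -1 else 1)) * b
     + b ^ 2) by (field; lra).
  assert (E1 : forall c, 2 * mu * (c ^ 2 / (2 * mu)) = c ^ 2) by (intros; field; lra).
  assert (E2 : mu * (a / mu) = a) by (field; lra).
  destruct (Rlt_dec (Rabs (a + b)) mu), (Rlt_dec (Rabs a) mu); rewrite ?E1, ?E2;
    unfold Rabs in *; repeat destruct Rcase_abs; nra.
Qed.

(** On the linear branch the value is at least mu/2, so a smaller value forces the quadratic
    branch. *)
Lemma huber_small mu a : mu > 0 -> huber_term mu a < mu / 2 ->
  huber_term mu a = / (2 * mu) * a ^ 2.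
Proof.
  intros H. unfold huber_term. destruct Rlt_dec; intros Hs; [field; lra|lra].
Qed.

Lemma huber_nonneg mu a : mu > 0 -> 0 <= huber_term mu a.
Proof.
  intros H. unfold huber_term. destruct Rlt_dec.
  - apply Rmult_le_pos; [nra|]. left. apply Rinv_0_lt_compat. lra.
  - lra.
Qed.

(** On the quadratic branch this is (|a| - mu)^2 >= 0. It is the source of coercivity in step
    (1). *)
Lemma huber_ge_abs mu a : mu > 0 -> Rabs a - mu / 2 <= huber_term mu a.
Proof.
  intros H. unfold huber_term. destruct Rlt_dec; [|lra].
  apply Rmult_le_reg_l with (2 * mu); [lra|].
  replace (2 * mu * (a ^ 2 / (2 * mu))) with (a ^ 2) by (field; lra).
  unfold Rabs in *. destruct Rcase_abs; nra.
Qed.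

Lemma huber_Lip mu a b : mu > 0 -> Rabs (huber_term mu b - huber_term mu a) <= Rabs (b - a).
Proof.
  intros H.
  assert (Hone : forall a b, huber_term mu b - huber_term mu a <= Rabs (b - a)).
  { clear a b. intros a b. apply Rmult_le_reg_l with (2 * mu); [lra|].
    rewrite Rmult_minus_distr_l. unfold huber_term.
    assert (E1 : forall c, 2 * mu * (c ^ 2 / (2 * mu)) = c ^ 2) by (intros; field; lra).
    destruct (Rlt_dec (Rabs b) mu), (Rlt_dec (Rabs a) mu); rewrite ?E1;
      unfold Rabs in *; repeat destruct Rcase_abs; nra. }
  pose proof (Hone a b). pose proof (Hone b a) as H2. rewrite Rabs_minus_sym in H2.
  apply Rabs_le. lra.
Qed.

(** * Convergence under the Kurdyka-Lojasiewicz inequality *)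

(** With h = s' - s, concavity bounds ph s' - ph s by h times the difference quotient of ph at s
    with increment l h, for every l in (0, 1], and this quotient tends to c as l tends to 0. *)
Lemma concave_slope (ph : R -> R) (eta s s' c : R) :
  (forall s1 s2 l, 0 <= s1 < eta -> 0 <= s2 < eta -> 0 <= l <= 1 ->
        l * ph s1 + (1 - l) * ph s2 <= ph (l * s1 + (1 - l) * s2)) ->
  derivable_pt_lim ph s c -> 0 < s < eta -> 0 <= s' < eta ->
  ph s' <= ph s + c * (s' - s).
Proof.
  intros Hconc Hd Hs Hs'.
  destruct (Req_dec s' s) as [->|Hne]; [lra|].
  apply Rle_plus_epsilon. intros eps He.
  set (h := s' - s). assert (Hh : Rabs h > 0) by (apply Rabs_pos_lt; unfold h; lra).
  destruct (Hd (eps / Rabs h)) as [[del Hdel] Hlim]; [apply Rdiv_lt_0_compat; lra|].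
  set (l := Rmin 1 (del / 2 / Rabs h)).
  assert (Hl : 0 < l <= 1).
  { split; [|apply Rmin_l]. apply Rmin_glb_lt; [lra|]. apply Rdiv_lt_0_compat; lra. }
  assert (Hlh : l * Rabs h < del).
  { apply Rle_lt_trans with (del / 2); [|lra].
    replace (del / 2) with (del / 2 / Rabs h * Rabs h) by (field; lra).
    apply Rmult_le_compat_r; [lra|apply Rmin_r]. }
  specialize (Hlim (l * h)). simpl in Hlim.
  specialize (Hlim ltac:(apply Rmult_integral_contrapositive; split; unfold h; lra)).
  rewrite Rabs_mult, (Rabs_pos_eq l) in Hlim by lra. specialize (Hlim Hlh).
  specialize (Hconc s' s l ltac:(lra) ltac:(lra) ltac:(lra)).
  replace (l * s' + (1 - l) * s) with (s + l * h) in Hconc by (unfold h; ring).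
  set (Q := (ph (s + l * h) - ph s) / (l * h)) in *.
  assert (EQ : ph (s + l * h) - ph s = l * (Q * h)) by (unfold Q; field; unfold h; lra).
  assert (H1 : ph s' - ph s <= Q * h).
  { apply Rmult_le_reg_l with l; [lra|]. lra. }
  assert (H2 : Rabs ((Q - c) * h) <= eps).
  { rewrite Rabs_mult. apply Rle_trans with (eps / Rabs h * Rabs h).
    - apply Rmult_le_compat_r; lra.
    - right. field. lra. }
  pose proof (Rle_abs ((Q - c) * h)). fold h. lra.
Qed.

Definition desingularizing (eta : R) (ph dph : R -> R) : Prop :=
  ph 0 = 0 /\ (forall s, 0 <= s < eta -> 0 <= ph s) /\
  (forall s, 0 <= s < eta -> forall eps, eps > 0 -> exists d, d > 0 /\
        forall s', 0 <= s' < eta -> Rabs (s' - s) < d -> Rabs (ph s' - ph s) < eps) /\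
  (forall s1 s2 l, 0 <= s1 < eta -> 0 <= s2 < eta -> 0 <= l <= 1 ->
        l * ph s1 + (1 - l) * ph s2 <= ph (l * s1 + (1 - l) * s2)) /\
  (forall s, 0 < s < eta -> derivable_pt_lim ph s (dph s) /\ dph s > 0).

(* [r k] is the distance of the k-th iterate to the cluster point, [delta k] the length of
   the k-th step, [l k] the objective value and [w k] the norm of a subgradient. *)
Lemma KL_convergence (r delta l w : nat -> R) (ls a b eta del : R) (ph dph : R -> R) :
  a > 0 -> b > 0 -> eta > 0 -> del > 0 -> desingularizing eta ph dph ->
  (forall k, 0 <= r k) -> (forall k, 0 <= delta k) ->
  (forall k, r (S k) <= r k + delta k) ->
  (forall k, l (S k) + a * (delta k * delta k) <= l k) ->
  (forall k, 0 <= w (S k) <= b * delta k) ->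
  Un_cv delta 0 -> Un_cv l ls ->
  (forall eps N, eps > 0 -> exists k, (N <= k)%nat /\ r k < eps) ->
  (forall k, r k < del -> ls < l k < ls + eta -> dph (l k - ls) * w k >= 1) ->
  Un_cv r 0.
Proof.
  intros Ha Hb Heta Hdel (Hph0 & Hphp & Hphc & Hphv & Hphd)
    Hr Hd Hrd Hl Hw Hd0 Hlls Hcl HKL.
  assert (Hdec : forall k, l (S k) <= l k).
  { intros k. specialize (Hl k). specialize (Hd k). nra. }
  assert (Hge : forall k, ls <= l k).
  { intros k. apply decreasing_ineq with (Un := l); assumption. }
  assert (Hmain : forall eps, eps > 0 -> exists p, forall k, (p <= k)%nat -> r k < eps).
  2:{ intros eps He. destruct (Hmain eps He) as [p Hp]. exists p. intros k Hk.
      unfold Rdist. rewrite Rminus_0_r, Rabs_pos_eq by apply Hr. now apply Hp. }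
  intros eps0 He0.
  (* The Kurdyka-Lojasiewicz inequality speaks only of values above [ls]. If [ls] is attained, the
     values are constant from there on, all later steps vanish, and [r] no longer increases. *)
  destruct (classic (exists k0, l k0 <= ls)) as [[k0 Hk0]|Hpos].
  - assert (Heq : forall k, (k0 <= k)%nat -> l k = ls).
    { intros k Hk. apply Rle_antisym; [|apply Hge].
      induction Hk as [|k' Hk' IH]; [exact Hk0|]. specialize (Hdec k'). lra. }
    destruct (Hcl eps0 k0 He0) as (p & Hp & Hrp). exists p. intros k Hk.
    induction Hk as [|k' Hk' IH]; [exact Hrp|].
    specialize (Hl k'). rewrite (Heq k'), (Heq (S k')) in Hl by lia.
    specialize (Hd k'). specialize (Hrd k'). assert (delta k' <= 0); [|lra].
    apply Rnot_lt_le. intros Hlt.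
    assert (0 < a * (delta k' * delta k')) by (apply Rmult_lt_0_compat; nra). lra.
  - assert (Hgt : forall k, ls < l k).
    { intros k. apply Rnot_le_lt. intros H. apply Hpos. now exists k. }
    (* Later distances will be at most r (S p) + delta p + c g (S p), and each of the three terms is
       made smaller than eps/3. As [eps <= del], the iterates then stay where the inequality is
       available. *)
    set (eps := Rmin eps0 del).
    assert (He : eps > 0) by (apply Rmin_glb_lt; lra).
    assert (Hee : eps <= eps0) by apply Rmin_l.
    assert (Hed : eps <= del) by apply Rmin_r.
    set (c := b / a). assert (Hc : c > 0) by (apply Rdiv_lt_0_compat; lra).
    destruct (Hphc 0 ltac:(lra) (eps / (3 * c))) as (d & Hdp & Hdc);
      [apply Rdiv_lt_0_compat; lra|].
    destruct (Hlls (Rmin d eta)) as [N1 HN1]; [apply Rmin_glb_lt; lra|].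
    assert (Hlk : forall k, (N1 <= k)%nat -> l k - ls < d /\ l k - ls < eta).
    { intros k Hk. specialize (HN1 k Hk). unfold Rdist in HN1.
      rewrite Rabs_pos_eq in HN1 by (specialize (Hge k); lra).
      pose proof (Rmin_l d eta). pose proof (Rmin_r d eta). lra. }
    destruct (Hd0 (eps / 3)) as [N2 HN2]; [lra|].
    destruct (Hcl (eps / 3) (S (N1 + N2)) ltac:(lra)) as (p & Hp & Hrp).
    (* The telescoped sum starts with the step that leads to the chosen index, so this index is
       written [S p]. *)
    destruct p as [|p]; [lia|].
    set (g := fun k => ph (l k - ls)).
    assert (Hg : forall k, (N1 <= k)%nat -> 0 <= g k).
    { intros k Hk. apply Hphp. specialize (Hlk k Hk). specialize (Hgt k). lra. }
    assert (Hgp : c * g (S p) < eps / 3).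
    { destruct (Hlk (S p) ltac:(lia)) as [? ?]. pose proof (Hgt (S p)).
      specialize (Hdc (l (S p) - ls) ltac:(lra)). rewrite Rminus_0_r in Hdc.
      rewrite Rabs_pos_eq in Hdc by lra. specialize (Hdc ltac:(lra)).
      rewrite Hph0, Rminus_0_r in Hdc. fold (g (S p)) in Hdc.
      rewrite Rabs_pos_eq in Hdc by (apply Hg; lia).
      apply Rlt_le_trans with (c * (eps / (3 * c))); [apply Rmult_lt_compat_l; lra|].
      right. field. lra. }
    assert (Hdp2 : delta p < eps / 3).
    { specialize (HN2 p ltac:(lia)). unfold Rdist in HN2.
      rewrite Rminus_0_r, Rabs_pos_eq in HN2 by apply Hd. exact HN2. }
    (* [2 delta (S k) <= delta k + c (g (S k) - g (S (S k)))] telescopes. *)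
    assert (Hq : forall q, r (S (p + q)) <= r (S p) + delta p - delta (p + q)%nat
                             + c * (g (S p) - g (S (p + q)))).
    { induction q as [|q IH]; [rewrite Nat.add_0_r; lra|].
      rewrite Nat.add_succ_r. set (k := (p + q)%nat) in *.
      pose proof (Hd k) as Hdk. pose proof (Hd (S k)) as Hdk1.
      assert (Hgk : 0 <= g (S k)) by (apply Hg; unfold k; lia).
      assert (Hcg : 0 <= c * g (S k)) by nra.
      (* The induction hypothesis itself keeps iterate [S k] in the neighbourhood where the
         inequality holds. *)
      assert (Hin : r (S k) < del) by (rewrite Rmult_minus_distr_l in IH; lra).
      destruct (Hlk (S k)) as [_ Hlt]; [unfold k; lia|].
      pose proof (Hgt (S k)) as Hg1. pose proof (Hgt (S (S k))) as Hg2.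
      pose proof (Hdec (S k)) as Hdec1.
      specialize (HKL (S k) Hin ltac:(lra)).
      destruct (Hphd (l (S k) - ls) ltac:(lra)) as [Hder Hdpos].
      set (D := dph (l (S k) - ls)) in *.
      pose proof (concave_slope ph eta (l (S k) - ls) (l (S (S k)) - ls) D Hphv Hder
                    ltac:(lra) ltac:(lra)) as Hsl.
      fold (g (S k)) in Hsl. fold (g (S (S k))) in Hsl.
      destruct (Hw k) as [Hw0 Hw1]. specialize (Hl (S k)).
      set (G := g (S k) - g (S (S k))).
      (* By concavity the decrease of [ph] dominates its slope times the decrease of [l], and the
         latter is at least a delta^2. *)
      assert (HG : D * (a * (delta (S k) * delta (S k))) <= G).
      { apply Rle_trans with (D * (l (S k) - l (S (S k)))); [|unfold G; lra].
        apply Rmult_le_compat_l; lra. }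
      assert (HDb : 1 <= D * (b * delta k)).
      { apply Rle_trans with (D * w (S k)); [lra|]. apply Rmult_le_compat_l; lra. }
      assert (Haa : 0 <= a * (delta (S k) * delta (S k))) by nra.
      assert (Hsq : a * (delta (S k) * delta (S k)) <= delta k * (b * G)).
      { apply Rle_trans with (D * (b * delta k) * (a * (delta (S k) * delta (S k)))).
        - rewrite <- (Rmult_1_l (a * _)) at 1. apply Rmult_le_compat_r; assumption.
        - replace (D * (b * delta k) * (a * (delta (S k) * delta (S k))))
            with ((b * delta k) * (D * (a * (delta (S k) * delta (S k))))) by ring.
          replace (delta k * (b * G)) with (b * delta k * G) by ring.
          apply Rmult_le_compat_l; [nra|exact HG]. }
      assert (HG0 : 0 <= G) by nra.
      assert (HcG : 0 <= c * G) by nra.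
      assert (Hsq2 : delta (S k) * delta (S k) <= delta k * (c * G)).
      { apply Rmult_le_reg_l with a; [lra|].
        replace (a * (delta k * (c * G))) with (delta k * (b * G)); [exact Hsq|].
        unfold c. field. lra. }
      (* Arithmetic-geometric mean inequality, from (delta k - c G)^2 >= 0. *)
      assert (H2 : 2 * delta (S k) <= delta k + c * G).
      { apply Rsqr_incr_0_var; [|lra]. unfold Rsqr.
        pose proof (Rle_0_sqr (delta k - c * G)) as Hs. unfold Rsqr in Hs. nra. }
      specialize (Hrd (S k)).
      replace (c * (g (S p) - g (S (S k)))) with (c * (g (S p) - g (S k)) + c * G)
        by (unfold G; ring).
      lra. }
    exists (S p). intros k Hk. specialize (Hq (k - S p)%nat).
    replace (S (p + (k - S p))) with k in Hq by lia.
    pose proof (Hd (p + (k - S p))%nat).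
    assert (0 <= c * g k) by (apply Rmult_le_pos; [lra|apply Hg; lia]).
    rewrite Rmult_minus_distr_l in Hq. lra.
Qed.

(** The source of all first-order conditions below: minimality along a segment gives such a
    quadratic in s, and for small s its sign is that of the linear coefficient. *)
Lemma nonneg_of_small_quadratic a b :
  (forall s, 0 < s <= 1 -> 0 <= s * a + s * s * b) -> 0 <= a.
Proof.
  intros H. apply Rnot_lt_le. intros Ha.
  (* For a < 0 this s satisfies s b <= - a / 2, so s a + s^2 b is negative. *)
  set (s := Rmin 1 (- a / (2 * (Rabs b + 1)))).
  pose proof (Rabs_pos b) as Hb. pose proof (Rle_abs b) as Hbb.
  assert (Hs0 : 0 < - a / (2 * (Rabs b + 1))) by (apply Rdiv_lt_0_compat; lra).
  assert (Hs : 0 < s <= 1) by (split; [apply Rmin_glb_lt; lra|apply Rmin_l]).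
  assert (Hs2 : s * (2 * (Rabs b + 1)) <= - a).
  { replace (- a) with (- a / (2 * (Rabs b + 1)) * (2 * (Rabs b + 1))) by (field; lra).
    apply Rmult_le_compat_r; [lra|apply Rmin_r]. }
  specialize (H s Hs).
  assert (s * b <= - a / 2) by nra. nra.
Qed.

(** * The data-fidelity term *)

Definition Phi_partials (pr : problem) : Prop :=
  forall p r c th, (p < pP pr)%nat -> (r < pn pr)%nat -> (c < pn pr)%nat ->
    derivable_pt_lim (fun s => Phit pr (upd th p s) r c) (th p) (pdPhi pr p th r c).

Definition Phi_second_partials (pr : problem) : Prop :=
  exists d2Phi : nat -> nat -> vec -> nat -> nat -> R,
    forall p p' r c, (p < pP pr)%nat -> (p' < pP pr)%nat -> (r < pn pr)%nat -> (c < pn pr)%nat ->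
      (forall th, derivable_pt_lim (fun s => pdPhi pr p (upd th p' s) r c) (th p')
                    (d2Phi p p' th r c)) /\
      cont_fun (pP pr) (fun th => d2Phi p p' th r c).

Definition orthonormal_rows (pr : problem) : Prop :=
  forall r r', (r < dimx pr)%nat -> (r' < dimx pr)%nat ->
    sumR (dimW pr) (fun c => pW pr r c * pW pr r' c) = if Nat.eqb r r' then 1 else 0.

Section Smoothness.
Variable pr : problem.
Notation m := (pm pr).
Notation n := (pn pr).
Notation M := (pM pr).
Notation P := (pP pr).
Notation dx := (dimx pr).
Notation dt := (dimt pr).

Definition dimz : nat := (dx + dt)%nat.
Definition join (x t : vec) : vec := fun i => if Nat.ltb i dx then x i else t (i - dx)%nat.
(** Offset in z of the block of observation [S j]: sums run over j from 0, while observations are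
    numbered from 1. *)
Definition toff (j : nat) : nat := (dx + j * P)%nat.
Definition dom (B : R) (z : vec) : Prop :=
  (forall i, (i < dx)%nat -> Rabs (z i) <= B) /\ inC pr (blk dx z).

Lemma blk_join x t : blk dx (join x t) = t.
Proof.
  apply functional_extensionality. intros i. unfold blk, join.
  destruct (Nat.ltb_spec (dx + i) dx); [lia|]. f_equal. lia.
Qed.

Lemma join_l x t i : (i < dx)%nat -> join x t i = x i.
Proof. intros Hi. unfold join. destruct (Nat.ltb_spec i dx); [reflexivity|lia]. Qed.

Lemma join_r x t i : join x t (dx + i)%nat = t i.
Proof. exact (f_equal (fun f => f i) (blk_join x t)). Qed.

Lemma tblk_S t j : tblk pr t (S j) = blk (j * P) t.
Proof.
  apply functional_extensionality. intros p. unfold tblk, blk.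
  now replace (S j - 1)%nat with j by lia.
Qed.

Lemma blk_toff z j : blk (toff j) z = tblk pr (blk dx z) (S j).
Proof.
  rewrite tblk_S. apply functional_extensionality. intros p. unfold blk, toff. f_equal. lia.
Qed.

Lemma blk_toff_join x t j : blk (toff j) (join x t) = tblk pr t (S j).
Proof. now rewrite blk_toff, blk_join. Qed.

Lemma dom_join B x t : (forall i, (i < dx)%nat -> Rabs (x i) <= B) -> inC pr t -> dom B (join x t).
Proof.
  intros Hx Ht. split; [|now rewrite blk_join].
  intros i Hi. rewrite join_l; auto.
Qed.

Lemma block_lt a b j p : (j < a)%nat -> (p < b)%nat -> (j * b + p < a * b)%nat.
Proof. intros. nia. Qed.

Lemma inCj_S j t : inCj pr (S j) t <-> box P (blk (j * P) (plo pr)) (blk (j * P) (phi pr)) t.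
Proof.
  unfold inCj, box, blk. split; intros H p Hp; specialize (H p Hp);
    replace (S j - 1)%nat with j in * by lia; exact H.
Qed.

Lemma inC_block t j : inC pr t -> (j < m)%nat -> inCj pr (S j) (tblk pr t (S j)).
Proof.
  intros H Hj p Hp. unfold tblk. apply H. replace (S j - 1)%nat with j by lia.
  now apply block_lt.
Qed.

Lemma inC_of_blocks t : (forall j, (j < m)%nat -> inCj pr (S j) (tblk pr t (S j))) -> inC pr t.
Proof.
  intros H i Hi. unfold dimt in Hi.
  assert (HP : P <> 0%nat) by nia.
  assert (Hj : (i / P < m)%nat) by (apply Nat.Div0.div_lt_upper_bound; lia).
  specialize (H _ Hj (i mod P) (Nat.mod_upper_bound i P HP)). unfold tblk in H.
  replace ((S (i / P) - 1) * P + i mod P)%nat with i in H; [exact H|].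
  replace (S (i / P) - 1)%nat with (i / P)%nat by lia.
  rewrite (Nat.div_mod_eq i P) at 1. lia.
Qed.

Lemma trunc_ext d u v : (forall p, (p < d)%nat -> u p = v p) -> trunc d u = trunc d v.
Proof.
  intros H. apply functional_extensionality. intros i. unfold trunc.
  destruct (Nat.ltb_spec i d); auto.
Qed.

Lemma Phit_ext u v : (forall p, (p < P)%nat -> u p = v p) -> Phit pr u = Phit pr v.
Proof. intros H. unfold Phit. now rewrite (trunc_ext P u v). Qed.

Lemma xblk_lt j k : (j <= m)%nat -> (k < n)%nat -> (j * n + k < dx)%nat.
Proof. intros. apply block_lt; lia. Qed.

Lemma matvec_ext c A u v r :
  (forall k, (k < c)%nat -> u k = v k) -> matvec c A u r = matvec c A v r.
Proof. intros H. apply sumR_ext. intros k Hk. now rewrite H. Qed.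

Lemma resid_ext j x x' t r : (j <= m)%nat -> (forall i, (i < dx)%nat -> x i = x' i) ->
  resid pr j x t r = resid pr j x' t r.
Proof.
  intros Hj H. unfold resid.
  rewrite (matvec_ext n _ _ (matvec n (Phit pr t) (xblk pr x' 0))).
  - rewrite (matvec_ext n _ (xblk pr x j) (xblk pr x' j)); [reflexivity|].
    intros k Hk. apply H. now apply xblk_lt.
  - intros k Hk. apply matvec_ext. intros i Hi. apply H. exact (xblk_lt 0 i (Nat.le_0_l _) Hi).
Qed.

Lemma AJ_ext j x x' t r p : (forall i, (i < dx)%nat -> x i = x' i) ->
  AJ pr j x t r p = AJ pr j x' t r p.
Proof.
  intros H. apply sumR_ext. intros c Hc. f_equal. apply matvec_ext. intros i Hi.
  apply H. exact (xblk_lt 0 i (Nat.le_0_l _) Hi).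
Qed.

Lemma qfun_ext j x x' t : (j <= m)%nat -> (forall i, (i < dx)%nat -> x i = x' i) ->
  qfun pr j x t = qfun pr j x' t.
Proof. intros Hj H. apply sumR_ext. intros r _. now rewrite (resid_ext j x x'). Qed.

Lemma fit_ext x x' t : (forall i, (i < dx)%nat -> x i = x' i) -> fit pr x t = fit pr x' t.
Proof. intros H. apply sumR_ext. intros j Hj. apply qfun_ext; auto. Qed.

Lemma gradq_ext j x x' t p : (j <= m)%nat -> (forall i, (i < dx)%nat -> x i = x' i) ->
  gradq pr j x t p = gradq pr j x' t p.
Proof.
  intros Hj H. unfold gradq. f_equal. apply sumR_ext. intros r _.
  now rewrite (resid_ext j x x'), (AJ_ext j x x').
Qed.

Lemma Hmat_ext j x x' t p q : (forall i, (i < dx)%nat -> x i = x' i) ->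
  Hmat pr j x t p q = Hmat pr j x' t p q.
Proof.
  intros H. unfold Hmat. f_equal. apply sumR_ext. intros r _.
  now rewrite !(AJ_ext j x x').
Qed.

Hypothesis HdPhi : Phi_partials pr.
Hypothesis HC2 : Phi_second_partials pr.

(** [pdPhi] is given as a function of a whole sequence. It reads only the first P coordinates
    because it is the derivative of [Phit], which truncates its argument, and derivatives are
    unique. *)
Lemma pdPhi_ext p r c u v : (p < P)%nat -> (r < n)%nat -> (c < n)%nat ->
  (forall q, (q < P)%nat -> u q = v q) -> pdPhi pr p u r c = pdPhi pr p v r c.
Proof.
  intros Hp Hr Hc H.
  apply uniqueness_limite with (fun s => Phit pr (upd u p s) r c) (u p).
  - now apply HdPhi.
  - rewrite (H p Hp).
    replace (fun s => Phit pr (upd u p s) r c) with (fun s => Phit pr (upd v p s) r c).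
    + now apply HdPhi.
    + apply functional_extensionality. intros s. rewrite (Phit_ext (upd v p s) (upd u p s)); [reflexivity|].
      intros q Hq. unfold upd. destruct Nat.eqb; [reflexivity|]. symmetry. now apply H.
Qed.

Lemma Lip_pdPhi_box lo hi p r c : (p < P)%nat -> (r < n)%nat -> (c < n)%nat ->
  Lip P (box P lo hi) (fun t => pdPhi pr p t r c).
Proof.
  intros Hp Hr Hc. destruct HC2 as [d2 H2].
  apply Lip_box_of_partials with (fun p' t => d2 p p' t r c).
  - intros u v. now apply pdPhi_ext.
  - intros p' th Hp'. now apply H2.
  - intros p' Hp'. destruct (cont_bounded_on_box P lo hi (fun t => d2 p p' t r c)) as (K & _ & HK).
    + now apply H2.
    + now exists K.
Qed.

Lemma dom_box B j z : (j < m)%nat -> dom B z ->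
  box P (blk (j * P) (plo pr)) (blk (j * P) (phi pr)) (blk (toff j) z).
Proof. intros Hj [_ H]. rewrite blk_toff. apply inCj_S. now apply inC_block. Qed.

Lemma toff_le j : (j < m)%nat -> (toff j + P <= dimz)%nat.
Proof. intros Hj. unfold toff, dimz, dimt. nia. Qed.

(** [gPhi], [gPhix], [gres], [gq] and [gfit] are the gradients in z of an entry of Phi(theta_j), an
    entry of Phi(theta_j) x_0, a residual, a single [qfun] and [fit], in the shape in which the
    rules for [C11] produce them. *)
Definition gPhi (j c k : nat) : vec -> nat -> R :=
  blk_grad (toff j) P (fun t p => pdPhi pr p t c k).

Lemma C11_Phi B j c k : (j < m)%nat -> (c < n)%nat -> (k < n)%nat ->
  C11 dimz (dom B) (fun z => Phit pr (blk (toff j) z) c k) (gPhi j c k).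
Proof.
  intros Hj Hc Hk.
  apply (C11_blk (toff j) P dimz (dom B) _ (fun t => Phit pr t c k)
           (fun t p => pdPhi pr p t c k) (toff_le j Hj) (fun z => dom_box B j z Hj)).
  apply (C11_box P _ _ (fun t => Phit pr t c k) (fun p t => pdPhi pr p t c k)).
  - intros u v H. now rewrite (Phit_ext u v H).
  - intros p th Hp. now apply HdPhi.
  - intros p Hp. now apply Lip_pdPhi_box.
Qed.

Definition ind (k i : nat) : R := if Nat.eqb k i then 1 else 0.

Lemma C11_x B k : (k < dx)%nat -> C11 dimz (dom B) (fun z => z k) (fun _ i => ind k i).
Proof.
  intros Hk. apply C11_coord with B; [unfold dimz; lia|]. intros z [Hz _]. now apply Hz.
Qed.

Definition gPhix (j c : nat) (z : vec) (i : nat) : R :=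
  sumR n (fun k => gPhi j c k z i * z k + Phit pr (blk (toff j) z) c k * ind k i).

Definition gres (j r : nat) (z : vec) (i : nat) : R :=
  sumR n (fun c => Aj pr (S j) r c * gPhix j c z i)
  + sumR n (fun c => Aj pr (S j) r c * ind (S j * n + c) i).

Lemma C11_resid B j r : (j < m)%nat ->
  C11 dimz (dom B) (fun z => resid pr (S j) z (blk (toff j) z) r) (gres j r).
Proof.
  intros Hj.
  assert (H1 : C11 dimz (dom B)
            (fun z => sumR n (fun c => Aj pr (S j) r c
                          * sumR n (fun k => Phit pr (blk (toff j) z) c k * z k)))
            (fun z i => sumR n (fun c => Aj pr (S j) r c * gPhix j c z i))).
  { apply (C11_sumR dimz (dom B) n
      (fun c z => Aj pr (S j) r c * sumR n (fun k => Phit pr (blk (toff j) z) c k * z k))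
      (fun c z i => Aj pr (S j) r c * gPhix j c z i)).
    intros c Hc. apply (C11_scal dimz (dom B) (Aj pr (S j) r c)
      (fun z => sumR n (fun k => Phit pr (blk (toff j) z) c k * z k)) (gPhix j c)).
    apply (C11_sumR dimz (dom B) n
      (fun k z => Phit pr (blk (toff j) z) c k * z k)
      (fun k z i => gPhi j c k z i * z k + Phit pr (blk (toff j) z) c k * ind k i)).
    intros k Hk.
    apply (C11_mult dimz (dom B) (fun z => Phit pr (blk (toff j) z) c k) (gPhi j c k)
             (fun z => z k) (fun _ i => ind k i)).
    - now apply C11_Phi.
    - apply C11_x. unfold dimx. nia. }
  assert (H2 : C11 dimz (dom B)
            (fun z => sumR n (fun c => Aj pr (S j) r c * z (S j * n + c)%nat))
            (fun z i => sumR n (fun c => Aj pr (S j) r c * ind (S j * n + c) i))).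
  { apply (C11_sumR dimz (dom B) n
      (fun c z => Aj pr (S j) r c * z (S j * n + c)%nat)
      (fun c z i => Aj pr (S j) r c * ind (S j * n + c) i)).
    intros c Hc. apply (C11_scal dimz (dom B) (Aj pr (S j) r c)
      (fun z => z (S j * n + c)%nat) (fun _ i => ind (S j * n + c) i)).
    apply C11_x. now apply xblk_lt. }
  pose proof (C11_plus dimz (dom B) _ _ _ _ (C11_plus dimz (dom B) _ _ _ _ H1 H2)
                (C11_const dimz (dom B) (- yblk pr (S j) r))) as H3.
  eapply C11_ext; [| |exact H3].
  - intros z _. reflexivity.
  - intros z i _ _. unfold gres. simpl. ring.
Qed.

Definition gq (j : nat) (z : vec) (i : nat) : R :=
  2 * sumR M (fun r => gres j r z i * resid pr (S j) z (blk (toff j) z) r).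

Lemma C11_qfun B j : (j < m)%nat ->
  C11 dimz (dom B) (fun z => qfun pr (S j) z (blk (toff j) z)) (gq j).
Proof.
  intros Hj.
  pose proof (C11_sumR dimz (dom B) M
    (fun r z => resid pr (S j) z (blk (toff j) z) r * resid pr (S j) z (blk (toff j) z) r)
    (fun r z i => gres j r z i * resid pr (S j) z (blk (toff j) z) r
                  + resid pr (S j) z (blk (toff j) z) r * gres j r z i)) as H.
  eapply C11_ext; [| |apply H].
  - intros z _. reflexivity.
  - intros z i _ _. unfold gq. rewrite <- sumR_scal. apply sumR_ext. intros r _. ring.
  - intros r _. apply (C11_mult dimz (dom B)); now apply C11_resid.
Qed.

Lemma ind_ne k i : k <> i -> ind k i = 0.
Proof. intros H. unfold ind. now destruct (Nat.eqb_spec k i). Qed.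

(** Identifies the gradient built by the [C11] rules with the matrix [AJ] of the algorithm: at
    theta-indices the derivatives of the x-coordinates vanish, and block j' of theta enters only its
    own residual. *)
Lemma gres_theta j j' r z p : (j < m)%nat -> (p < P)%nat ->
  gres j r z (toff j' + p) = if Nat.eqb j j' then AJ pr (S j) z (blk (toff j) z) r p else 0.
Proof.
  intros Hj Hp. unfold gres. rewrite (sumR_0 n (fun c => _ * ind _ _)), Rplus_0_r.
  2:{ intros c Hc. rewrite ind_ne; [ring|]. pose proof (xblk_lt (S j) c Hj Hc).
      unfold toff. lia. }
  assert (E : forall c, (c < n)%nat -> gPhix j c z (toff j' + p)
              = sumR n (fun k => gPhi j c k z (toff j' + p) * z k)).
  { intros c Hc. apply sumR_ext. intros k Hk. rewrite ind_ne; [ring|].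
    pose proof (xblk_lt 0 k (Nat.le_0_l _) Hk). unfold toff. lia. }
  destruct (Nat.eqb_spec j j') as [<-|Hne].
  - unfold AJ. apply sumR_ext. intros c Hc. f_equal. rewrite E by exact Hc.
    apply sumR_ext. intros k Hk. unfold gPhi. rewrite blk_grad_in by exact Hp. reflexivity.
  - apply sumR_0. intros c Hc. rewrite E by exact Hc. rewrite sumR_0; [ring|].
    intros k Hk. unfold gPhi. rewrite blk_grad_out; [ring|]. unfold toff.
    assert (j < j' \/ j' < j)%nat as [Hl|Hl] by lia; [right|left]; nia.
Qed.

Lemma gq_theta j j' z p : (j < m)%nat -> (p < P)%nat ->
  gq j z (toff j' + p) = if Nat.eqb j j' then gradq pr (S j) z (blk (toff j) z) p else 0.
Proof.
  intros Hj Hp. unfold gq.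
  destruct (Nat.eqb j j') eqn:E.
  - unfold gradq. f_equal. apply sumR_ext. intros r _. rewrite gres_theta, E; auto.
  - rewrite sumR_0; [ring|]. intros r _. rewrite gres_theta, E; auto. ring.
Qed.

Definition gfit (z : vec) (i : nat) : R := sumR m (fun j => gq j z i).

Lemma C11_fit B : C11 dimz (dom B) (fun z => fit pr z (blk dx z)) gfit.
Proof.
  eapply C11_ext; [| |apply (C11_sumR dimz (dom B) m
    (fun j z => qfun pr (S j) z (blk (toff j) z)) gq)].
  - intros z _. apply sumR_ext. intros j _. now rewrite blk_toff.
  - reflexivity.
  - intros j Hj. now apply C11_qfun.
Qed.

(** Since theta_j enters only q_j, the partial gradients used block by block in step (2) assemble to
    the theta-part of the gradient of [fit]. *)
Lemma gfit_theta j z p : (j < m)%nat -> (p < P)%nat ->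
  gfit z (toff j + p) = gradq pr (S j) z (blk (toff j) z) p.
Proof.
  intros Hj Hp. unfold gfit. rewrite (sumR_single m _ j Hj).
  - rewrite gq_theta, Nat.eqb_refl; auto.
  - intros k Hk Hne. rewrite gq_theta by assumption.
    now destruct (Nat.eqb_spec k j).
Qed.

Lemma gfit_join_theta j x t p : (j < m)%nat -> (p < P)%nat ->
  gfit (join x t) (toff j + p) = gradq pr (S j) x (tblk pr t (S j)) p.
Proof.
  intros Hj Hp. rewrite gfit_theta, blk_toff_join by assumption.
  apply gradq_ext; [lia|]. intros. now apply join_l.
Qed.

Lemma fit_join x t : fit pr (join x t) (blk dx (join x t)) = fit pr x t.
Proof. rewrite blk_join. apply fit_ext. intros. now apply join_l. Qed.

Lemma dot_dimz u v : dot dimz u v = dot dx u v + dot dt (blk dx u) (blk dx v).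
Proof. unfold dot, dimz. now rewrite sumR_app. Qed.

Lemma n1_dimz u : n1 dimz u = n1 dx u + n1 dt (blk dx u).
Proof. unfold n1, dimz. now rewrite sumR_app. Qed.

Lemma sqn_join x t x' t' :
  sqn dimz (vsub (join x t) (join x' t')) = sqn dx (vsub x x') + sqn dt (vsub t t').
Proof.
  unfold sqn. rewrite dot_dimz. f_equal.
  - apply sumR_ext. intros i Hi. unfold vsub. now rewrite !join_l.
  - apply sumR_ext. intros i Hi. unfold blk, vsub. now rewrite !join_r.
Qed.

Lemma n1_join x t x' t' :
  n1 dimz (vsub (join x t) (join x' t')) = n1 dx (vsub x x') + n1 dt (vsub t t').
Proof.
  rewrite n1_dimz. f_equal.
  - apply sumR_ext. intros i Hi. unfold vsub. now rewrite !join_l.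
  - apply sumR_ext. intros i Hi. unfold blk, vsub. now rewrite !join_r.
Qed.

(** * Changing a single block of theta *)

Definition setblk (t : vec) (j : nat) (s : vec) : vec :=
  fun i => if andb (Nat.leb (j * P) i) (Nat.ltb i (j * P + P)) then s (i - j * P)%nat else t i.

Lemma setblk_in t j s p : (p < P)%nat -> setblk t j s (j * P + p)%nat = s p.
Proof.
  intros Hp. unfold setblk.
  destruct (Nat.leb_spec (j * P) (j * P + p)), (Nat.ltb_spec (j * P + p) (j * P + P));
    try lia. simpl. f_equal. lia.
Qed.

Lemma setblk_out t j s i : (i < j * P \/ j * P + P <= i)%nat -> setblk t j s i = t i.
Proof.
  intros Hi. unfold setblk.
  destruct (Nat.leb_spec (j * P) i), (Nat.ltb_spec i (j * P + P)); try lia; reflexivity.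
Qed.

Lemma inC_setblk t j s : inC pr t -> inCj pr (S j) s -> inC pr (setblk t j s).
Proof.
  intros Ht Hs i Hi.
  destruct (Nat.lt_ge_cases i (j * P)) as [H1|H1]; [rewrite setblk_out; auto|].
  destruct (Nat.lt_ge_cases i (j * P + P)) as [H2|H2]; [|rewrite setblk_out; auto].
  replace i with (j * P + (i - j * P))%nat by lia. rewrite setblk_in by lia.
  apply inCj_S; [exact Hs|lia].
Qed.

(** Used with [f] an absolute value and with [f] the multiplication by a gradient entry, to reduce
    the l1 norm and the inner product to block j. *)
Lemma sumR_setblk f t j s :
  (j < m)%nat -> (forall a, f a 0 = 0) ->
  sumR dt (fun i => f i (setblk t j s i - t i))
  = sumR P (fun p => f (j * P + p)%nat (s p - tblk pr t (S j) p)).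
Proof.
  intros Hj Hf. rewrite tblk_S. unfold dimt.
  replace (m * P)%nat with (j * P + (P + (m - j - 1) * P))%nat
    by (rewrite Nat.mul_sub_distr_r, Nat.mul_sub_distr_r; nia).
  rewrite !sumR_app.
  rewrite (sumR_0 (j * P)) by (intros; rewrite setblk_out, Rminus_diag by lia; apply Hf).
  rewrite (sumR_0 ((m - j - 1) * P))
    by (intros; rewrite setblk_out, Rminus_diag by lia; apply Hf).
  rewrite Rplus_0_l, Rplus_0_r. apply sumR_ext. intros p Hp.
  now rewrite setblk_in.
Qed.

(** The upper Taylor bound for two joint points that differ in one block of theta. [K] depends on
    [B] only, hence serves all points with that bound. *)
Lemma qfun_descent B : exists K, 0 <= K /\ forall j x t s, (j < m)%nat ->
  (forall i, (i < dx)%nat -> Rabs (x i) <= B) -> inC pr t -> inCj pr (S j) s ->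
  qfun pr (S j) x s <= qfun pr (S j) x (tblk pr t (S j))
    + dot P (gradq pr (S j) x (tblk pr t (S j))) (vsub s (tblk pr t (S j)))
    + K * (n1 P (vsub s (tblk pr t (S j))) * n1 P (vsub s (tblk pr t (S j)))).
Proof.
  destruct (fin_max m (fun j K => forall z z', dom B z -> dom B z' ->
     qfun pr (S j) z' (blk (toff j) z') <= qfun pr (S j) z (blk (toff j) z)
     + dot dimz (gq j z) (vsub z' z) + K * (n1 dimz (vsub z' z) * n1 dimz (vsub z' z))))
    as (K & HK & H).
  { intros j K K' _ HK H z z' Hz Hz'. specialize (H z z' Hz Hz').
    pose proof (n1_sqr_nonneg dimz (vsub z' z)). nra. }
  { intros j Hj. destruct (C11_lower _ _ _ _ (C11_qfun B j Hj)) as (K & _ & H).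
    exists K. intros z z' Hz Hz'. now apply H. }
  exists K. split; [exact HK|]. intros j x t s Hj Hx Ht Hs.
  specialize (H j Hj (join x t) (join x (setblk t j s))
                (dom_join _ _ _ Hx Ht) (dom_join _ _ _ Hx (inC_setblk _ _ _ Ht Hs))).
  rewrite !blk_toff_join in H.
  rewrite !(qfun_ext (S j) (join x _) x) in H by (try lia; intros; now apply join_l).
  rewrite (n1_join x (setblk t j s) x t) in H.
  replace (n1 dx (vsub x x)) with 0 in H
    by (symmetry; apply sumR_0; intros; unfold vsub; rewrite Rminus_diag; apply Rabs_R0).
  rewrite Rplus_0_l in H.
  replace (n1 dt (vsub (setblk t j s) t)) with (n1 P (vsub s (tblk pr t (S j)))) in H
    by (symmetry; apply (sumR_setblk (fun _ a => Rabs a) t j s Hj); intros; apply Rabs_R0).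
  replace (dot dimz (gq j (join x t)) (vsub (join x (setblk t j s)) (join x t)))
    with (dot P (gradq pr (S j) x (tblk pr t (S j))) (vsub s (tblk pr t (S j)))) in H.
  (* The new block agrees with [s] on its first P coordinates, which are all that [Phit] reads. *)
  - replace (qfun pr (S j) x s) with (qfun pr (S j) x (tblk pr (setblk t j s) (S j))); [exact H|].
    unfold qfun, sqn, dot. apply sumR_ext. intros r _. unfold resid.
    rewrite (Phit_ext (tblk pr (setblk t j s) (S j)) s); [reflexivity|].
    intros p Hp. rewrite tblk_S. now apply setblk_in.
  - rewrite dot_dimz. unfold dot at 2. rewrite sumR_0, Rplus_0_l.
    2:{ intros i Hi. unfold vsub. rewrite !join_l, Rminus_diag by exact Hi. ring. }
    symmetry. etransitivity;
      [|etransitivity; [apply (sumR_setblk (fun i a => gq j (join x t) (dx + i)%nat * a) t j s Hj)|]].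
    + apply sumR_ext. intros i _. unfold blk, vsub. now rewrite !join_r.
    + intros. ring.
    + apply sumR_ext. intros p Hp. f_equal.
      replace (dx + (j * P + p))%nat with (toff j + p)%nat by (unfold toff; lia).
      rewrite gq_theta, Nat.eqb_refl, blk_toff_join by assumption.
      apply gradq_ext; [lia|]. intros. now apply join_l.
Qed.

(** The entries of [AJ] are theta-components of the gradient of a residual, hence bounded on [dom],
    and those of [Hmat] are finite sums of products of them. *)
Lemma Hmat_bounded B : exists K, 0 <= K /\ forall j x t p q,
  (j < m)%nat -> (p < P)%nat -> (q < P)%nat ->
  (forall i, (i < dx)%nat -> Rabs (x i) <= B) -> inC pr t ->
  Rabs (Hmat pr (S j) x (tblk pr t (S j)) p q) <= K.
Proof.
  assert (HAJ : forall j r p, (j < m)%nat -> (p < P)%nat ->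
            Lip dimz (dom B) (fun z => AJ pr (S j) z (blk (toff j) z) r p)).
  { intros j r p Hj Hp. apply Lip_ext with (fun z => gres j r z (toff j + p)).
    - intros z _. rewrite gres_theta, Nat.eqb_refl; auto.
    - apply (C11_resid B j r Hj). pose proof (toff_le j Hj). lia. }
  destruct (fin_max m (fun j K => forall p, (p < P)%nat -> forall q, (q < P)%nat ->
     forall z, dom B z -> Rabs (Hmat pr (S j) z (blk (toff j) z) p q) <= K)) as (K & HK & H).
  { intros j K K' _ HK H p Hp q Hq z Hz. specialize (H p Hp q Hq z Hz). lra. }
  { intros j Hj.
    destruct (fin_max P (fun p K => forall q, (q < P)%nat ->
     forall z, dom B z -> Rabs (Hmat pr (S j) z (blk (toff j) z) p q) <= K)) as (K & _ & H).
    { intros p K K' _ HK H q Hq z Hz. specialize (H q Hq z Hz). lra. }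
    2:{ exists K. auto. }
    intros p Hp.
    destruct (fin_max P (fun q K =>
     forall z, dom B z -> Rabs (Hmat pr (S j) z (blk (toff j) z) p q) <= K)) as (K & _ & H).
    { intros q K K' _ HK H z Hz. specialize (H z Hz). lra. }
    2:{ exists K. auto. }
    intros q Hq.
    destruct (Lip_scal dimz (dom B) 2 _ (Lip_sumR dimz (dom B) M
      (fun r z => AJ pr (S j) z (blk (toff j) z) r p * AJ pr (S j) z (blk (toff j) z) r q)
      (fun r _ => Lip_mult _ _ _ _ (HAJ j r p Hj Hp) (HAJ j r q Hj Hq)))) as (K & _ & HL).
    exists K. intros z Hz. now apply HL. }
  exists K. split; [exact HK|]. intros j x t p q Hj Hp Hq Hx Ht.
  specialize (H j Hj p Hp q Hq (join x t) (dom_join _ _ _ Hx Ht)).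
  rewrite blk_toff_join, (Hmat_ext (S j) (join x t) x) in H; [exact H|].
  intros. now apply join_l.
Qed.

End Smoothness.

(** * Step (1) *)

Section Proximal.
Variable pr : problem.
Notation dx := (dimx pr).
Notation dt := (dimt pr).
Hypothesis Hmu : pmu pr > 0.
Hypothesis HWWt : orthonormal_rows pr.

(** W W^T = I makes W^T an isometry: after the sums are exchanged only the terms with r = r'
    survive. *)
Lemma sqn_Wt u : sqn (dimW pr) (Wt pr u) = sqn dx u.
Proof.
  unfold sqn, dot, Wt.
  transitivity (sumR (dimW pr) (fun c => sumR dx (fun r => sumR dx (fun r' =>
     u r * u r' * (pW pr r c * pW pr r' c))))).
  { apply sumR_ext. intros c _. rewrite <- sumR_scal_r. apply sumR_ext. intros r _.
    rewrite <- sumR_scal. apply sumR_ext. intros r' _. ring. }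
  rewrite sumR_swap. apply sumR_ext. intros r Hr. rewrite sumR_swap.
  rewrite (sumR_single dx _ r Hr).
  - rewrite sumR_scal, HWWt, Nat.eqb_refl by assumption. ring.
  - intros r' Hr' Hne. rewrite sumR_scal, HWWt by assumption.
    destruct (Nat.eqb_spec r r'); [congruence|ring].
Qed.

Lemma Wt_plus u v c s : Wt pr (fun i => u i + s * v i) c = Wt pr u c + s * Wt pr v c.
Proof.
  unfold Wt. rewrite <- sumR_scal, <- sumR_plus. apply sumR_ext. intros; ring.
Qed.

Lemma Wt_ext u v : (forall i, (i < dx)%nat -> u i = v i) -> Wt pr u = Wt pr v.
Proof.
  intros H. apply functional_extensionality. intros c. apply sumR_ext. intros r Hr.
  now rewrite H.
Qed.

Lemma HW_ext u v : (forall i, (i < dx)%nat -> u i = v i) -> HW pr u = HW pr v.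
Proof. intros H. unfold HW. now rewrite (Wt_ext u v). Qed.

Lemma HW_nonneg u : 0 <= HW pr u.
Proof. apply sumR_nonneg. intros. now apply huber_nonneg. Qed.

Lemma HW_0 u : (forall i, (i < dx)%nat -> u i = 0) -> HW pr u = 0.
Proof.
  intros H. unfold HW, Huber. apply sumR_0. intros c _.
  replace (Wt pr u c) with 0; [now apply huber_0|].
  symmetry. apply sumR_0. intros r Hr. rewrite H by exact Hr. ring.
Qed.

(** Each summand is at most the whole sum, so all of them lie on the quadratic branch; the isometry
    then removes W. *)
Lemma HW_quadratic u : HW pr u < pmu pr / 2 -> HW pr u = / (2 * pmu pr) * sqn dx u.
Proof.
  intros H. rewrite <- sqn_Wt. unfold sqn, dot. rewrite <- sumR_scal.
  unfold HW, Huber. apply sumR_ext. intros c Hc.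
  rewrite huber_small; [ring|exact Hmu|].
  eapply Rle_lt_trans; [|exact H].
  apply (sumR_term_le _ (fun i => huber_term (pmu pr) (Wt pr u i))); [|exact Hc].
  intros. now apply huber_nonneg.
Qed.

(** |u_i| <= |u| = |W^T u|, which is at most the l1 norm of W^T u, and each term of that norm
    exceeds its Huber value by at most mu/2. *)
Lemma HW_coercive u i : (i < dx)%nat -> Rabs (u i) <= HW pr u + INR (dimW pr) * (pmu pr / 2).
Proof.
  intros Hi. eapply Rle_trans; [exact (nrm_coord dx u i Hi)|].
  unfold nrm at 1. rewrite <- sqn_Wt. fold (nrm (dimW pr) (Wt pr u)).
  eapply Rle_trans; [apply nrm_le_n1|].
  rewrite <- sumR_const. unfold HW, Huber. rewrite <- sumR_plus. apply sumR_le.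
  intros c _. pose proof (huber_ge_abs (pmu pr) (Wt pr u c) Hmu). lra.
Qed.

Lemma HW_cv (u : nat -> vec) l : vcv dx u l -> Un_cv (fun k => HW pr (u k)) (HW pr l).
Proof.
  intros H. apply (sumR_cv (dimW pr) (fun k c => huber_term (pmu pr) (Wt pr (u k) c))
                     (fun c => huber_term (pmu pr) (Wt pr l c))).
  intros c _.
  assert (HWt : Un_cv (fun k => Wt pr (u k) c) (Wt pr l c)).
  { apply (sumR_cv dx (fun k r => pW pr r c * u k r) (fun r => pW pr r c * l r)).
    intros r Hr. apply (CV_mult (fun _ => pW pr r c)); [apply Un_cv_const|now apply H]. }
  intros e He. destruct (HWt e He) as [N HN]. exists N. intros k Hk.
  eapply Rle_lt_trans; [now apply huber_Lip|]. now apply HN.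
Qed.

Definition gHW (u : vec) (r : nat) : R :=
  sumR (dimW pr) (fun c => pW pr r c * dhuber (pmu pr) (Wt pr u c)).

Lemma HW_descent u v : exists K, forall s,
  HW pr (fun i => u i + s * v i) <= HW pr u + s * dot dx (gHW u) v + s * s * K.
Proof.
  exists (/ (2 * pmu pr) * sqn (dimW pr) (Wt pr v)). intros s.
  assert (E : dot dx (gHW u) v = sumR (dimW pr) (fun c => dhuber (pmu pr) (Wt pr u c) * Wt pr v c)).
  { unfold dot, gHW, Wt.
    transitivity (sumR dx (fun r => sumR (dimW pr) (fun c =>
       pW pr r c * dhuber (pmu pr) (sumR dx (fun r0 => pW pr r0 c * u r0)) * v r))).
    - apply sumR_ext. intros. now rewrite sumR_scal_r.
    - rewrite sumR_swap. apply sumR_ext. intros c _. rewrite <- sumR_scal.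
      apply sumR_ext. intros. ring. }
  rewrite E. unfold HW, Huber, sqn, dot.
  rewrite <- !sumR_scal, <- !sumR_plus. apply sumR_le. intros c _.
  rewrite Wt_plus.
  eapply Rle_trans; [now apply huber_descent|]. right. ring.
Qed.

(** The bound is linear in |u|, so the proximal term contributes to the subgradient of [L] in
    proportion to the step. *)
Lemma gHW_bound : exists K, 0 <= K /\
  forall u r, (r < dx)%nat -> Rabs (gHW u r) <= K * nrm dx u.
Proof.
  set (D := INR (dimW pr)).
  destruct (fin_max dx (fun r K => sumR (dimW pr) (fun c => Rabs (pW pr r c)) <= K))
    as (K & HK & H).
  { intros. lra. }
  { intros r _. eexists. apply Rle_refl. }
  assert (Hi : 0 < / pmu pr) by now apply Rinv_0_lt_compat.
  exists (K * / pmu pr). split; [apply Rmult_le_pos; lra|]. intros u r Hr.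
  unfold gHW. eapply Rle_trans; [apply sumR_abs|].
  apply Rle_trans with (sumR (dimW pr) (fun c => Rabs (pW pr r c)) * (/ pmu pr * nrm dx u)).
  - rewrite <- sumR_scal_r. apply sumR_le. intros c Hc. rewrite Rabs_mult.
    apply Rmult_le_compat_l; [apply Rabs_pos|].
    eapply Rle_trans; [now apply dhuber_bound|].
    apply Rmult_le_compat_l; [lra|].
    replace (nrm dx u) with (nrm (dimW pr) (Wt pr u)) by (unfold nrm; now rewrite sqn_Wt).
    now apply (nrm_coord (dimW pr) (Wt pr u)).
  - rewrite Rmult_assoc. apply Rmult_le_compat_r; [|now apply H].
    apply Rmult_le_pos; [lra|apply nrm_nonneg].
Qed.

Hypothesis Hkappa : pkappa pr > 0.
Hypothesis HRp : proper_fun (Rt pr).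
Hypothesis HRl : lsc_fun dx (Rt pr).
Hypothesis HRc : convex_fun (Rt pr).

Lemma Lobj_in x t : inC pr t -> Lobj pr x t = eadd (Rt pr x) (Fin (pkappa pr * fit pr x t)).
Proof. intros H. unfold Lobj. now destruct excluded_middle_informative. Qed.

Lemma Lobj_out x t : ~ inC pr t -> Lobj pr x t = PInf.
Proof. intros H. unfold Lobj. now destruct excluded_middle_informative. Qed.

(** Closedness of sublevel sets for [R] plus a term that converges along the sequence. *)
Lemma lsc_vcv (u : nat -> vec) l r (G : nat -> R) g :
  vcv dx u l -> Un_cv G g ->
  (forall eps, eps > 0 -> exists N, forall k, (N <= k)%nat ->
      ele (eadd (Rt pr (u k)) (Fin (G k))) (Fin (r + eps))) ->
  ele (eadd (Rt pr l) (Fin g)) (Fin r).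
Proof.
  intros Hu HG H.
  destruct (classic (ele (eadd (Rt pr l) (Fin g)) (Fin r))) as [|Hn]; [assumption|exfalso].
  (* Far along the sequence [R] exceeds r - g + 3e and [G] exceeds g - e, so their sum exceeds r +
     2e, against the assumed r + e. *)
  assert (Hgap : exists e, e > 0 /\ elt (Fin (r - g + 3 * e)) (Rt pr l)).
  { destruct (Rt pr l) as [a|]; simpl in *.
    - exists ((a + g - r) / 4). lra.
    - exists 1. split; [lra|exact I]. }
  destruct Hgap as (e & He & Hlt).
  destruct (HRl l _ Hlt) as (del & Hdel & Hnear).
  destruct (vcv_nrm dx u l Hu del Hdel) as [N1 HN1].
  destruct (HG e He) as [N2 HN2]. destruct (H e He) as [N3 HN3].
  set (k := (N1 + N2 + N3)%nat).
  specialize (HN1 k ltac:(unfold k; lia)). specialize (HN2 k ltac:(unfold k; lia)).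
  specialize (HN3 k ltac:(unfold k; lia)). unfold Rdist in *.
  rewrite Rminus_0_r, Rabs_pos_eq in HN1 by apply nrm_nonneg.
  specialize (Hnear _ HN1). destruct (Rt pr (u k)) as [a|]; simpl in *; [|contradiction].
  apply Rabs_def2 in HN2. lra.
Qed.

Lemma resid_cv j (u : nat -> vec) l t r : (j <= pm pr)%nat -> vcv dx u l ->
  Un_cv (fun k => resid pr j (u k) t r) (resid pr j l t r).
Proof.
  intros Hj H. unfold resid.
  assert (Hmv : forall A (v : nat -> vec) w i, (forall k, (k < pn pr)%nat -> Un_cv (fun q => v q k) (w k)) ->
            Un_cv (fun q => matvec (pn pr) A (v q) i) (matvec (pn pr) A w i)).
  { intros A v w i Hv. apply (sumR_cv (pn pr) (fun q k => A i k * v q k) (fun k => A i k * w k)).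
    intros k Hk. apply (CV_mult (fun _ => A i k)); [apply Un_cv_const|now apply Hv]. }
  apply CV_minus; [|apply Un_cv_const]. apply CV_plus; apply Hmv; intros k Hk.
  - apply Hmv. intros i Hi. apply H. exact (xblk_lt pr 0 i (Nat.le_0_l _) Hi).
  - apply H. now apply xblk_lt.
Qed.

Lemma fit_cv (u : nat -> vec) l t : vcv dx u l -> Un_cv (fun k => fit pr (u k) t) (fit pr l t).
Proof.
  intros H. apply (sumR_cv (pm pr) (fun k j => qfun pr (S j) (u k) (tblk pr t (S j)))
                     (fun j => qfun pr (S j) l (tblk pr t (S j)))).
  intros j Hj.
  apply (sumR_cv (pM pr) (fun k r => resid pr (S j) (u k) (tblk pr t (S j)) r * resid pr (S j) (u k) (tblk pr t (S j)) r)
            (fun r => resid pr (S j) l (tblk pr t (S j)) r * resid pr (S j) l (tblk pr t (S j)) r)).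
  intros r Hr. apply (CV_mult (fun k => resid pr (S j) (u k) (tblk pr t (S j)) r)
     (fun k => resid pr (S j) (u k) (tblk pr t (S j)) r)); now apply resid_cv.
Qed.

(** As [L] is bounded below by c, a point at level at most a has proximal term [HW] at most 2 (a -
    c) / lam, and coercivity of [HW] bounds its coordinates; the direct method applies. *)
Lemma Step1_exists lam x0 t : lam > 0 -> inC pr t ->
  (exists c, forall x th, ele (Fin c) (Lobj pr x th)) ->
  exists x, Step1 pr lam x0 t x.
Proof.
  intros Hlam Ht [c Hc].
  set (F := fun x => eadd (Lobj pr x t) (Fin (lam / 2 * HW pr (vsub x x0)))).
  destruct HRp as [xp Hxp].
  assert (HFp : exists a, F xp = Fin a).
  { unfold F. rewrite Lobj_in by exact Ht.
    destruct (Rt pr xp) as [r|]; [|congruence]. eexists. reflexivity. }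
  destruct HFp as [a Ha].
  assert (HFc : forall x, ele (eadd (Fin c) (Fin (lam / 2 * HW pr (vsub x x0)))) (F x)).
  { intros x. unfold F. specialize (Hc x t). destruct (Lobj pr x t); simpl in *; [lra|exact I]. }
  destruct (fin_max dx (fun i K => Rabs (x0 i) <= K)) as (X & HX & HX0).
  { intros. lra. }
  { intros. eexists. apply Rle_refl. }
  apply (argmin_exists dx F xp a
           (X + (2 / lam * (a - c) + INR (dimW pr) * (pmu pr / 2))) c Ha).
  - intros x. eapply ele_trans; [|apply HFc]. simpl.
    pose proof (HW_nonneg (vsub x x0)). assert (0 <= lam / 2 * HW pr (vsub x x0)) by nra. lra.
  - intros x Hx i Hi. pose proof (ele_trans _ _ _ (HFc x) Hx) as H. simpl in H.
    pose proof (HW_coercive (vsub x x0) i Hi) as H1. unfold vsub at 1 in H1.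
    assert (H2 : HW pr (vsub x x0) <= 2 / lam * (a - c)).
    { apply Rmult_le_reg_l with (lam / 2); [lra|].
      replace (lam / 2 * (2 / lam * (a - c))) with (a - c) by (field; lra). lra. }
    specialize (HX0 i Hi). pose proof (Rabs_triang (x i - x0 i) (x0 i)) as H3.
    replace (x i - x0 i + x0 i) with (x i) in H3 by ring. lra.
  - intros u l r Hu Hr. unfold F in *. rewrite Lobj_in by exact Ht.
    assert (E : forall b p q, eadd (eadd b (Fin p)) (Fin q) = eadd b (Fin (p + q)))
      by (intros [b|] p q; simpl; [f_equal; ring|reflexivity]).
    rewrite E.
    apply (lsc_vcv u l r (fun k => pkappa pr * fit pr (u k) t + lam / 2 * HW pr (vsub (u k) x0))).
    + exact Hu.
    + apply (CV_plus (fun k => pkappa pr * fit pr (u k) t)).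
      * apply (CV_mult (fun _ => pkappa pr)); [apply Un_cv_const|now apply fit_cv].
      * apply (CV_mult (fun _ => lam / 2)); [apply Un_cv_const|].
        apply (HW_cv (fun k => vsub (u k) x0)). intros i Hi.
        apply (CV_minus (fun k => u k i)); [now apply Hu|apply Un_cv_const].
    + intros eps He. exists 0%nat. intros k _. specialize (Hr k).
      rewrite Lobj_in, E in Hr by exact Ht.
      eapply ele_trans; [exact Hr|]. simpl. lra.
Qed.

Lemma Step1_finite lam x0 t x1 : inC pr t -> Step1 pr lam x0 t x1 -> exists r, Rt pr x1 = Fin r.
Proof.
  intros Ht H. destruct HRp as [xp Hxp]. specialize (H xp).
  rewrite !Lobj_in in H by exact Ht.
  destruct (Rt pr x1) as [r|]; [now exists r|].
  destruct (Rt pr xp); simpl in H; [contradiction|congruence].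
Qed.

Lemma Step1_decrease lam x0 t x1 : Step1 pr lam x0 t x1 ->
  ele (eadd (Lobj pr x1 t) (Fin (lam / 2 * HW pr (vsub x1 x0)))) (Lobj pr x0 t).
Proof.
  intros H. eapply ele_trans; [apply (H x0)|].
  rewrite (HW_0 (vsub x0 x0)) by (intros; unfold vsub; ring).
  destruct (Lobj pr x0 t); simpl; [lra|exact I].
Qed.

Hypothesis HdPhi : Phi_partials pr.
Hypothesis HC2 : Phi_second_partials pr.

(** Minus the gradient of the smooth part is a convex subgradient of [R] at [x1]. Along the segment
    from [x1] to [x'], convexity bounds [R] by an affine function of s, the smooth terms expand up
    to order s^2, and minimality forces the sign of the linear coefficient. *)
Lemma Step1_subgradient lam x0 t x1 r1 : lam > 0 -> inC pr t -> Step1 pr lam x0 t x1 ->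
  Rt pr x1 = Fin r1 -> forall x' r', Rt pr x' = Fin r' ->
  r1 - dot dx (fun i => pkappa pr * gfit pr (join pr x1 t) i + lam / 2 * gHW (vsub x1 x0) i)
         (vsub x' x1) <= r'.
Proof.
  intros Hlam Ht H1 Hr1 x' r' Hr'.
  set (v := vsub x' x1).
  destruct (HW_descent (vsub x1 x0) v) as [KH HKH].
  (* Large enough for the whole segment from [x1] to [x'] to lie in [dom pr B]. *)
  destruct (fin_max dx (fun i K => Rabs (x1 i) + Rabs (x' i) <= K)) as (B & HB0 & HB).
  { intros. lra. }
  { intros. eexists. apply Rle_refl. }
  destruct (C11_lower _ _ _ _ (C11_fit pr HdPhi HC2 B)) as (K & HK & HF).
  set (z1 := join pr x1 t). fold z1 in HF.
  assert (E : dot dx (fun i => pkappa pr * gfit pr z1 i + lam / 2 * gHW (vsub x1 x0) i) v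
            = pkappa pr * dot dx (gfit pr z1) v + lam / 2 * dot dx (gHW (vsub x1 x0)) v).
  { unfold dot. rewrite <- !sumR_scal, <- sumR_plus. apply sumR_ext. intros; ring. }
  rewrite E.
  set (dF := dot dx (gfit pr z1) v) in *. set (dH := dot dx (gHW (vsub x1 x0)) v) in *.
  enough (0 <= r' - r1 + pkappa pr * dF + lam / 2 * dH) by lra.
  apply nonneg_of_small_quadratic with (pkappa pr * (K * (n1 dx v * n1 dx v)) + lam / 2 * KH).
  intros s Hs.
  set (xs := fun i => s * x' i + (1 - s) * x1 i).
  assert (Hxs : ele (Rt pr xs) (Fin (s * r' + (1 - s) * r1))) by (apply HRc; auto; lra).
  specialize (H1 xs). rewrite !Lobj_in, Hr1 in H1 by exact Ht.
  destruct (Rt pr xs) as [rs|]; simpl in Hxs; [|contradiction]. simpl in H1.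
  assert (HH : HW pr (vsub xs x0) <= HW pr (vsub x1 x0) + s * dH + s * s * KH).
  { eapply Rle_trans; [|apply HKH]. right. apply HW_ext. intros i _.
    unfold v, vsub, xs. ring. }
  assert (HFs : fit pr xs t <= fit pr x1 t + s * dF + K * (s * s * (n1 dx v * n1 dx v))).
  { assert (Hd1 : dom pr B z1).
    { apply dom_join; [|exact Ht]. intros i Hi. specialize (HB i Hi).
      pose proof (Rabs_pos (x' i)). lra. }
    assert (Hd2 : dom pr B (join pr xs t)).
    { apply dom_join; [|exact Ht]. intros i Hi. specialize (HB i Hi). unfold xs.
      eapply Rle_trans; [apply Rabs_triang|]. rewrite !Rabs_mult, !(Rabs_pos_eq s), !(Rabs_pos_eq (1 - s)) by lra.
      pose proof (Rabs_pos (x' i)). pose proof (Rabs_pos (x1 i)). nra. }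
    destruct (HF _ _ Hd1 Hd2) as [_ Hup]. unfold z1 in Hup. rewrite !fit_join in Hup.
    fold z1 in Hup. eapply Rle_trans; [exact Hup|]. right. f_equal; [f_equal|f_equal].
    - unfold dF. rewrite dot_dimz. unfold dot. rewrite <- sumR_scal.
      rewrite (sumR_0 dt), Rplus_0_r.
      + apply sumR_ext. intros i Hi. unfold vsub, z1. rewrite !join_l by exact Hi.
        unfold xs, v, vsub. ring.
      + intros i Hi. unfold blk, vsub, z1. rewrite !join_r. ring.
    - unfold z1. rewrite n1_join.
      replace (n1 dt (vsub t t)) with 0
        by (symmetry; apply sumR_0; intros; unfold vsub; rewrite Rminus_diag; apply Rabs_R0).
      replace (n1 dx (vsub xs x1)) with (s * n1 dx v); [ring|].
      unfold n1. rewrite <- sumR_scal. apply sumR_ext. intros i Hi.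
      replace (vsub xs x1 i) with (s * v i) by (unfold xs, v, vsub; ring).
      rewrite Rabs_mult, (Rabs_pos_eq s) by lra. reflexivity. }
  apply (Rmult_le_compat_l (pkappa pr)) in HFs; [|lra].
  apply (Rmult_le_compat_l (lam / 2)) in HH; [|lra].
  lra.
Qed.

End Proximal.

(** * Step (2) *)

Section Theta.
Variable pr : problem.
Notation P := (pP pr).
Notation dx := (dimx pr).

Definition lin (d : nat) (Q : nat -> nat -> R) (u : vec) : vec :=
  fun p => sumR d (fun q => Q p q * u q).

Lemma quad_dot d Q u : quad d Q u = dot d u (lin d Q u).
Proof.
  apply sumR_ext. intros p _. unfold lin. rewrite <- sumR_scal.
  apply sumR_ext. intros; ring.
Qed.

Lemma quad_line d Q u v s : (forall p q, Q p q = Q q p) ->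
  quad d Q (fun i => u i + s * v i)
  = quad d Q u + 2 * s * dot d (lin d Q u) v + s * s * quad d Q v.
Proof.
  intros Hsym.
  assert (E : forall p, lin d Q (fun i => u i + s * v i) p = lin d Q u p + s * lin d Q v p).
  { intros p. unfold lin. rewrite <- sumR_scal, <- sumR_plus. apply sumR_ext. intros; ring. }
  assert (E2 : dot d u (lin d Q v) = dot d (lin d Q u) v).
  { unfold dot, lin.
    transitivity (sumR d (fun p => sumR d (fun q => u p * Q p q * v q))).
    - apply sumR_ext. intros p _. rewrite <- sumR_scal. apply sumR_ext. intros; ring.
    - rewrite sumR_swap. apply sumR_ext. intros q _. rewrite <- sumR_scal_r.
      apply sumR_ext. intros p _. rewrite (Hsym p q). ring. }
  rewrite !quad_dot.
  transitivity (dot d u (lin d Q u) + s * dot d u (lin d Q v)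
                + s * dot d (lin d Q u) v + s * s * dot d v (lin d Q v)).
  - unfold dot. rewrite <- !sumR_scal, <- !sumR_plus. apply sumR_ext. intros p _.
    rewrite E. ring.
  - rewrite E2. ring.
Qed.

Lemma quad_shift d Q c u : quad d (shiftI Q c) u = quad d Q u + c * sqn d u.
Proof.
  unfold quad, sqn, dot. rewrite <- sumR_scal, <- sumR_plus. apply sumR_ext. intros p Hp.
  transitivity (sumR d (fun p' => u p * Q p p' * u p')
     + sumR d (fun p' => u p * (if Nat.eqb p p' then c else 0) * u p')).
  - rewrite <- sumR_plus. apply sumR_ext. intros q _. unfold shiftI. ring.
  - f_equal. rewrite (sumR_single d _ p Hp).
    + rewrite Nat.eqb_refl. ring.
    + intros q _ Hq. destruct (Nat.eqb_spec p q); [congruence|ring].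
Qed.

(** The quadratic form is 2 |A_j J u|^2. *)
Lemma quad_Hmat_nonneg j x t u : 0 <= quad P (Hmat pr j x t) u.
Proof.
  replace (quad P (Hmat pr j x t) u)
    with (2 * sumR (pM pr) (fun r => sumR P (fun p => AJ pr j x t r p * u p)
                                     * sumR P (fun p => AJ pr j x t r p * u p))).
  { apply Rmult_le_pos; [lra|]. apply sumR_nonneg. intros. apply Rle_0_sqr. }
  unfold quad, Hmat. rewrite <- sumR_scal.
  transitivity (sumR (pM pr) (fun r => sumR P (fun p => sumR P (fun q =>
     2 * (AJ pr j x t r p * AJ pr j x t r q) * u p * u q)))).
  - apply sumR_ext. intros r _. rewrite <- sumR_scal_r, <- sumR_scal.
    apply sumR_ext. intros p _. rewrite <- Rmult_assoc, <- sumR_scal.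
    apply sumR_ext. intros q _. ring.
  - rewrite sumR_swap. apply sumR_ext. intros p _. rewrite sumR_swap.
    apply sumR_ext. intros q _. rewrite <- sumR_scal, <- sumR_scal, <- sumR_scal_r.
    apply sumR_ext. intros. ring.
Qed.

Lemma Hmat_sym j x t p q : Hmat pr j x t p q = Hmat pr j x t q p.
Proof. unfold Hmat. f_equal. apply sumR_ext. intros. ring. Qed.

Lemma shift_Hmat_sym j x t c p q :
  shiftI (Hmat pr j x t) c p q = shiftI (Hmat pr j x t) c q p.
Proof. unfold shiftI. now rewrite Hmat_sym, Nat.eqb_sym. Qed.

Lemma model_ext lam j x tk i s s' : (forall p, (p < P)%nat -> s p = s' p) ->
  model pr lam j x tk i s = model pr lam j x tk i s'.
Proof.
  intros H. unfold model. f_equal; [|f_equal].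
  - apply sumR_ext. intros p Hp. unfold vsub. now rewrite H.
  - apply sumR_ext. intros p Hp. apply sumR_ext. intros q Hq. unfold vsub. now rewrite !H.
Qed.

(** A new theta is glued from blocks, and its blocks agree with the chosen minimizers on the first P
    coordinates only. *)
Lemma Step2j_ext lam j x tk s s' : (forall p, (p < P)%nat -> s p = s' p) ->
  Step2j pr lam j x tk s -> Step2j pr lam j x tk s'.
Proof.
  intros H (i & Hi & [Hin Hmin] & Hacc & Hleast). exists i. split; [exact Hi|].
  split; [|split; [|exact Hleast]].
  - split.
    + intros p Hp. rewrite <- H by exact Hp. now apply Hin.
    + intros t' Ht'. rewrite <- (model_ext lam j x tk i s s' H). now apply Hmin.
  - unfold accept in *.
    replace (qfun pr j x s') with (qfun pr j x s).
    + replace (dot P (gradq pr j x tk) (vsub s' tk)) with (dot P (gradq pr j x tk) (vsub s tk)).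
      * replace (quad P (shiftI (Hmat pr j x tk) ((2 ^ i - 1) * lam)) (vsub s' tk))
          with (quad P (shiftI (Hmat pr j x tk) ((2 ^ i - 1) * lam)) (vsub s tk)); [exact Hacc|].
        apply sumR_ext. intros p Hp. apply sumR_ext. intros q Hq. unfold vsub. now rewrite !H.
      * apply sumR_ext. intros p Hp. unfold vsub. now rewrite H.
    + apply sumR_ext. intros r _. unfold resid. now rewrite (Phit_ext pr s s' H).
Qed.

(** The quadratic part is nonnegative, so the linear part alone bounds the model from below. *)
Lemma model_ge lam j x tk i s : lam > 0 ->
  - sumR P (fun p => Rabs (gradq pr j x tk p) * Rabs (s p - tk p)) <= model pr lam j x tk i s.
Proof.
  intros Hlam. unfold model. rewrite quad_shift.
  pose proof (quad_Hmat_nonneg j x tk (vsub s tk)). pose proof (sqn_nonneg P (vsub s tk)).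
  assert (0 < 2 ^ i * lam) by (apply Rmult_lt_0_compat; [apply pow_lt|]; lra).
  assert (0 <= 2 ^ i * lam * sqn P (vsub s tk)) by (apply Rmult_le_pos; lra).
  assert (Hd : - sumR P (fun p => Rabs (gradq pr j x tk p) * Rabs (s p - tk p))
               <= dot P (gradq pr j x tk) (vsub s tk)).
  { assert (Ha : Rabs (sumR P (fun p => gradq pr j x tk p * vsub s tk p))
                 <= sumR P (fun p => Rabs (gradq pr j x tk p) * Rabs (s p - tk p))).
    { eapply Rle_trans; [apply sumR_abs|]. right. apply sumR_ext. intros. apply Rabs_mult. }
    unfold dot. set (S0 := sumR P (fun p => gradq pr j x tk p * vsub s tk p)) in *.
    pose proof (Rle_abs (- S0)) as Hm. rewrite Rabs_Ropp in Hm. lra. }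
  lra.
Qed.

Lemma model_cv lam j x tk i (u : nat -> vec) l : vcv P u l ->
  Un_cv (fun k => model pr lam j x tk i (u k)) (model pr lam j x tk i l).
Proof.
  intros H.
  assert (Hv : vcv P (fun k => vsub (u k) tk) (vsub l tk)).
  { intros p Hp. apply (CV_minus (fun k => u k p)); [now apply H|apply Un_cv_const]. }
  apply (CV_plus (fun k => dot P (gradq pr j x tk) (vsub (u k) tk))).
  - apply (sumR_cv P (fun k p => gradq pr j x tk p * vsub (u k) tk p)
             (fun p => gradq pr j x tk p * vsub l tk p)).
    intros p Hp. apply (CV_mult (fun _ => gradq pr j x tk p)); [apply Un_cv_const|now apply Hv].
  - apply (CV_mult (fun _ => 1 / 2)); [apply Un_cv_const|].
    set (Q := shiftI (Hmat pr j x tk) (2 ^ i * lam)).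
    apply (sumR_cv P (fun k p => sumR P (fun q => vsub (u k) tk p * Q p q * vsub (u k) tk q))
             (fun p => sumR P (fun q => vsub l tk p * Q p q * vsub l tk q))).
    intros p Hp.
    apply (sumR_cv P (fun k q => vsub (u k) tk p * Q p q * vsub (u k) tk q)
             (fun q => vsub l tk p * Q p q * vsub l tk q)).
    intros q Hq. apply (CV_mult (fun k => vsub (u k) tk p * Q p q)); [|now apply Hv].
    apply (CV_mult (fun k => vsub (u k) tk p)); [now apply Hv|apply Un_cv_const].
Qed.

Lemma box_closed d lo hi (u : nat -> vec) l :
  vcv d u l -> (forall k, box d lo hi (u k)) -> box d lo hi l.
Proof.
  intros H Hb p Hp. split.
  - apply (@Rle_cv_lim (fun _ => lo p) (fun k => u k p)); auto using Un_cv_const.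
    intros k. now apply Hb.
  - apply (@Rle_cv_lim (fun k => u k p) (fun _ => hi p)); auto using Un_cv_const.
    intros k. now apply Hb.
Qed.

(** Direct method with the constraint encoded by [PInf]; [t0] shows that the box is nonempty. *)
Lemma sub_argmin_exists lam j x tk i t0 : lam > 0 -> inCj pr (S j) t0 ->
  exists s, sub_argmin pr lam (S j) x tk i s.
Proof.
  intros Hlam H0.
  set (lo := blk (j * P) (plo pr)). set (hi := blk (j * P) (phi pr)).
  set (F := fun s => if excluded_middle_informative (inCj pr (S j) s)
                     then Fin (model pr lam (S j) x tk i s) else PInf).
  assert (Fin_in : forall s, inCj pr (S j) s -> F s = Fin (model pr lam (S j) x tk i s)).
  { intros s Hs. unfold F. now destruct excluded_middle_informative. }
  assert (Fin_inv : forall s r, ele (F s) (Fin r) -> inCj pr (S j) s /\ model pr lam (S j) x tk i s <= r).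
  { intros s r. unfold F. destruct excluded_middle_informative; simpl; tauto. }
  destruct (fin_max P (fun p K => Rabs (lo p) + Rabs (hi p) <= K)) as (B & HB0 & HB).
  { intros. lra. }
  { intros. eexists. apply Rle_refl. }
  assert (Hbd : forall s, inCj pr (S j) s -> forall p, (p < P)%nat -> Rabs (s p) <= B).
  { intros s Hs p Hp. pose proof (proj1 (inCj_S pr j s) Hs p Hp) as Hs0. specialize (HB p Hp).
    fold lo hi in Hs0. pose proof (Rle_abs (hi p)). pose proof (Rle_abs (- lo p)) as Hlo.
    rewrite Rabs_Ropp in Hlo. pose proof (Rabs_pos (lo p)). pose proof (Rabs_pos (hi p)).
    apply Rabs_le. lra. }
  destruct (argmin_exists P F t0 (model pr lam (S j) x tk i t0) B
     (- sumR P (fun p => Rabs (gradq pr (S j) x tk p) * (B + Rabs (tk p))))) as [s Hs].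
  - now apply Fin_in.
  - intros s. unfold F. destruct excluded_middle_informative as [Hs|]; [|exact I].
    eapply Rle_trans; [|apply model_ge, Hlam]. apply Ropp_le_contravar, sumR_le.
    intros p Hp. apply Rmult_le_compat_l; [apply Rabs_pos|].
    specialize (Hbd s Hs p Hp). unfold Rminus. eapply Rle_trans; [apply Rabs_triang|].
    rewrite Rabs_Ropp. lra.
  - intros s Hs. apply Hbd. now apply Fin_inv in Hs.
  - intros u l r Hu Hr.
    assert (Hl : inCj pr (S j) l).
    { apply inCj_S. apply (box_closed P _ _ u l Hu). intros k. apply inCj_S.
      now destruct (Fin_inv _ _ (Hr k)). }
    rewrite Fin_in by exact Hl. simpl.
    apply (@Rle_cv_lim (fun k => model pr lam (S j) x tk i (u k)) (fun _ => r)).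
    + intros k. now destruct (Fin_inv _ _ (Hr k)).
    + now apply model_cv.
    + apply Un_cv_const.
  - exists s. pose proof (Hs t0) as Hs0. rewrite (Fin_in t0 H0) in Hs0.
    destruct (Fin_inv _ _ Hs0) as [Hin _]. split; [exact Hin|].
    intros t' Ht'. specialize (Hs t'). rewrite !Fin_in in Hs by assumption. exact Hs.
Qed.

(** The model vanishes at [tk], so its minimum is at most 0. The acceptance test uses 2^i - 1 where
    the model has 2^i; this surplus leaves lam/2 times the squared step. *)
Lemma Step2_decrease lam j x tk i s : inCj pr j tk ->
  sub_argmin pr lam j x tk i s -> accept pr lam j x tk i s ->
  qfun pr j x s + lam / 2 * sqn P (vsub s tk) <= qfun pr j x tk.
Proof.
  intros Htk [_ Hmin] Hacc. specialize (Hmin tk Htk).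
  unfold model, accept in *. rewrite !quad_shift in *.
  set (Hq := quad P (Hmat pr j x tk)) in *.
  replace (dot P (gradq pr j x tk) (vsub tk tk)) with 0 in Hmin.
  2:{ symmetry. apply sumR_0. intros. unfold vsub. ring. }
  replace (Hq (vsub tk tk)) with 0 in Hmin.
  2:{ symmetry. apply sumR_0. intros. apply sumR_0. intros. unfold vsub. ring. }
  replace (sqn P (vsub tk tk)) with 0 in Hmin.
  2:{ symmetry. apply sumR_0. intros. unfold vsub. ring. }
  lra.
Qed.

(** The box is convex, so the model may be compared along the segment from [s] to [t']; the vector
    on the left is the gradient of the model at [s]. *)
Lemma Step2_variational lam j x tk i s :
  sub_argmin pr lam j x tk i s -> forall t', inCj pr j t' ->
  0 <= dot P (fun p => gradq pr j x tk p
         + lin P (shiftI (Hmat pr j x tk) (2 ^ i * lam)) (vsub s tk) p) (vsub t' s).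
Proof.
  intros [Hs Hmin] t' Ht'. set (Q := shiftI (Hmat pr j x tk) (2 ^ i * lam)).
  set (v := vsub t' s).
  assert (E : dot P (fun p => gradq pr j x tk p + lin P Q (vsub s tk) p) v
     = dot P (gradq pr j x tk) v + dot P (lin P Q (vsub s tk)) v).
  { unfold dot. rewrite <- sumR_plus. apply sumR_ext. intros; ring. }
  rewrite E. apply nonneg_of_small_quadratic with (1 / 2 * quad P Q v).
  intros e He. specialize (Hmin (fun p => s p + e * v p)).
  assert (Hin : inCj pr j (fun p => s p + e * v p)).
  { intros p Hp. specialize (Hs p Hp). specialize (Ht' p Hp). unfold v, vsub. nra. }
  specialize (Hmin Hin). unfold model in Hmin. fold Q in Hmin.
  replace (vsub (fun p => s p + e * v p) tk) with (fun p => vsub s tk p + e * v p) in Hmin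
    by (apply functional_extensionality; intros p; unfold vsub; ring).
  rewrite (quad_line P Q (vsub s tk) v e) in Hmin by (apply shift_Hmat_sym).
  replace (dot P (gradq pr j x tk) (fun p => vsub s tk p + e * v p))
    with (dot P (gradq pr j x tk) (vsub s tk) + e * dot P (gradq pr j x tk) v) in Hmin.
  2:{ unfold dot. rewrite <- sumR_scal, <- sumR_plus. apply sumR_ext. intros; ring. }
  lra.
Qed.

Lemma pow2_ge i : INR i + 1 <= 2 ^ i.
Proof.
  induction i as [|i IH]; [simpl; lra|]. rewrite S_INR. simpl pow.
  pose proof (pos_INR i). lra.
Qed.

Lemma least_nat (Q : nat -> Prop) : (exists k, Q k) -> exists k, Q k /\ forall l, (l < k)%nat -> ~ Q l.
Proof.
  intros [k Hk]. apply NNPP. intros Hn.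
  assert (H : forall k, forall l, (l <= k)%nat -> ~ Q l).
  { induction k0 as [|k' IH]; intros l Hl HQ; apply Hn; exists l; split; auto; intros l' Hl';
      [lia|]. apply IH. lia. }
  exact (H k k (Nat.le_refl _) Hk).
Qed.

Hypothesis HdPhi : Phi_partials pr.
Hypothesis HC2 : Phi_second_partials pr.

(** The Taylor remainder is at most K P^2 |s - theta_j|^2 in the Euclidean norm and is absorbed by
    the shift once (2^i - 1) lam >= 2 K P^2, since [Hmat] is positive semidefinite. This holds for
    every [s] in the box. *)
Lemma accept_large B : exists K, 0 <= K /\ forall lam j x t s i, (j < pm pr)%nat ->
  (forall k, (k < dx)%nat -> Rabs (x k) <= B) -> inC pr t -> inCj pr (S j) s ->
  K <= (2 ^ i - 1) * lam -> accept pr lam (S j) x (tblk pr t (S j)) i s.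
Proof.
  destruct (qfun_descent pr HdPhi HC2 B) as (K & HK & H).
  set (d := INR P * INR P). assert (Hd : 0 <= d) by (pose proof (pos_INR P); unfold d; nra).
  exists (2 * (K * d)). split; [nra|]. intros lam j x t s i Hj Hx Ht Hs Hi.
  unfold accept. eapply Rle_trans; [exact (H j x t s Hj Hx Ht Hs)|].
  rewrite Rplus_assoc, Rplus_assoc. apply Rplus_le_compat_l, Rplus_le_compat_l.
  rewrite quad_shift. pose proof (quad_Hmat_nonneg (S j) x (tblk pr t (S j)) (vsub s (tblk pr t (S j)))).
  set (u := vsub s (tblk pr t (S j))) in *.
  pose proof (n1_sqr_le_sqn P u) as Hn. fold d in Hn. pose proof (sqn_nonneg P u) as Hq.
  apply (Rmult_le_compat_l K) in Hn; [|exact HK].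
  apply (Rmult_le_compat_r (sqn P u)) in Hi; [|exact Hq].
  lra.
Qed.

Lemma Step2_exists lam j x t : lam > 0 -> (j < pm pr)%nat -> inC pr t ->
  exists s, Step2j pr lam (S j) x (tblk pr t (S j)) s.
Proof.
  intros Hlam Hj Ht.
  (* A bound for this [x] alone: termination at one iteration needs no uniformity over the
     iterates. *)
  destruct (fin_max dx (fun i K => Rabs (x i) <= K)) as (B & _ & HB).
  { intros. lra. }
  { intros. eexists. apply Rle_refl. }
  destruct (accept_large B) as (K & HK & Hacc).
  set (tk := tblk pr t (S j)).
  destruct (least_nat (fun i => (1 <= i)%nat /\ exists s,
     sub_argmin pr lam (S j) x tk i s /\ accept pr lam (S j) x tk i s)) as (i & Hi & Hleast).
  - destruct (INR_unbounded (K / lam)) as [i Hi]. exists (S i). split; [lia|].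
    destruct (sub_argmin_exists lam j x tk (S i) tk Hlam (inC_block pr t j Ht Hj)) as [s Hs].
    exists s. split; [exact Hs|]. apply Hacc; auto; [apply Hs|].
    pose proof (pow2_ge (S i)) as Hp. rewrite S_INR in Hp. pose proof (pos_INR i).
    apply Rle_trans with (K / lam * lam); [right; field; lra|].
    apply Rmult_le_compat_r; lra.
  - destruct Hi as (Hi & s & Hs & Ha). exists s, i. split; [exact Hi|split; [exact Hs|split; [exact Ha|]]].
    intros i' Hi' s' Hs' Ha'. apply (Hleast i'); [lia|]. split; [lia|]. now exists s'.
Qed.

(** The preceding exponent was rejected although every sufficiently large one is accepted, so
    2^(i-1) lam < K + lam with [K] from [accept_large]; doubling gives the bound. *)
Lemma Step2_bounded B lmax : exists K, 0 <= K /\ forall lam j x t s, 0 < lam <= lmax ->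
  (j < pm pr)%nat -> (forall k, (k < dx)%nat -> Rabs (x k) <= B) -> inC pr t ->
  Step2j pr lam (S j) x (tblk pr t (S j)) s ->
  exists i, sub_argmin pr lam (S j) x (tblk pr t (S j)) i s /\
    0 <= 2 ^ i * lam <= K + 2 * lmax.
Proof.
  destruct (accept_large B) as (K & HK & Hacc). exists (2 * K). split; [lra|].
  intros lam j x t s Hlam Hj Hx Ht (i & Hi & Hs & Ha & Hleast). exists i. split; [exact Hs|].
  split; [apply Rmult_le_pos; [apply pow_le|]; lra|].
  (* For i = 1 nothing has been rejected, and 2 lam <= 2 lmax. *)
  destruct i as [|[|i]]; [lia|simpl; lra|].
  destruct (sub_argmin_exists lam j x (tblk pr t (S j)) (S i) _ (proj1 Hlam)
              (inC_block pr t j Ht Hj)) as [s' Hs'].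
  pose proof (Hleast (S i) ltac:(lia) s' Hs') as Hna.
  assert (HnK : (2 ^ S i - 1) * lam < K).
  { apply Rnot_le_lt. intros HKi. apply Hna. apply Hacc; auto. apply Hs'. }
  replace (2 ^ S (S i)) with (2 * 2 ^ S i) by (simpl; ring). lra.
Qed.

End Theta.

(** * Subgradients at the iterates *)

Lemma pdist_nonneg dx dt x t x' t' : 0 <= pdist dx dt x t x' t'.
Proof. apply sqrt_pos. Qed.

Lemma pdist_sqr dx dt x t x' t' : pdist dx dt x t x' t' * pdist dx dt x t x' t'
  = sqn dx (vsub x x') + sqn dt (vsub t t').
Proof. apply sqrt_def, Rplus_le_le_0_compat; apply sqn_nonneg. Qed.

Lemma pdist_refl dx dt x t : pdist dx dt x t x t = 0.
Proof.
  unfold pdist, sqn, dot. rewrite !sumR_0 by (intros; unfold vsub; ring).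
  rewrite Rplus_0_l. apply sqrt_0.
Qed.

Lemma pdist_join pr x t x' t' : pdist (dimx pr) (dimt pr) x t x' t'
  = nrm (dimz pr) (vsub (join pr x t) (join pr x' t')).
Proof. unfold pdist, nrm. now rewrite sqn_join. Qed.

Lemma pdist_triang pr x t x' t' x'' t'' :
  pdist (dimx pr) (dimt pr) x t x'' t''
  <= pdist (dimx pr) (dimt pr) x' t' x'' t'' + pdist (dimx pr) (dimt pr) x t x' t'.
Proof.
  rewrite !pdist_join, Rplus_comm. eapply Rle_trans; [|apply nrm_triang]. right. f_equal.
  apply functional_extensionality. intros i. unfold vsub. ring.
Qed.

Lemma nrm_le_of_sqr d u e : 0 <= e -> sqn d u <= e * e -> nrm d u <= e.
Proof.
  intros He H. apply Rsqr_incr_0_var; [|exact He]. unfold Rsqr. now rewrite nrm_sqr.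
Qed.

Lemma nrm_le_pdist_l dx dt x t x' t' : nrm dx (vsub x x') <= pdist dx dt x t x' t'.
Proof.
  apply nrm_le_of_sqr; [apply pdist_nonneg|]. rewrite pdist_sqr.
  pose proof (sqn_nonneg dt (vsub t t')). lra.
Qed.

Lemma nrm_le_pdist_r dx dt x t x' t' : nrm dt (vsub t t') <= pdist dx dt x t x' t'.
Proof.
  apply nrm_le_of_sqr; [apply pdist_nonneg|]. rewrite pdist_sqr.
  pose proof (sqn_nonneg dx (vsub x x')). lra.
Qed.

Lemma pdist_le_nrm dx dt x t x' t' :
  pdist dx dt x t x' t' <= nrm dx (vsub x x') + nrm dt (vsub t t').
Proof.
  pose proof (nrm_nonneg dx (vsub x x')). pose proof (nrm_nonneg dt (vsub t t')).
  apply Rsqr_incr_0_var; [|lra]. unfold Rsqr. rewrite pdist_sqr, <- !nrm_sqr. nra.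
Qed.

Lemma limiting_of_frechet dx dt F x t vx vt :
  frechet_sub dx dt F x t vx vt -> limiting_sub dx dt F x t vx vt.
Proof.
  intros H. pose proof H as [a [Ha _]].
  exists a, (fun _ => x), (fun _ => t), (fun _ => vx), (fun _ => vt), (fun _ => a).
  rewrite !pdist_refl. auto using Un_cv_const.
Qed.

(** * Null sequences and monotone limits *)

Lemma Un_cv_squeeze0 u v : (forall k, 0 <= u k <= v k) -> Un_cv v 0 -> Un_cv u 0.
Proof.
  intros H Hv e He. destruct (Hv e He) as [N HN]. exists N. intros k Hk.
  specialize (HN k Hk). specialize (H k). unfold Rdist in *. rewrite Rminus_0_r in *.
  rewrite Rabs_pos_eq in * by lra. lra.
Qed.

Lemma Un_cv_scal0 c u : Un_cv u 0 -> Un_cv (fun k => c * u k) 0.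
Proof.
  intros H. rewrite <- (Rmult_0_r c). apply (CV_mult (fun _ => c)); auto using Un_cv_const.
Qed.

Lemma Un_cv_unshift u l N : Un_cv (fun k => u (N + k)%nat) l -> Un_cv u l.
Proof.
  intros H e He. destruct (H e He) as [K HK]. exists (N + K)%nat. intros k Hk.
  replace k with (N + (k - N))%nat by lia. apply HK. lia.
Qed.

Lemma Un_cv_shift u l N : Un_cv u l -> Un_cv (fun k => u (N + k)%nat) l.
Proof.
  intros H e He. destruct (H e He) as [K HK]. exists K. intros k Hk. apply HK. lia.
Qed.

Lemma decreasing_bounded_cv (l : nat -> R) c :
  (forall k, l (S k) <= l k) -> (forall k, c <= l k) -> exists ls, Un_cv l ls.
Proof.
  intros Hd Hb. destruct (decreasing_cv l Hd) as [ls Hls]; [|now exists ls].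
  exists (- c). intros y [k ->]. unfold opp_seq. specialize (Hb k). lra.
Qed.

Lemma decrements_cv0 (l c : nat -> R) b :
  (forall k, l (S k) + c k <= l k) -> (forall k, 0 <= c k) -> (forall k, b <= l k) -> Un_cv c 0.
Proof.
  intros Hd Hc Hb. destruct (decreasing_bounded_cv l b) as [ls Hls]; [|exact Hb|].
  { intros k. specialize (Hd k). specialize (Hc k). lra. }
  apply Un_cv_squeeze0 with (fun k => l k - l (S k)).
  - intros k. specialize (Hd k). specialize (Hc k). lra.
  - rewrite <- (Rminus_diag ls). apply CV_minus; [exact Hls|]. now apply (Un_cv_shift l ls 1).
Qed.

Lemma divmod_block j P p : (p < P)%nat -> ((j * P + p) / P = j /\ (j * P + p) mod P = p)%nat.
Proof.
  intros Hp. split.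
  - rewrite Nat.div_add_l by lia. rewrite Nat.div_small by lia. lia.
  - rewrite Nat.add_comm, Nat.Div0.mod_add. now apply Nat.mod_small.
Qed.

(** * Existence, decrease and subgradient bound for a single step *)

Section Convergence.
Variable pr : problem.
Variables lmin lmax : R.
Notation m := (pm pr).
Notation P := (pP pr).
Notation dx := (dimx pr).
Notation dt := (dimt pr).
Hypothesis Hkappa : pkappa pr > 0.
Hypothesis Hmu : pmu pr > 0.
Hypothesis HRp : proper_fun (Rt pr).
Hypothesis HRl : lsc_fun dx (Rt pr).
Hypothesis HRc : convex_fun (Rt pr).
Hypothesis HdPhi : Phi_partials pr.
Hypothesis HC2 : Phi_second_partials pr.
Hypothesis HWWt : orthonormal_rows pr.

Lemma Step_inC lam lamt x0 t0 x1 t1 : Step pr lam lamt x0 t0 x1 t1 -> inC pr t1.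
Proof.
  intros [_ H]. apply inC_of_blocks. intros j Hj.
  destruct (H (S j) ltac:(lia)) as (i & _ & [Hin _] & _). exact Hin.
Qed.

Lemma Step_exists lam lamt x0 t0 : lam > 0 -> lamt > 0 -> inC pr t0 ->
  (exists c, forall x th, ele (Fin c) (Lobj pr x th)) ->
  exists x1 t1, Step pr lam lamt x0 t0 x1 t1.
Proof.
  intros Hlam Hlamt Ht Hc.
  destruct (Step1_exists pr Hmu HWWt HRp HRl lam x0 t0 Hlam Ht Hc) as [x1 Hx1].
  assert (Hj : forall j, exists s, (j < m)%nat -> Step2j pr lamt (S j) x1 (tblk pr t0 (S j)) s).
  { intros j. destruct (Nat.lt_ge_cases j m) as [Hj|Hj]; [|exists t0; lia].
    destruct (Step2_exists pr HdPhi HC2 lamt j x1 t0 Hlamt Hj Ht) as [s Hs]. now exists s. }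
  set (s := fun j => proj1_sig (constructive_indefinite_description _ (Hj j))).
  assert (Hs : forall j, (j < m)%nat -> Step2j pr lamt (S j) x1 (tblk pr t0 (S j)) (s j)).
  { intros j. unfold s. now destruct constructive_indefinite_description. }
  (* Coordinate i of theta sits in block i / P at position i mod P. *)
  exists x1, (fun i => s (i / P)%nat (i mod P)%nat). split; [exact Hx1|].
  intros [|j] Hj'; [lia|]. apply Step2j_ext with (s j); [|apply Hs; lia].
  intros p Hp. rewrite tblk_S. unfold blk. destruct (divmod_block j P p Hp) as [-> ->].
  reflexivity.
Qed.

(** Step (1) contributes the Huber term at fixed theta. Step (2) then lowers each q_j at fixed x; as
    the q_j enter [L] with factor kappa, so does the squared theta-step. *)
Lemma Step_decrease lam lamt x0 t0 x1 t1 : lmin <= lam -> lmin <= lamt -> inC pr t0 ->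
  Step pr lam lamt x0 t0 x1 t1 ->
  ele (eadd (Lobj pr x1 t1) (Fin (lmin / 2 * (pkappa pr * sqn dt (vsub t1 t0)
                                              + HW pr (vsub x1 x0)))))
      (Lobj pr x0 t0).
Proof.
  intros Hlam Hlamt Ht HS. pose proof (Step_inC _ _ _ _ _ _ HS) as Ht1. destruct HS as [H1 H2].
  assert (Hfit : fit pr x1 t1 + lmin / 2 * sqn dt (vsub t1 t0) <= fit pr x1 t0).
  { unfold fit, sqn, dot, dimt. rewrite sumR_blocks, <- sumR_scal, <- sumR_plus.
    apply sumR_le. intros j Hj. destruct (H2 (S j) ltac:(lia)) as (i & _ & Hs & Ha & _).
    pose proof (Step2_decrease pr lamt (S j) x1 _ i _ (inC_block pr t0 j Ht Hj) Hs Ha) as Hd.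
    eapply Rle_trans; [|exact Hd]. apply Rplus_le_compat_l.
    apply Rle_trans with (lmin / 2 * sqn P (vsub (tblk pr t1 (S j)) (tblk pr t0 (S j)))).
    - rewrite !tblk_S. right. reflexivity.
    - apply Rmult_le_compat_r; [apply sqn_nonneg|lra]. }
  eapply ele_trans; [|apply (Step1_decrease pr Hmu _ _ _ _ H1)].
  rewrite !Lobj_in by assumption.
  destruct (Rt pr x1) as [r|]; simpl; [|exact I].
  pose proof (HW_nonneg pr Hmu (vsub x1 x0)) as HH.
  apply (Rmult_le_compat_l (pkappa pr)) in Hfit; [|lra].
  apply (Rmult_le_compat_r (HW pr (vsub x1 x0))) in Hlam; [|exact HH].
  lra.
Qed.

Lemma lin_bound d Q u K p : (forall q, (q < d)%nat -> Rabs (Q p q) <= K) ->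
  Rabs (lin d Q u p) <= K * n1 d u.
Proof.
  intros H. unfold lin. eapply Rle_trans; [apply sumR_abs|]. unfold n1.
  rewrite <- sumR_scal. apply sumR_le. intros q Hq. rewrite Rabs_mult.
  apply Rmult_le_compat_r; [apply Rabs_pos|auto].
Qed.

(* On block j, [e] is the model Hessian [H + 2^i lamt I] applied to the step; minimality of
   the accepted [i] is what bounds [2^i] uniformly along the iterates. *)
Lemma Step2_optimality B : exists K, 0 <= K /\ forall lamt x t0 t1, 0 < lamt <= lmax ->
  (forall k, (k < dx)%nat -> Rabs (x k) <= B) -> inC pr t0 ->
  (forall j, (1 <= j <= m)%nat -> Step2j pr lamt j x (tblk pr t0 j) (tblk pr t1 j)) ->
  exists e : vec,
    (forall i, (i < dt)%nat -> Rabs (e i) <= K * n1 dt (vsub t1 t0)) /\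
    forall t', inC pr t' ->
      0 <= dot dt (fun i => gfit pr (join pr x t0) (dx + i) + e i) (vsub t' t1).
Proof.
  destruct (Hmat_bounded pr HdPhi HC2 B) as (Kh & HKh & HH).
  destruct (Step2_bounded pr HdPhi HC2 B lmax) as (K2 & HK2 & H2).
  (* For negative [lmax] no [lamt] meets the premise; otherwise the constant chosen below is
     nonnegative. *)
  destruct (Rlt_le_dec lmax 0) as [Hneg|Hlm].
  { exists 0. split; [lra|]. intros. lra. }
  (* [Kh] bounds the entries of [Hmat], the rest bounds the shift 2^i lamt on the diagonal. *)
  exists (Kh + (K2 + 2 * lmax)). split; [lra|]. intros lamt x t0 t1 Hl Hx Ht0 HS.
  set (tk := fun j => tblk pr t0 (S j)). set (s := fun j => tblk pr t1 (S j)).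
  assert (Hej : forall j, exists e : vec, (j < m)%nat ->
     (forall p, (p < P)%nat -> Rabs (e p) <= (Kh + (K2 + 2 * lmax)) * n1 P (vsub (s j) (tk j))) /\
     forall t', inCj pr (S j) t' ->
       0 <= dot P (fun p => gradq pr (S j) x (tk j) p + e p) (vsub t' (s j))).
  { intros j. destruct (Nat.lt_ge_cases j m) as [Hj|Hj]; [|exists zerov; lia].
    destruct (H2 lamt j x t0 (s j) Hl Hj Hx Ht0 (HS (S j) ltac:(lia))) as (i & Hs & Hi).
    exists (lin P (shiftI (Hmat pr (S j) x (tk j)) (2 ^ i * lamt)) (vsub (s j) (tk j))).
    intros _. split.
    - intros p Hp. apply lin_bound. intros q Hq. unfold shiftI.
      eapply Rle_trans; [apply Rabs_triang|]. apply Rplus_le_compat.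
      + now apply HH.
      + destruct Nat.eqb; [rewrite Rabs_pos_eq; lra|rewrite Rabs_R0; lra].
    - intros t' Ht'. exact (Step2_variational pr lamt (S j) x (tk j) i (s j) Hs t' Ht'). }
  set (ej := fun j => proj1_sig (constructive_indefinite_description _ (Hej j))).
  assert (He : forall j, (j < m)%nat ->
     (forall p, (p < P)%nat -> Rabs (ej j p) <= (Kh + (K2 + 2 * lmax)) * n1 P (vsub (s j) (tk j))) /\
     forall t', inCj pr (S j) t' ->
       0 <= dot P (fun p => gradq pr (S j) x (tk j) p + ej j p) (vsub t' (s j))).
  { intros j. unfold ej. now destruct constructive_indefinite_description. }
  exists (fun i => ej (i / P)%nat (i mod P)%nat). split.
  - intros i Hi. unfold dimt in Hi. assert (HP : P <> 0%nat) by nia.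
    assert (Hj : (i / P < m)%nat) by (apply Nat.Div0.div_lt_upper_bound; lia).
    eapply Rle_trans; [apply (proj1 (He _ Hj)); now apply Nat.mod_upper_bound|].
    apply Rmult_le_compat_l; [lra|]. unfold s, tk. rewrite !tblk_S.
    apply (n1_blk (i / P * P) P dt (vsub t1 t0)). unfold dimt. nia.
  - intros t' Ht'. unfold dot, dimt. rewrite sumR_blocks. apply sumR_nonneg. intros j Hj.
    destruct (He j Hj) as [_ Hvi]. specialize (Hvi _ (inC_block pr t' j Ht' Hj)).
    eapply Rle_trans; [exact Hvi|]. right. apply sumR_ext. intros p Hp.
    destruct (divmod_block j P p Hp) as [-> ->].
    replace (dx + (j * P + p))%nat with (toff pr j + p)%nat by (unfold toff; lia).
    rewrite gfit_join_theta by assumption. unfold s, tk. rewrite !tblk_S. reflexivity.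
Qed.

(** Both optimality conditions involve the gradient at [z0] = (x1, t0). Replacing it by the gradient
    at [z1] = (x1, t1) costs a difference that the Lipschitz bound controls by the theta-step. *)
Lemma Step_subgradient B : 0 <= lmax -> exists b, b > 0 /\ forall lam lamt x0 t0 x1 t1,
  0 < lam <= lmax -> 0 < lamt <= lmax ->
  (forall k, (k < dx)%nat -> Rabs (x1 k) <= B) -> inC pr t0 ->
  Step pr lam lamt x0 t0 x1 t1 ->
  exists w, frechet_sub dx dt (Lobj pr) x1 t1 w (blk dx w) /\
    nrm (dimz pr) w <= b * pdist dx dt x1 t1 x0 t0.
Proof.
  intros Hlm.
  destruct (C11_grad_Lip _ _ _ _ (C11_fit pr HdPhi HC2 B)) as (Kg & HKg & HG).
  destruct (gHW_bound pr Hmu HWWt) as (KH & HKH & HHW).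
  destruct (Step2_optimality B) as (Ke & HKe & Hopt).
  (* Contributions of the change of base point, of the proximal gradient and of the model
     Hessian. *)
  set (b0 := pkappa pr * Kg * INR dt + lmax / 2 * KH + pkappa pr * Ke * INR dt).
  pose proof (pos_INR dt) as Hdt. pose proof (pos_INR (dimz pr)) as Hdz.
  assert (Hkg : 0 <= pkappa pr * Kg) by nra. assert (Hke : 0 <= pkappa pr * Ke) by nra.
  assert (Hb0 : 0 <= b0) by (unfold b0; nra).
  exists (INR (dimz pr) * b0 + 1). split; [nra|].
  intros lam lamt x0 t0 x1 t1 Hlam Hlamt Hx1 Ht0 HS.
  pose proof (Step_inC _ _ _ _ _ _ HS) as Ht1. destruct HS as [HS1 HS2].
  destruct (Hopt lamt x1 t0 t1 Hlamt Hx1 Ht0 HS2) as (e & He & Hvi).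
  set (z1 := join pr x1 t1). set (z0 := join pr x1 t0). fold z0 in Hvi.
  set (g := gHW pr (vsub x1 x0)).
  set (f := fun i => if Nat.ltb i dx then lam / 2 * g i else pkappa pr * e (i - dx)%nat).
  (* [f] collects the gradient of the proximal term on x and kappa times the error [e] on theta. *)
  set (w := fun i => pkappa pr * (gfit pr z1 i - gfit pr z0 i) - f i).
  set (D := pdist dx dt x1 t1 x0 t0).
  assert (HD : 0 <= D) by apply pdist_nonneg.
  assert (Hdom1 : dom pr B z1) by now apply dom_join.
  assert (Hdom0 : dom pr B z0) by now apply dom_join.
  assert (HnT : n1 dt (vsub t1 t0) <= INR dt * D).
  { eapply Rle_trans; [apply n1_le_nrm|]. apply Rmult_le_compat_l; [exact Hdt|].
    apply nrm_le_pdist_r. }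
  exists w. split.
  2:{ eapply Rle_trans; [apply nrm_le_n1|].
      apply Rle_trans with (INR (dimz pr) * b0 * D); [|lra].
      rewrite Rmult_assoc, <- sumR_const. apply sumR_le. intros i Hi. unfold w.
      eapply Rle_trans; [apply Rabs_triang|]. rewrite Rabs_Ropp.
      assert (Hw1 : Rabs (pkappa pr * (gfit pr z1 i - gfit pr z0 i)) <= pkappa pr * Kg * INR dt * D).
      { rewrite Rabs_mult, Rabs_pos_eq by lra. rewrite !Rmult_assoc.
        apply Rmult_le_compat_l; [lra|].
        eapply Rle_trans; [exact (proj2 (HG i z0 z1 Hi Hdom0 Hdom1))|].
        apply Rmult_le_compat_l; [exact HKg|]. unfold z1, z0. rewrite n1_join.
        replace (n1 dx (vsub x1 x1)) with 0
          by (symmetry; apply sumR_0; intros; unfold vsub; rewrite Rminus_diag; apply Rabs_R0).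
        lra. }
      assert (Hw2 : Rabs (f i) <= lmax / 2 * KH * D + pkappa pr * Ke * INR dt * D).
      { assert (0 <= lmax / 2 * KH * D) by (repeat apply Rmult_le_pos; lra).
        assert (0 <= pkappa pr * Ke * INR dt * D) by (repeat apply Rmult_le_pos; lra).
        unfold f. destruct (Nat.ltb_spec i dx) as [Hi'|Hi'].
        - rewrite Rabs_mult, Rabs_pos_eq by lra.
          apply Rle_trans with (lmax / 2 * KH * D); [|lra]. rewrite Rmult_assoc.
          apply Rmult_le_compat; [lra|apply Rabs_pos|lra|].
          eapply Rle_trans; [now apply HHW|]. apply Rmult_le_compat_l; [exact HKH|].
          apply nrm_le_pdist_l.
        - rewrite Rabs_mult, Rabs_pos_eq by lra.
          apply Rle_trans with (pkappa pr * Ke * INR dt * D); [|lra]. rewrite !Rmult_assoc.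
          apply Rmult_le_compat_l; [lra|].
          eapply Rle_trans; [apply He; unfold dimz in Hi; lia|].
          apply Rmult_le_compat_l; [exact HKe|exact HnT]. }
      unfold b0. lra. }
  destruct (Step1_finite pr HRp lam x0 t0 x1 Ht0 HS1) as [r1 Hr1].
  exists (r1 + pkappa pr * fit pr x1 t1). split.
  { rewrite Lobj_in, Hr1 by exact Ht1. reflexivity. }
  intros eps Heps.
  (* Test points lie within distance 1 of [x1], hence the radius B + 1. *)
  destruct (C11_lower _ _ _ _ (C11_fit pr HdPhi HC2 (B + 1))) as (K & HK & HF).
  set (dz := INR (dimz pr)) in *. set (C := pkappa pr * K * (dz * dz)).
  assert (HC : 0 <= C) by (unfold C; repeat apply Rmult_le_pos; lra).
  (* Makes the quadratic remainder C d^2 at most eps d. *)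
  exists (Rmin 1 (eps / (C + 1))). split.
  { apply Rmin_glb_lt; [lra|apply Rdiv_lt_0_compat; lra]. }
  intros x' t' [Hd0 Hd]. set (d := pdist dx dt x' t' x1 t1) in *.
  assert (Hd1 : d < 1) by (eapply Rlt_le_trans; [exact Hd|apply Rmin_l]).
  assert (HdC : C * d <= eps).
  { apply Rle_trans with ((C + 1) * (eps / (C + 1))); [|right; field; lra].
    apply Rmult_le_compat; try lra. eapply Rle_trans; [left; exact Hd|apply Rmin_r]. }
  destruct (classic (inC pr t')) as [Ht'|Ht']; [|rewrite Lobj_out by exact Ht'; exact I].
  rewrite Lobj_in by exact Ht'. destruct (Rt pr x') as [r'|] eqn:Hr'; [|exact I]. simpl.
  pose proof (Step1_subgradient pr Hmu Hkappa HRc HdPhi HC2 lam x0 t0 x1 r1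
                (proj1 Hlam) Ht0 HS1 Hr1 x' r' Hr') as Hsub. fold z0 g in Hsub.
  specialize (Hvi t' Ht').
  assert (Hdom' : dom pr (B + 1) (join pr x' t')).
  { apply dom_join; [|exact Ht']. intros i Hi. specialize (Hx1 i Hi).
    pose proof (nrm_coord dx (vsub x' x1) i Hi) as H1.
    pose proof (nrm_le_pdist_l dx dt x' t' x1 t1) as H2. fold d in H2.
    pose proof (Rabs_triang (vsub x' x1 i) (x1 i)) as H3.
    replace (vsub x' x1 i + x1 i) with (x' i) in H3 by (unfold vsub; ring). lra. }
  assert (Hdom1' : dom pr (B + 1) z1).
  { apply dom_join; [|exact Ht1]. intros i Hi. specialize (Hx1 i Hi). lra. }
  destruct (HF z1 _ Hdom1' Hdom') as [HFl _].
  unfold z1 in HFl at 1. rewrite !fit_join in HFl.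
  set (u := vsub x' x1) in *. set (v := vsub t' t1) in *.
  set (n := n1 (dimz pr) (vsub (join pr x' t') z1)) in *.
  assert (Hn : n * n <= dz * dz * (d * d)).
  { unfold n. eapply Rle_trans; [apply n1_sqr_le_sqn|]. right. fold dz. f_equal.
    unfold z1. rewrite sqn_join. unfold d. now rewrite pdist_sqr. }
  assert (Hdot : dot (dimz pr) (gfit pr z1) (vsub (join pr x' t') z1)
            = dot dx (gfit pr z1) u + dot dt (blk dx (gfit pr z1)) v).
  { rewrite dot_dimz. f_equal.
    - apply sumR_ext. intros i Hi. unfold u, vsub, z1. now rewrite !join_l.
    - apply sumR_ext. intros i Hi. unfold v, vsub, z1, blk. now rewrite !join_r. }
  rewrite Hdot in HFl.
  assert (Ew1 : dot dx w u = pkappa pr * dot dx (gfit pr z1) u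
      - dot dx (fun i => pkappa pr * gfit pr z0 i + lam / 2 * g i) u).
  { unfold dot. rewrite <- sumR_scal, <- sumR_minus. apply sumR_ext. intros i Hi.
    unfold w, f. destruct (Nat.ltb_spec i dx); [ring|lia]. }
  assert (Ew2 : dot dt (blk dx w) v = pkappa pr * dot dt (blk dx (gfit pr z1)) v
      - pkappa pr * dot dt (fun i => gfit pr z0 (dx + i)%nat + e i) v).
  { unfold dot. rewrite <- !sumR_scal, <- sumR_minus. apply sumR_ext. intros i Hi.
    unfold w, f, blk. destruct (Nat.ltb_spec (dx + i) dx); [lia|].
    replace (dx + i - dx)%nat with i by lia. ring. }
  rewrite Ew1, Ew2.
  assert (Hrem : pkappa pr * (K * (n * n)) <= eps * d).
  { apply Rle_trans with (C * d * d); [|apply Rmult_le_compat_r; lra].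
    unfold C. rewrite !Rmult_assoc.
    apply Rmult_le_compat_l; [lra|]. apply Rmult_le_compat_l; [exact HK|]. lra. }
  (* The subgradient inequality for [R], the lower Taylor bound for [fit] and the variational
     inequality are added; the gradients at [z0] cancel against those in [w]. *)
  apply (Rmult_le_compat_l (pkappa pr)) in HFl; [|lra].
  apply (Rmult_le_compat_l (pkappa pr)) in Hvi; [|lra].
  lra.
Qed.

(** The subgradients of [R] from step (1) are bounded uniformly for points within B. With [x'] a
    cluster point this bounds the values of [R] at nearby iterates from above, which lower
    semicontinuity does not. *)
Lemma Step1_value_bound B : 0 <= B -> 0 <= lmax -> exists K, 0 <= K /\ forall lam x0 t0 x1 r1,
  0 < lam <= lmax -> (forall k, (k < dx)%nat -> Rabs (x0 k) <= B) ->
  (forall k, (k < dx)%nat -> Rabs (x1 k) <= B) -> inC pr t0 ->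
  Step1 pr lam x0 t0 x1 -> Rt pr x1 = Fin r1 ->
  forall x' r', Rt pr x' = Fin r' -> r1 <= r' + K * n1 dx (vsub x1 x').
Proof.
  intros HB0 Hlm.
  destruct (C11_grad_Lip _ _ _ _ (C11_fit pr HdPhi HC2 B)) as (Kg & HKg & HG).
  destruct (gHW_bound pr Hmu HWWt) as (KH & HKH & HHW).
  pose proof (pos_INR dx) as Hdx.
  (* Bounds the l1 norm of [vsub x1 x0]. *)
  set (E := INR dx * (2 * B)). assert (HE : 0 <= E) by (unfold E; apply Rmult_le_pos; lra).
  exists (pkappa pr * Kg + lmax / 2 * (KH * E)).
  assert (HK1 : 0 <= pkappa pr * Kg) by nra.
  assert (HK2 : 0 <= lmax / 2 * (KH * E)) by (repeat apply Rmult_le_pos; lra).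
  split; [lra|]. intros lam x0 t0 x1 r1 Hlam Hx0 Hx1 Ht0 HS1 Hr1 x' r' Hr'.
  pose proof (Step1_subgradient pr Hmu Hkappa HRc HdPhi HC2 lam x0 t0 x1 r1
                (proj1 Hlam) Ht0 HS1 Hr1 x' r' Hr') as Hsub.
  set (G := fun i => _) in Hsub.
  enough (dot dx G (vsub x' x1) <= (pkappa pr * Kg + lmax / 2 * (KH * E)) * n1 dx (vsub x1 x'))
    by lra.
  rewrite n1_vsub_sym. unfold dot, n1. rewrite <- sumR_scal. apply sumR_le. intros i Hi.
  eapply Rle_trans; [apply Rle_abs|]. rewrite Rabs_mult.
  apply Rmult_le_compat_r; [apply Rabs_pos|]. unfold G.
  eapply Rle_trans; [apply Rabs_triang|]. rewrite !Rabs_mult, !(Rabs_pos_eq (pkappa pr)),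
    !(Rabs_pos_eq (lam / 2)) by lra.
  assert (Hdom0 : dom pr B (join pr x1 t0)) by now apply dom_join.
  apply Rplus_le_compat.
  - apply Rmult_le_compat_l; [lra|].
    apply (HG i _ _ ltac:(unfold dimz; lia) Hdom0 Hdom0).
  - apply Rmult_le_compat; [lra|apply Rabs_pos|lra|].
    eapply Rle_trans; [now apply HHW|]. apply Rmult_le_compat_l; [exact HKH|].
    eapply Rle_trans; [apply nrm_le_n1|]. unfold E. rewrite <- sumR_const.
    apply sumR_le. intros k Hk. specialize (Hx0 k Hk). specialize (Hx1 k Hk). unfold vsub, Rminus.
    eapply Rle_trans; [apply Rabs_triang|]. rewrite Rabs_Ropp. lra.
Qed.

End Convergence.

(** * The generated sequence *)

Section Sequences.
Variable pr : problem.
Variables (lamx : nat -> R) (lamt lmin lmax : R).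
Notation dx := (dimx pr).
Notation dt := (dimt pr).
Hypothesis Hkappa : pkappa pr > 0.
Hypothesis Hmu : pmu pr > 0.
Hypothesis HRp : proper_fun (Rt pr).
Hypothesis HRl : lsc_fun dx (Rt pr).
Hypothesis HRc : convex_fun (Rt pr).
Hypothesis HLb : exists c, forall x th, ele (Fin c) (Lobj pr x th).
Hypothesis HdPhi : Phi_partials pr.
Hypothesis HC2 : Phi_second_partials pr.
Hypothesis HWWt : orthonormal_rows pr.
Hypothesis Hlmin : 0 < lmin.
Hypothesis Hlamx : forall k, lmin <= lamx k <= lmax.
Hypothesis Hlamt : lmin <= lamt <= lmax.

Lemma iterates_inC xs ts K : Init pr (xs O) (ts O) ->
  (forall k, (k < K)%nat -> Step pr (lamx k) lamt (xs k) (ts k) (xs (S k)) (ts (S k))) ->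
  inC pr (ts K).
Proof.
  intros [_ H0] HS. destruct K as [|K]; [exact H0|].
  apply (Step_inC pr (lamx K) lamt (xs K) (ts K) (xs (S K))). apply HS. lia.
Qed.

Variables (xs ts : nat -> vec).
Hypothesis HG : Generated pr lamx lamt xs ts.

Lemma ts_inC k : inC pr (ts k).
Proof. destruct HG as [H0 HS]. apply (iterates_inC xs ts k); auto. Qed.

Definition stepcost (k : nat) : R :=
  lmin / 2 * (pkappa pr * sqn dt (vsub (ts (S k)) (ts k)) + HW pr (vsub (xs (S k)) (xs k))).

Lemma stepcost_nonneg k : 0 <= stepcost k.
Proof.
  unfold stepcost. pose proof (HW_nonneg pr Hmu (vsub (xs (S k)) (xs k))).
  pose proof (sqn_nonneg dt (vsub (ts (S k)) (ts k))).
  apply Rmult_le_pos; [lra|]. apply Rplus_le_le_0_compat; [|assumption].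
  apply Rmult_le_pos; lra.
Qed.

Lemma sufficient_decrease k :
  ele (eadd (Lobj pr (xs (S k)) (ts (S k))) (Fin (stepcost k))) (Lobj pr (xs k) (ts k)).
Proof.
  apply (Step_decrease pr lmin Hkappa Hmu (lamx k) lamt).
  - apply Hlamx.
  - apply Hlamt.
  - apply ts_inC.
  - apply HG.
Qed.

(** Belongs to iterate [S k], an output of step (1), where [R] is finite; the default 0 never
    occurs. *)
Definition Rval (k : nat) : R := match Rt pr (xs (S k)) with Fin r => r | PInf => 0 end.

Lemma Rval_eq k : Rt pr (xs (S k)) = Fin (Rval k).
Proof.
  unfold Rval.
  destruct (Step1_finite pr HRp (lamx k) (xs k) (ts k) (xs (S k)) (ts_inC k)) as [r ->];
    [apply HG|reflexivity].
Qed.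

(* Indexed from the first iterate, since L may be infinite at the initial point. *)
Definition Lval (k : nat) : R := Rval k + pkappa pr * fit pr (xs (S k)) (ts (S k)).

Lemma Lval_eq k : Lobj pr (xs (S k)) (ts (S k)) = Fin (Lval k).
Proof. rewrite Lobj_in by apply ts_inC. rewrite Rval_eq. reflexivity. Qed.

Lemma Lval_decrease k : Lval (S k) + stepcost (S k) <= Lval k.
Proof. pose proof (sufficient_decrease (S k)) as H. rewrite !Lval_eq in H. exact H. Qed.

Lemma Lval_bounded : exists c, forall k, c <= Lval k.
Proof.
  destruct HLb as [c Hc]. exists c. intros k. specialize (Hc (xs (S k)) (ts (S k))).
  rewrite Lval_eq in Hc. exact Hc.
Qed.

Lemma stepcost_cv0 : Un_cv stepcost 0.
Proof.
  (* [Lval] starts at the first computed iterate, so its decrements control the costs from index 1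
     on. *)
  destruct Lval_bounded as [c Hc]. apply (Un_cv_unshift _ _ 1).
  apply (decrements_cv0 Lval (fun k => stepcost (S k)) c); auto using Lval_decrease, stepcost_nonneg.
Qed.

Lemma HW_step_cv0 : Un_cv (fun k => HW pr (vsub (xs (S k)) (xs k))) 0.
Proof.
  apply Un_cv_squeeze0 with (fun k => 2 / lmin * stepcost k); [|apply Un_cv_scal0, stepcost_cv0].
  intros k. split; [now apply HW_nonneg|]. unfold stepcost.
  rewrite <- Rmult_assoc. replace (2 / lmin * (lmin / 2)) with 1 by (field; lra).
  pose proof (sqn_nonneg dt (vsub (ts (S k)) (ts k))).
  assert (0 <= pkappa pr * sqn dt (vsub (ts (S k)) (ts k))) by (apply Rmult_le_pos; lra). lra.
Qed.

Lemma HW_step_quadratic : exists N, forall k, (N <= k)%nat ->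
  HW pr (vsub (xs (S k)) (xs k)) = / (2 * pmu pr) * sqn dx (vsub (xs (S k)) (xs k)).
Proof.
  destruct (HW_step_cv0 (pmu pr / 2)) as [N HN]; [lra|]. exists N. intros k Hk.
  apply HW_quadratic; auto. specialize (HN k Hk). unfold Rdist in HN.
  rewrite Rminus_0_r, Rabs_pos_eq in HN by now apply HW_nonneg. exact HN.
Qed.

Lemma nrm_cv0 d (u : nat -> vec) : Un_cv (fun k => sqn d (u k)) 0 -> Un_cv (fun k => nrm d (u k)) 0.
Proof.
  intros H e He. destruct (H (e * e / 4)) as [N HN]; [nra|]. exists N. intros k Hk.
  specialize (HN k Hk). unfold Rdist in *. rewrite Rminus_0_r in *.
  rewrite Rabs_pos_eq in * by auto using sqn_nonneg, nrm_nonneg.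
  apply Rle_lt_trans with (e / 2); [|lra]. apply nrm_le_of_sqr; lra.
Qed.

Lemma steps_vanish : Un_cv (fun k => nrm dx (vsub (xs (S k)) (xs k))
                                   + nrm dt (vsub (ts (S k)) (ts k))) 0.
Proof.
  rewrite <- (Rplus_0_l 0).
  apply (CV_plus (fun k => nrm dx (vsub (xs (S k)) (xs k)))); apply nrm_cv0.
  - destruct HW_step_quadratic as [N HN]. apply (Un_cv_unshift _ _ N).
    apply Un_cv_ext with (fun k => 2 * pmu pr * HW pr (vsub (xs (S (N + k))) (xs (N + k)%nat))).
    + intros k. rewrite HN by lia. field. lra.
    + apply Un_cv_scal0.
      apply (Un_cv_shift (fun k => HW pr (vsub (xs (S k)) (xs k))) 0 N), HW_step_cv0.
  - apply Un_cv_squeeze0 with (fun k => 2 / (lmin * pkappa pr) * stepcost k);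
      [|apply Un_cv_scal0, stepcost_cv0].
    intros k. split; [apply sqn_nonneg|]. unfold stepcost.
    pose proof (HW_nonneg pr Hmu (vsub (xs (S k)) (xs k))).
    replace (2 / (lmin * pkappa pr) * _) with
      (sqn dt (vsub (ts (S k)) (ts k)) + / pkappa pr * HW pr (vsub (xs (S k)) (xs k)))
      by (field; lra).
    assert (0 <= / pkappa pr * HW pr (vsub (xs (S k)) (xs k)))
      by (apply Rmult_le_pos; [left; now apply Rinv_0_lt_compat|assumption]).
    lra.
Qed.

Lemma lmax_pos : 0 < lmax.
Proof. lra. Qed.

Hypothesis HB : exists B, forall k, nrm dx (xs k) <= B.

Lemma xs_bounded : exists B, 0 <= B /\ forall k i, (i < dx)%nat -> Rabs (xs k i) <= B.
Proof.
  destruct HB as [B H]. exists B. split.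
  - eapply Rle_trans; [apply nrm_nonneg|apply (H O)].
  - intros k i Hi. eapply Rle_trans; [exact (nrm_coord dx (xs k) i Hi)|apply H].
Qed.

Lemma ts_bounded : exists B, 0 <= B /\ forall k i, (i < dt)%nat -> Rabs (ts k i) <= B.
Proof.
  destruct (fin_max dt (fun i K => Rabs (plo pr i) + Rabs (phi pr i) <= K)) as (B & HB0 & HBi).
  { intros. lra. }
  { intros. eexists. apply Rle_refl. }
  exists B. split; [exact HB0|]. intros k i Hi. specialize (HBi i Hi).
  destruct (ts_inC k i Hi). unfold Rabs in *; repeat destruct Rcase_abs in *; lra.
Qed.

Notation pd k x t := (pdist dx dt (xs k) (ts k) x t).

(** Extraction from the joint vectors gives one subsequence for x and theta; the offset [N] places
    it beyond any prescribed index. *)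
Lemma cluster_point N : exists phi z, (forall k, (phi k < phi (S k))%nat) /\
  vcv dx (fun k => xs (N + phi k)%nat) z /\ vcv dt (fun k => ts (N + phi k)%nat) (blk dx z).
Proof.
  destruct xs_bounded as (B1 & HB1 & Hx), ts_bounded as (B2 & HB2 & Ht).
  destruct (Bolzano_Weierstrass_vec (dimz pr) (fun k => join pr (xs (N + k)%nat) (ts (N + k)%nat))
              (B1 + B2)) as (phi & z & Hphi & Hz).
  { intros k i Hi. unfold join. destruct (Nat.ltb_spec i dx) as [H|H].
    - specialize (Hx (N + k)%nat i H). lra.
    - specialize (Ht (N + k)%nat (i - dx)%nat). unfold dimz in Hi.
      specialize (Ht ltac:(lia)). lra. }
  exists phi, z. split; [exact Hphi|]. split; intros i Hi.
  - apply Un_cv_ext with (2 := Hz i ltac:(unfold dimz; lia)). intros k. now apply join_l.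
  - apply Un_cv_ext with (2 := Hz (dx + i)%nat ltac:(unfold dimz; lia)). intros k. apply join_r.
Qed.

Lemma pdist_cv0 (u v : nat -> vec) x t : vcv dx u x -> vcv dt v t ->
  Un_cv (fun k => pdist dx dt (u k) (v k) x t) 0.
Proof.
  intros Hu Hv. apply Un_cv_squeeze0 with (fun k => nrm dx (vsub (u k) x) + nrm dt (vsub (v k) t)).
  - intros k. split; [apply pdist_nonneg|apply pdist_le_nrm].
  - rewrite <- (Rplus_0_l 0). apply (CV_plus (fun k => nrm dx (vsub (u k) x))); now apply vcv_nrm.
Qed.

Lemma vcv_bound d (u : nat -> vec) l B :
  vcv d u l -> (forall k i, (i < d)%nat -> Rabs (u k i) <= B) ->
  forall i, (i < d)%nat -> Rabs (l i) <= B.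
Proof.
  intros Hu H i Hi.
  apply (@Rle_cv_lim (fun k => Rabs (u k i)) (fun _ => B)); auto using Un_cv_const.
  apply cv_cvabs. now apply Hu.
Qed.

(* R is only lower semicontinuous: the upper bound for its values along the subsequence
   comes from the subgradient inequality of step (1), with bounded subgradients. *)
Lemma objective_at_cluster_point N phi x t ls :
  (forall k, (phi k < phi (S k))%nat) ->
  vcv dx (fun k => xs (S (N + phi k))) x -> vcv dt (fun k => ts (S (N + phi k))) t ->
  Un_cv (fun k => Lval (N + phi k)) ls -> Lobj pr x t = Fin ls.
Proof.
  intros Hphi Hx Ht Hl.
  destruct xs_bounded as (B & HB0 & HxB).
  assert (HtC : inC pr t).
  { apply (box_closed dt (plo pr) (Defs.phi pr) (fun k => ts (S (N + phi k)))); [exact Ht|].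
    intros k. apply ts_inC. }
  assert (HxB' : forall i, (i < dx)%nat -> Rabs (x i) <= B).
  { apply (vcv_bound dx _ x B Hx). intros k i Hi. now apply HxB. }
  assert (Hfit : Un_cv (fun k => pkappa pr * fit pr (xs (S (N + phi k))) (ts (S (N + phi k))))
                   (pkappa pr * fit pr x t)).
  { apply (CV_mult (fun _ => pkappa pr)); [apply Un_cv_const|].
    destruct (proj1 (C11_fit pr HdPhi HC2 B)) as (K & HK & HL).
    assert (H0 : Un_cv (fun k => K * (n1 dx (vsub (xs (S (N + phi k))) x)
                                      + n1 dt (vsub (ts (S (N + phi k))) t))) 0).
    { apply Un_cv_scal0. rewrite <- (Rplus_0_l 0).
      apply (CV_plus (fun k => n1 dx (vsub (xs (S (N + phi k))) x))).
      - now apply (vcv_n1 dx (fun k => xs (S (N + phi k)))).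
      - now apply (vcv_n1 dt (fun k => ts (S (N + phi k)))). }
    intros e He. destruct (H0 e He) as [N0 HN0]. exists N0. intros k Hk. specialize (HN0 k Hk).
    unfold Rdist in *. rewrite Rminus_0_r in HN0.
    eapply Rle_lt_trans; [|eapply Rle_lt_trans; [apply Rle_abs|exact HN0]].
    rewrite <- n1_join, <- (fit_join pr (xs _)), <- (fit_join pr x).
    apply HL; apply dom_join; auto using ts_inC. }
  assert (Hlow : ele (eadd (Rt pr x) (Fin (pkappa pr * fit pr x t))) (Fin ls)).
  { apply (lsc_vcv pr HRl (fun k => xs (S (N + phi k))) x ls _ _ Hx Hfit).
    intros eps He. destruct (Hl eps He) as [N0 HN0]. exists N0. intros k Hk.
    specialize (HN0 k Hk). unfold Rdist in HN0. apply Rabs_def2 in HN0.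
    rewrite Rval_eq. simpl. unfold Lval in HN0. lra. }
  rewrite Lobj_in by exact HtC. destruct (Rt pr x) as [r|] eqn:Hr; [|contradiction].
  simpl in *. f_equal. apply Rle_antisym; [exact Hlow|].
  (* The remaining inequality: the limit [ls] of the values is at most L(x, t). *)
  destruct (Step1_value_bound pr lmax Hkappa Hmu HRc HdPhi HC2 HWWt B HB0 (Rlt_le _ _ lmax_pos))
    as (K & HK & Hval).
  apply (@Rle_cv_lim (fun k => Lval (N + phi k))
     (fun k => (r + K * n1 dx (vsub (xs (S (N + phi k))) x))
               + pkappa pr * fit pr (xs (S (N + phi k))) (ts (S (N + phi k))))).
  - intros k. unfold Lval. apply Rplus_le_compat_r.
    apply (Hval (lamx (N + phi k)) (xs (N + phi k)%nat) (ts (N + phi k)%nat)); auto using ts_inC.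
    + specialize (Hlamx (N + phi k)). lra.
    + apply HG.
    + apply Rval_eq.
  - exact Hl.
  - apply CV_plus; [|exact Hfit]. replace r with (r + 0) at 1 by ring.
    apply (CV_plus (fun _ => r)); [apply Un_cv_const|]. apply Un_cv_scal0.
    now apply (vcv_n1 dx (fun k => xs (S (N + phi k)))).
Qed.

(** [Lval k] is the value at iterate [S k], so the step from iterate k to [S k] lowers
    [Lval (pred k)] to [Lval k]. [N] marks the quadratic regime of the Huber term, and [a] is the
    smaller of the coefficients lmin kappa / 2 and lmin / (4 mu). *)
Lemma quadratic_decrease : exists a N, a > 0 /\ forall k, (N <= k)%nat ->
  Lval k + a * (pdist dx dt (xs (S k)) (ts (S k)) (xs k) (ts k)
                * pdist dx dt (xs (S k)) (ts (S k)) (xs k) (ts k)) <= Lval (pred k).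
Proof.
  destruct HW_step_quadratic as [N HN].
  set (a1 := lmin / 2 * pkappa pr). set (a2 := lmin / 2 * / (2 * pmu pr)).
  assert (Hinv : 0 < / (2 * pmu pr)) by (apply Rinv_0_lt_compat; lra).
  assert (Ha1 : 0 < a1) by (apply Rmult_lt_0_compat; lra).
  assert (Ha2 : 0 < a2) by (apply Rmult_lt_0_compat; lra).
  exists (Rmin a1 a2), (S N). split; [now apply Rmin_glb_lt|]. intros [|k] Hk; [lia|].
  rewrite pdist_sqr. pose proof (Lval_decrease k) as H. unfold stepcost in H.
  rewrite HN in H by lia.
  set (X := sqn dx _) in *. set (T := sqn dt _) in *.
  assert (HX : 0 <= X) by apply sqn_nonneg. assert (HT : 0 <= T) by apply sqn_nonneg.
  pose proof (Rmult_le_compat_r X _ _ HX (Rmin_r a1 a2)) as H1.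
  pose proof (Rmult_le_compat_r T _ _ HT (Rmin_l a1 a2)) as H2.
  simpl pred. unfold a1 in H2 at 2. unfold a2 in H1 at 2. lra.
Qed.

(** Subgradients at the iterates are bounded by the steps and tend to 0, and the values tend to the
    value at the cluster point, which is therefore critical. Only then is the Kurdyka-Lojasiewicz
    inequality invoked there, to pass from a subsequence to the whole sequence. *)
Lemma convergence_to_critical_point : KL_fun dx dt (Lobj pr) ->
  exists xst tst, Un_cv (fun k => pd k xst tst) 0 /\
                  limiting_sub dx dt (Lobj pr) xst tst zerov zerov.
Proof.
  intros HKL.
  destruct xs_bounded as (B & HB0 & HxB).
  destruct quadratic_decrease as (a & N & Ha & Hdec).
  destruct (Step_subgradient pr lmax Hkappa Hmu HRp HRc HdPhi HC2 HWWt B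
              (Rlt_le _ _ lmax_pos)) as (b & Hb & Hsub).
  set (step := fun k => pdist dx dt (xs (S k)) (ts (S k)) (xs k) (ts k)).
  assert (Hstep0 : Un_cv step 0).
  { apply Un_cv_squeeze0 with (2 := steps_vanish). intros k.
    split; [apply pdist_nonneg|apply pdist_le_nrm]. }
  assert (Hw : forall k, exists w, frechet_sub dx dt (Lobj pr) (xs (S k)) (ts (S k)) w (blk dx w) /\
                 nrm (dimz pr) w <= b * step k).
  { intros k. apply (Hsub (lamx k) lamt); auto using ts_inC.
    - specialize (Hlamx k). lra.
    - lra.
    - apply HG. }
  set (w := fun k => proj1_sig (constructive_indefinite_description _ (Hw k))).
  assert (Hws : forall k, frechet_sub dx dt (Lobj pr) (xs (S k)) (ts (S k)) (w k) (blk dx (w k)) /\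
                 nrm (dimz pr) (w k) <= b * step k).
  { intros k. unfold w. now destruct constructive_indefinite_description. }
  clearbody w.
  assert (Hwn : forall k, pdist dx dt (w k) (blk dx (w k)) zerov zerov = nrm (dimz pr) (w k)).
  { intros k. unfold pdist, nrm. f_equal. unfold sqn. rewrite dot_dimz. f_equal;
      apply sumR_ext; intros i _; unfold vsub, zerov; ring. }
  destruct (cluster_point (S N)) as (phi & z & Hphi & Hx & Ht).
  set (x := z) in *. set (t := blk dx z) in *.
  destruct Lval_bounded as [c Hc].
  destruct (decreasing_bounded_cv Lval c) as [ls Hls]; [|exact Hc|].
  { intros k. pose proof (Lval_decrease k). pose proof (stepcost_nonneg (S k)). lra. }
  assert (Hlphi : Un_cv (fun k => Lval (N + phi k)) ls).
  { apply (Un_cv_subseq (fun k => Lval (N + k)) ls phi Hphi). now apply Un_cv_shift. }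
  assert (HL : Lobj pr x t = Fin ls).
  { now apply (objective_at_cluster_point N phi x t ls Hphi). }
  pose proof (pdist_cv0 _ _ _ _ Hx Ht) as Hr.
  assert (Hcrit : limiting_sub dx dt (Lobj pr) x t zerov zerov).
  { exists ls, (fun k => xs (S N + phi k)%nat), (fun k => ts (S N + phi k)%nat),
      (fun k => w (N + phi k)%nat), (fun k => blk dx (w (N + phi k)%nat)),
      (fun k => Lval (N + phi k)).
    split; [exact HL|]. split; [|split; [exact Hr|split; [exact Hlphi|]]].
    - intros k. split; [apply Lval_eq|apply Hws].
    - apply Un_cv_squeeze0 with (fun k => b * step (N + phi k)%nat).
      + intros k. split; [apply pdist_nonneg|]. rewrite Hwn. apply Hws.
      + apply Un_cv_scal0. apply (Un_cv_subseq (fun k => step (N + k)%nat) 0 phi Hphi).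
        now apply Un_cv_shift. }
  exists x, t. split; [|exact Hcrit].
  (* [KL_fun] asks for a nonempty limiting subdifferential; criticality provides the zero vector. *)
  destruct (HKL x t (ex_intro _ zerov (ex_intro _ zerov Hcrit)))
    as (a' & eta & del & ph & dph & Ha' & Heta & Hdel & Hp0 & Hp1 & Hp2 & Hp3 & Hp4 & Hineq).
  rewrite HL in Ha'. injection Ha' as <-.
  apply (Un_cv_unshift _ _ (S N)).
  (* [Lval] and [w] at index N + k both belong to iterate S N + k, whence the different offsets. *)
  apply (KL_convergence (fun k => pd (S N + k)%nat x t) (fun k => step (S N + k)%nat)
           (fun k => Lval (N + k)) (fun k => nrm (dimz pr) (w (N + k)%nat))
           ls a b eta del ph dph); auto.
  - unfold desingularizing. repeat split; auto; now apply Hp4.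
  - intros k. apply pdist_nonneg.
  - intros k. apply pdist_nonneg.
  - intros k. rewrite Nat.add_succ_r. apply pdist_triang.
  - intros k. rewrite Nat.add_succ_r. specialize (Hdec (S (N + k))%nat ltac:(lia)). exact Hdec.
  - intros k. rewrite Nat.add_succ_r. split; [apply nrm_nonneg|]. exact (proj2 (Hws (S (N + k)))).
  - now apply Un_cv_shift.
  - now apply Un_cv_shift.
  - intros eps N0 He. destruct (Hr eps He) as [N1 HN1]. exists (phi (N0 + N1)%nat). split.
    + pose proof (strict_mono_ge phi Hphi (N0 + N1)). lia.
    + specialize (HN1 (N0 + N1)%nat ltac:(lia)). unfold Rdist in HN1.
      rewrite Rminus_0_r, Rabs_pos_eq in HN1 by apply pdist_nonneg. exact HN1.
  - intros k Hk Hlk. rewrite <- Hwn.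
    apply (Hineq (xs (S N + k)%nat) (ts (S N + k)%nat)).
    + exact Hk.
    + apply Lval_eq.
    + exact Hlk.
    + apply limiting_of_frechet. apply Hws.
Qed.

End Sequences.

Theorem theorem1 (pr : problem) (lamx : nat -> R) (lamt lmin lmax : R)
  (* dimensions *)
  (Hm : (1 <= pm pr)%nat) (Hn : (1 <= pn pr)%nat) (HM : (1 <= pM pr <= pn pr)%nat)
  (HP : (1 <= pP pr)%nat) (HN : (pn pr <= pN pr)%nat)
  (* parameters *)
  (Hkappa : pkappa pr > 0) (Hmu : pmu pr > 0)
  (Hbox : forall i, (i < dimt pr)%nat -> plo pr i <= phi pr i)
  (* R proper, lsc, convex on R^{(m+1)n} *)
  (HRp : proper_fun (Rt pr)) (HRl : lsc_fun (dimx pr) (Rt pr)) (HRc : convex_fun (Rt pr))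
  (* L bounded below *)
  (HLb : exists c, forall x th, ele (Fin c) (Lobj pr x th))
  (* Phi is C^2: pdPhi are its first partials, which have continuous partials *)
  (HdPhi : forall p r c th, (p < pP pr)%nat -> (r < pn pr)%nat -> (c < pn pr)%nat ->
     derivable_pt_lim (fun s => Phit pr (upd th p s) r c) (th p) (pdPhi pr p th r c))
  (HC2 : exists d2Phi : nat -> nat -> vec -> nat -> nat -> R,
     forall p p' r c, (p < pP pr)%nat -> (p' < pP pr)%nat -> (r < pn pr)%nat -> (c < pn pr)%nat ->
       (forall th, derivable_pt_lim (fun s => pdPhi pr p (upd th p' s) r c) (th p')
                     (d2Phi p p' th r c)) /\
       cont_fun (pP pr) (fun th => d2Phi p p' th r c))
  (* W W^T = I *)
  (HWWt : forall r r', (r < dimx pr)%nat -> (r' < dimx pr)%nat ->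
     sumR (dimW pr) (fun c => pW pr r c * pW pr r' c) = if Nat.eqb r r' then 1 else 0)
  (* step sizes *)
  (Hlmin : 0 < lmin) (Hlminmax : lmin <= lmax)
  (Hlamx : forall k, lmin <= lamx k <= lmax) (Hlamt : lmin <= lamt <= lmax) :
  WellDefined pr lamx lamt /\
  forall xs ts : nat -> vec, Generated pr lamx lamt xs ts ->
    (* 1. sufficient decrease *)
    (forall k, ele (eadd (Lobj pr (xs (S k)) (ts (S k)))
                        (Fin (lmin / 2 * (pkappa pr * sqn (dimt pr) (vsub (ts (S k)) (ts k))
                                          + HW pr (vsub (xs (S k)) (xs k))))))
                   (Lobj pr (xs k) (ts k))) /\
    (forall k, ele (Lobj pr (xs (S k)) (ts (S k))) (Lobj pr (xs k) (ts k))) /\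
    (* 2. vanishing steps *)
    Un_cv (fun k => nrm (dimx pr) (vsub (xs (S k)) (xs k))
                    + nrm (dimt pr) (vsub (ts (S k)) (ts k))) 0 /\
    (* 3. convergence to a critical point under KL and boundedness *)
    (KL_fun (dimx pr) (dimt pr) (Lobj pr) ->
     (exists B, forall k, nrm (dimx pr) (xs k) <= B) ->
     exists xst tst,
       Un_cv (fun k => pdist (dimx pr) (dimt pr) (xs k) (ts k) xst tst) 0 /\
       limiting_sub (dimx pr) (dimt pr) (Lobj pr) xst tst zerov zerov).
Proof.
  split.
  (* Any finite run can be prolonged: its last theta lies in the box, and one more step exists from
     there. *)
  - intros xs ts K H0 HS. apply (Step_exists pr Hmu HRp HRl HdPhi HC2 HWWt); auto.
    + specialize (Hlamx K). lra.
    + lra.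
    + now apply (iterates_inC pr lamx lamt xs ts).
  - intros xs ts HG.
    pose proof (sufficient_decrease pr lamx lamt lmin lmax Hkappa Hmu Hlamx Hlamt xs ts HG)
      as Hdec.
    split; [exact Hdec|]. split; [|split].
    + intros k. eapply ele_trans; [|apply Hdec].
      pose proof (stepcost_nonneg pr lmin Hkappa Hmu Hlmin xs ts k).
      destruct (Lobj pr (xs (S k)) (ts (S k))); simpl; [lra|exact I].
    + now apply (steps_vanish pr lamx lamt lmin lmax).
    + intros HKL HB. now apply (convergence_to_critical_point pr lamx lamt lmin lmax).
Qed.
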